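(* Let $\Gamma$ be a finite ranked cyclic poset. Then $\Gamma$ is weakly Cohen-Macaulay (relative to $\mathbb{F}$) if and only if the algebra $R_\Gamma$ is Koszul.
   Context: Fix a field $\mathbb{F}$. All posets $\Gamma$ are finite with a unique minimal element $*$. Write $x\to y$ (or $y\leftarrow x$) if $x$ covers $y$; the (Hasse) graph of a poset has the covering relations as edges. $\Gamma$ is ranked if for every $b\in\Gamma$ any two maximal chains in $[*,b]$ have the same length, which is the rank $rk_\Gamma(b)$. The rank of $\Gamma$ is the maximal rank of its elements. $\Gamma_+=\Gamma\setminus\{*\}$; $\Gamma(k)$ is the set of elements of rank $k$; $\Gamma_x=[*,x]$; $\Gamma$ is cyclic if $\Gamma=\Gamma_x$ for some $x$. Algebra: $R_\Gamma$ is the graded $\mathbb{F}$-algebra with degree one generators $r_x$, $x\in\Gamma_+$, and relations $r_x\sum_{x\to y}r_y=0$ (sum over $y\in\Gamma_+$ covered by $x$) for all $x \in \Gamma_+$, and $r_xr_w=0$ whenever $x,w\in\Gamma_+$ and $x\not\to w$. A connected graded $\mathbb{F}$-algebra $A$ is Koszul if the trivial right $A$-module $\mathbb{F}_A$ has a linear projective resolution (the $i$-th term is generated in degree $i$). Sets $T_n,M_n$: for $W\subset\Gamma(n)$ put $r_W=\sum_{z\in W}r_z$. For $u,v\in\Gamma_+$ write $u\sim^W v$ if, for every $q=\sum_{z\in\Gamma_+}q_zr_z$ ($q_z\in\mathbb{F}$), $r_Wq=0$ implies $q_u=q_v$. This is an equivalence relation, with classes $[z]^W$. If $\Gamma=\Gamma_x$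 has rank $d\ge 1$, put $T_d(\Gamma)=\{\{x\}\}$ and, for $d-1\ge i\ge1$, $T_i(\Gamma)=\{[z_0]^W\subset\Gamma_+ : W\in T_{i+1}(\Gamma)\text{ and there is } s\in W\text{ with } s\to z_0\}$. For $W\subset\Gamma(n)$ put $\Gamma_W=\bigcup_{s\in W}[*,s]$ and $\Gamma(W,k)=\{a\in\Gamma_W: rk_\Gamma(a)\ge n-k\}$ for $0\le k\le n-1$ (for $n=k=1$ use the same formula). $W$ is linked if $\Gamma(W,1)$ is connected as a graph; $W'\subseteq W$ is maximally linked relative to $W$ if it is maximal among linked subsets of $W$. $M_n(\Gamma)$ is the set of all $W'$ that are maximally linked relative to some $W\in T_n(\Gamma)$. Complex $S^\bullet$: for a finite ranked poset $P$ with minimal element $*$, let $S^n(P_+)=\bigoplus_{rk_P(x)=n+1}\tilde H^{n-1}(\Delta(( *,x)))$ for $n\ge0$, where $\Delta$ is the order complex, $\tilde H$ is reduced simplicial cohomology with coefficients in $\mathbb{F}$, and $\tilde H^{-1}$ of the empty complex is $\mathbb{F}$. For $rk_P(x)=n+1$ with $n>0$, $\tilde H^{n-1}(\Delta(( *,x)))$ is spanned by the classes $[x_1\leftarrow\cdots\leftarrow x_n]_x$ of maximal chains of $( *,x)$; for $n=0$ it is spanned by $[1]_x$. The differential $S^n(P_+)\to S^{n+1}(P_+)$ is the (well-defined) linear map with $[1]_x\mapsto\sum_{y\to x}[x]_y$ and $[x_1\leftarrow\cdots\leftarrow x_n]_x\mapsto(-1)^n\sum_{y\to x}[x_1\leftarrow\cdots\leftarrow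 x_n\leftarrow x]_y$. For $W\subset\Gamma(n)$ and $0\le k<n$, $S^\bullet(\Gamma(W,k))$ denotes $S^\bullet(P_+)$ for $P=\Gamma(W,k)\sqcup\{*\}$ with $*$ adjoined as minimal element. Definition: a cyclic $\Gamma$ is weakly Cohen-Macaulay if for all $x\in\Gamma_+$, all integers $2\le k<n\le rk_\Gamma(x)$ and all $W\in M_n(\Gamma_x)$, $H^{k-1}(S^\bullet(\Gamma(W,k)))=0$. *)

(* Defs.v *)
From HB Require Import structures.
From mathcomp Require Import all_boot all_order all_algebra.
From mathcomp Require Import boolp.
From mathcomp.multinomials Require Import monalg.

Set Implicit Arguments.
Unset Strict Implicit.
Unset Printing Implicit Defensive.

Import Order.TTheory GRing.Theory.

Local Open Scope ring_scope.
Local Open Scope quotient_scope.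

(* Finite posets with a unique minimal element are modelled by finBPOrderType:
   in a finite poset a unique minimal element is the minimum \bot. *)

Section Posets.
Context {d : Order.disp_t}.
Implicit Types G : finBPOrderType d.

(* covers x y is the relation x -> y *)
Definition covers G (x y : G) : bool :=
  (y < x)%O && [forall z : G, ~~ ((y < z)%O && (z < x)%O)].

Definition is_chain G (C : {set G}) : bool :=
  [forall x in C, forall y in C, (x >=< y)%O].

Definition max_chain G (b : G) (C : {set G}) : bool :=
  maxset (fun C => (C \subset [set y | (y <= b)%O]) && is_chain C) C.

Definition ranked G : Prop :=
  forall (b : G) (C C' : {set G}),
    max_chain b C -> max_chain b C' -> #|C| = #|C'|.

(* The length of a chain is its cardinality minus one; when G is ranked the
   maximum below is over equal values. *)
Definition rk G (b : G) : nat := (\max_(C : {set G} | max_chain b C) #|C|).-1.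

Definition cyclic_poset G : Prop := exists x : G, forall y : G, (y <= x)%O.

Record plus G := Plus { plus_val :> G; _ : plus_val != \bot%O }.

HB.instance Definition _ G := [isSub for @plus_val G].
HB.instance Definition _ G := [Finite of plus G by <:].

(* A with the minimal element of G adjoined, ordered as in G *)
Record subposet G (A : {set G}) := SubPoset {
  subposet_val :> G;
  _ : (subposet_val == \bot%O) || (subposet_val \in A) }.

HB.instance Definition _ G (A : {set G}) := [isSub for @subposet_val G A].
HB.instance Definition _ G (A : {set G}) := [Finite of subposet A by <:].
HB.instance Definition _ G (A : {set G}) :=
  [SubChoice_isSubPOrder of subposet A by <: with d].

Lemma subposet_bot_subproof G (A : {set G}) :
  (\bot%O == \bot%O :> G) || (\bot%O \in A).
Proof. by rewrite eqxx. Qed.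

Definition subposet_bot G (A : {set G}) : subposet A :=
  SubPoset (subposet_bot_subproof A).

Lemma subposet_le0x G (A : {set G}) (y : subposet A) :
  (subposet_bot A <= y)%O.
Proof. by rewrite -Order.le_val /= le0x. Qed.

HB.instance Definition _ G (A : {set G}) :=
  Order.hasBottom.Build d (subposet A) (@subposet_le0x G A).

(* below x is Gamma_x = [*, x]; below_top x is its maximum x. *)
Definition below G (x : G) : finBPOrderType d :=
  subposet [set y | (y <= x)%O].

Lemma below_top_subproof1 G (x : plus G) :
  (val x == \bot%O) || (val x \in [set y | (y <= val x)%O]).
Proof. by rewrite inE lexx orbT. Qed.

Lemma below_top_subproof2 G (x : plus G) :
  (SubPoset (below_top_subproof1 x) : below x) != \bot%O.
Proof. by rewrite -val_eqE /= (valP x). Qed.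

Definition below_top G (x : plus G) : plus (below x) :=
  Plus (below_top_subproof2 x).

End Posets.

Section Algebra.
Variables (F : fieldType) (d : Order.disp_t) (G : finBPOrderType d).

(* the free associative F-algebra on plus G, i.e. the algebra of the free
   monoid on plus G *)
Definition freealg : Type := {malg F[{fmonom plus G}]}.

HB.instance Definition _ := GRing.Lalgebra.on freealg.

Definition gen (x : plus G) : freealg := << FMonom [:: x] >>.

Definition relator (p : freealg) : Prop :=
  (exists x : plus G, p = gen x * \sum_(y : plus G | covers (val x) (val y)) gen y)
  \/ (exists x w : plus G, ~~ covers (val x) (val w) /\ p = gen x * gen w).

(* the two-sided ideal generated by the relators *)
Definition relideal_prop (p : freealg) : Prop :=
  exists s : seq (freealg * freealg * freealg),
    (forall t, t \in s -> relator t.1.2)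
    /\ p = \sum_(t <- s) t.1.1 * t.1.2 * t.2.

Definition relideal : pred freealg := fun p => `[< relideal_prop p >].

Lemma relidealP p : reflect (relideal_prop p) (p \in relideal).
Proof. exact: asboolP. Qed.

Lemma relideal_mull a p : p \in relideal -> a * p \in relideal.
Proof.
move=> /relidealP[s [hs ->]]; apply/relidealP.
exists [seq (a * t.1.1, t.1.2, t.2) | t <- s]; split.
  by move=> _ /mapP[t ts ->] /=; apply: hs.
by rewrite big_map mulr_sumr; apply: eq_bigr => t _ /=; rewrite !mulrA.
Qed.

Lemma relideal_mulr a p : p \in relideal -> p * a \in relideal.
Proof.
move=> /relidealP[s [hs ->]]; apply/relidealP.
exists [seq (t.1.1, t.1.2, t.2 * a) | t <- s]; split.
  by move=> _ /mapP[t ts ->] /=; apply: hs.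
by rewrite big_map mulr_suml; apply: eq_bigr => t _ /=; rewrite !mulrA.
Qed.

Lemma relideal_zmod_closed : zmod_closed relideal.
Proof.
split; first by apply/relidealP; exists [::]; rewrite big_nil.
move=> p q /relidealP[s [hs ->]].
rewrite -mulN1r => /(relideal_mull (-1))/relidealP[s' [hs' ->]].
apply/relidealP; exists (s ++ s'); split; last by rewrite big_cat.
by move=> t; rewrite mem_cat => /orP[/hs|/hs'].
Qed.

HB.instance Definition _ :=
  GRing.isZmodClosed.Build freealg relideal relideal_zmod_closed.

(* constant coefficient *)
Definition const_coef (p : freealg) : F := mcoeff mone p.

Lemma const_coefB p q : const_coef (p - q) = const_coef p - const_coef q.
Proof. exact: mcoeffB. Qed.

Lemma const_coefM p q : const_coef (p * q) = const_coef p * const_coef q.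
Proof. exact: (rmorphM (@mcoeff {fmonom plus G} F mone)). Qed.

Lemma const_coef1 : const_coef 1 = 1.
Proof. exact: (rmorph1 (@mcoeff {fmonom plus G} F mone)). Qed.

Lemma const_coef_gen x : const_coef (gen x) = 0.
Proof.
rewrite /const_coef /gen mcoeffU; case: eqP => // /(congr1 (@fmonom_val _)).
by rewrite fm1.
Qed.

Lemma const_coef_genM x p : const_coef (gen x * p) = 0.
Proof. by rewrite const_coefM (const_coef_gen x) mul0r. Qed.

Lemma const_coef_relideal p : p \in relideal -> const_coef p = 0.
Proof.
move=> /relidealP[s [hs ->]].
rewrite /const_coef raddf_sum big_seq big1 //= => t /hs ht.
rewrite -/(const_coef _) 2!const_coefM.
suff -> : const_coef t.1.2 = 0 by rewrite mulr0 mul0r.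
by case: ht => [[x ->]|[x [w [_ ->]]]]; apply: const_coef_genM.
Qed.

Lemma relideal1 : 1 \notin relideal.
Proof.
by apply/negP => /const_coef_relideal/eqP; rewrite const_coef1 oner_eq0.
Qed.

Lemma freealg_scaleAr (c : F) (p q : freealg) : c *: (p * q) = p * (c *: q).
Proof.
have comm : p * (c%:MP : freealg) = (c%:MP : freealg) * p.
  apply/malgP => k; rewrite !malgM_def fgmulgU fgmulUg.
  by congr (mcoeff _ _); apply: eq_bigr => m _; rewrite mulrC mulm1 mul1m.
have cm (a : freealg) : c *: a = (c%:MP : freealg) * a.
  exact: (esym (mul_malgC c a)).
transitivity ((c%:MP : freealg) * p * q); first by rewrite -mulrA; exact: cm.
by rewrite -comm -(mulrA p (c%:MP : freealg) q); congr (_ * _); exact/esym/cm.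
Qed.

Definition Ralg := Quotient.quot (GRing.ZmodClosed.clone _ relideal _).

HB.instance Definition _ := GRing.Zmodule.on Ralg.

Definition Rpi (p : freealg) : Ralg := \pi_Ralg p.

Definition Rone : Ralg := Rpi 1.
Definition Rmul (a b : Ralg) : Ralg := Rpi (repr a * repr b).
Definition Rscale (c : F) (a : Ralg) : Ralg := Rpi (c *: repr a).

Lemma Req p q : Rpi p = Rpi q <-> p - q \in relideal.
Proof.
rewrite (Quotient.idealrBE (GRing.ZmodClosed.clone _ relideal _)).
by split => [/eqP|/eqP].
Qed.

Lemma Rind (P : Ralg -> Prop) : (forall p, P (Rpi p)) -> forall a, P a.
Proof. by move=> h a; rewrite -[a]reprK; apply: h. Qed.

Lemma Rrepr p : repr (Rpi p) - p \in relideal.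
Proof. by apply/Req; rewrite /Rpi reprK. Qed.

Lemma RmulE p q : Rmul (Rpi p) (Rpi q) = Rpi (p * q).
Proof.
apply/Req.
have -> : repr (Rpi p) * repr (Rpi q) - p * q
    = (repr (Rpi p) - p) * repr (Rpi q) + p * (repr (Rpi q) - q).
  by rewrite mulrBl mulrBr addrA subrK.
by apply: rpredD; [apply: relideal_mulr | apply: relideal_mull]; apply: Rrepr.
Qed.

Lemma RscaleE c p : Rscale c (Rpi p) = Rpi (c *: p).
Proof.
apply/Req; rewrite -scalerBr -[_ - _]mul1r scalerAl.
exact/relideal_mull/Rrepr.
Qed.

Lemma RaddE p q : Rpi p + Rpi q = Rpi (p + q).
Proof. by rewrite /Rpi !piE. Qed.

Lemma RsubE p q : Rpi p - Rpi q = Rpi (p - q).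
Proof. by rewrite /Rpi !piE. Qed.

Lemma RmulA : associative Rmul.
Proof.
elim/Rind=> p; elim/Rind=> q; elim/Rind=> r.
by rewrite (RmulE q r) (RmulE p q) !RmulE; congr Rpi; apply: mulrA.
Qed.

Lemma Rmul1l : left_id Rone Rmul.
Proof. by elim/Rind=> p; rewrite (RmulE 1 p); congr Rpi; apply: mul1r. Qed.

Lemma Rmul1r : right_id Rone Rmul.
Proof. by elim/Rind=> p; rewrite (RmulE p 1); congr Rpi; apply: mulr1. Qed.

Lemma RmulDl : left_distributive Rmul +%R.
Proof.
elim/Rind=> p; elim/Rind=> q; elim/Rind=> r.
by rewrite RaddE !RmulE RaddE; congr Rpi; apply: mulrDl.
Qed.

Lemma RmulDr : right_distributive Rmul +%R.
Proof.
elim/Rind=> p; elim/Rind=> q; elim/Rind=> r.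
by rewrite RaddE !RmulE RaddE; congr Rpi; apply: mulrDr.
Qed.

Lemma Rone_neq0 : Rone != 0.
Proof.
have -> : (0 : Ralg) = Rpi 0 by rewrite /Rpi !piE.
by apply/eqP => /Req; rewrite subr0; apply/negP/relideal1.
Qed.

HB.instance Definition _ := GRing.Zmodule_isNzRing.Build Ralg
  RmulA Rmul1l Rmul1r RmulDl RmulDr Rone_neq0.

Lemma RscaleA (b c : F) (a : Ralg) : Rscale b (Rscale c a) = Rscale (b * c) a.
Proof.
elim/Rind: a => p; rewrite (RscaleE c) (RscaleE b) (RscaleE (b * c)).
by congr Rpi; apply: scalerA.
Qed.

Lemma Rscale1 : left_id 1 Rscale.
Proof. by elim/Rind=> p; rewrite (RscaleE 1); congr Rpi; apply: scale1r. Qed.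

Lemma RscaleDr : right_distributive Rscale +%R.
Proof.
move=> c; elim/Rind=> p; elim/Rind=> q.
by rewrite RaddE !RscaleE RaddE; congr Rpi; apply: scalerDr.
Qed.

Lemma RscaleDl (a : Ralg) : {morph Rscale^~ a : b c / b + c}.
Proof.
move=> b c; elim/Rind: a => p.
by rewrite !RscaleE RaddE; congr Rpi; apply: scalerDl.
Qed.

HB.instance Definition _ := GRing.Zmodule_isLmodule.Build F Ralg
  RscaleA Rscale1 RscaleDr RscaleDl.

Lemma RscaleAl (c : F) (a b : Ralg) : c *: (a * b) = (c *: a) * b.
Proof.
elim/Rind: a => p; elim/Rind: b => q; change
  (Rscale c (Rmul (Rpi p) (Rpi q)) = Rmul (Rscale c (Rpi p)) (Rpi q)).
by rewrite RmulE !RscaleE RmulE; congr Rpi; apply: scalerAl.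
Qed.

Lemma RscaleAr (c : F) (a b : Ralg) : c *: (a * b) = a * (c *: b).
Proof.
elim/Rind: a => p; elim/Rind: b => q; change
  (Rscale c (Rmul (Rpi p) (Rpi q)) = Rmul (Rpi p) (Rscale c (Rpi q))).
by rewrite RmulE !RscaleE RmulE; congr Rpi; apply: freealg_scaleAr.
Qed.

HB.instance Definition _ := GRing.Lmodule_isLalgebra.Build F Ralg RscaleAl.
HB.instance Definition _ := GRing.Lalgebra_isAlgebra.Build F Ralg RscaleAr.

Definition Rgen (x : plus G) : Ralg := Rpi (gen x).

Definition Rgr (n : nat) (a : Ralg) : Prop :=
  exists p : freealg, (forall m, mcoeff m p != 0 -> fdeg m = n) /\ a = Rpi p.

(* the augmentation, with kernel the span of the components of positive
   degree *)
Definition Raug (a : Ralg) : F := const_coef (repr a).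

Lemma RaugE p : Raug (Rpi p) = const_coef p.
Proof.
apply/eqP; rewrite -subr_eq0 -const_coefB; apply/eqP.
exact/const_coef_relideal/Rrepr.
Qed.

Lemma Raug_zmod : zmod_morphism Raug.
Proof.
elim/Rind=> p; elim/Rind=> q.
by rewrite RsubE !RaugE; apply: const_coefB.
Qed.

Lemma Raug_monoid : monoid_morphism Raug.
Proof.
split; first by rewrite [LHS]RaugE const_coef1.
elim/Rind=> p; elim/Rind=> q; change
  (Raug (Rmul (Rpi p) (Rpi q)) = Raug (Rpi p) * Raug (Rpi q)).
by rewrite RmulE !RaugE; apply: const_coefM.
Qed.

HB.instance Definition _ := GRing.isZmodMorphism.Build Ralg F Raug Raug_zmod.
HB.instance Definition _ := GRing.isMonoidMorphism.Build Ralg F Raug Raug_monoid.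

End Algebra.

(* Right A-modules are left modules over the converse ring A^c: the product
   v . a is written (a : A^c) *: v. *)

Section GradedModules.
Variables (F : fieldType) (A : algType F).

(* V is the direct sum of the subgroups gr n *)
Definition is_grading (V : zmodType) (gr : nat -> V -> Prop) : Prop :=
  [/\ forall n, gr n 0,
      forall n u v, gr n u -> gr n v -> gr n (u - v),
      forall v, exists N (f : nat -> V),
        (forall n, gr n (f n)) /\ v = \sum_(n < N) f n
    & forall N (f : nat -> V), (forall n, gr n (f n)) ->
        \sum_(n < N) f n = 0 -> forall n, (n < N)%N -> f n = 0].

Variable grA : nat -> A -> Prop.

(* The components are F-subspaces because F acts through degree 0 of A. *)
Definition graded_module (M : lmodType A^c) (gr : nat -> M -> Prop) : Prop :=
  is_grading gr /\
  forall m n (v : M) (a : A), gr m v -> grA n a -> gr (m + n)%N ((a : A^c) *: v).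

Definition projective (P : lmodType A^c) : Prop :=
  forall (M N : lmodType A^c) (f : {linear M -> N}) (g : {linear P -> N}),
    (forall y, exists x, f x = y) ->
    exists h : {linear P -> M}, forall x, f (h x) = g x.

Definition generated_in_degree (i : nat) (M : lmodType A^c)
    (gr : nat -> M -> Prop) : Prop :=
  forall v : M, exists s : seq (A^c * M),
    (forall t, t \in s -> gr i t.2) /\ v = \sum_(t <- s) t.1 *: t.2.

(* For an augmentation aug : A -> F, the trivial right module F_A *)
Definition trivmod (aug : {rmorphism A -> F}) : Type := F.

Section Trivmod.
Variable aug : {rmorphism A -> F}.

HB.instance Definition _ := GRing.Zmodule.on (trivmod aug).

Definition triv_scale (a : A^c) (c : trivmod aug) : trivmod aug :=
  aug a * (c : F).

Lemma triv_scaleA (a b : A^c) c :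
  triv_scale a (triv_scale b c) = triv_scale (a * b) c.
Proof.
rewrite /triv_scale mulrA [aug a * _]mulrC; congr (_ * _).
exact: (esym (rmorphM aug (b : A) (a : A))).
Qed.

Lemma triv_scale1 : left_id 1 triv_scale.
Proof. by move=> c; rewrite /triv_scale (rmorph1 aug) mul1r. Qed.

Lemma triv_scaleDr : right_distributive triv_scale +%R.
Proof. by move=> a b c; apply: mulrDr. Qed.

Lemma triv_scaleDl c : {morph triv_scale^~ c : a b / a + b}.
Proof.
move=> a b; rewrite /triv_scale (rmorphD aug (a : A) (b : A)).
exact: mulrDl.
Qed.

HB.instance Definition _ := GRing.Zmodule_isLmodule.Build A^c (trivmod aug)
  triv_scaleA triv_scale1 triv_scaleDr triv_scaleDl.

End Trivmod.

(* A linear projective resolution ... -> P 1 -> P 0 -> F_A -> 0 of graded right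
   A-modules with homogeneous maps of degree 0, F_A being in degree 0.  Since
   A lives in degrees >= 0, a module generated in degree i >= 0 lives in
   degrees >= i, so gradings by nat are no restriction. *)
Definition Koszul (aug : {rmorphism A -> F}) : Prop :=
  exists (P : nat -> lmodType A^c) (gr : forall i, nat -> P i -> Prop)
         (D : forall i, {linear P i.+1 -> P i})
         (eps : {linear P 0%N -> trivmod aug}),
    (forall i, [/\ graded_module (gr i), projective (P i)
                 & generated_in_degree i (gr i)]) /\
    [/\ forall i n v, gr i.+1 n v -> gr i n (D i v),
        forall n v, (0 < n)%N -> gr 0%N n v -> eps v = 0,
        forall c, exists v, eps v = c,
        forall v, eps v = 0 <-> exists w, v = D 0%N w
      & forall i v, D i v = 0 <-> exists w, v = D i.+1 w].

End GradedModules.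

Section TnMn.
Variables (F : fieldType) (d : Order.disp_t) (G : finBPOrderType d).

Definition rsum (W : {set plus G}) : Ralg F G := \sum_(z in W) Rgen F z.

Definition equivW (W : {set plus G}) (u v : plus G) : Prop :=
  forall q : plus G -> F,
    rsum W * (\sum_z q z *: Rgen F z) = 0 -> q u = q v.

Definition classW (W : {set plus G}) (z : plus G) : {set plus G} :=
  [set v | `[< equivW W z v >]].

(* Tset x n W means W \in T_n(G), for G = G_x *)
Inductive Tset (x : plus G) : nat -> {set plus G} -> Prop :=
| Tset_top : Tset x (rk (val x)) [set x]
| Tset_step (i : nat) (W : {set plus G}) (s z : plus G) :
    (1 <= i)%N -> Tset x i.+1 W -> s \in W -> covers (val s) (val z) ->
    Tset x i (classW W z).

(* trunc n W k is Gamma(W, k) for W a subset of Gamma(n) *)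
Definition trunc (n : nat) (W : {set plus G}) (k : nat) : {set G} :=
  [set a : G | [exists s in W, (a <= val s)%O] && (n - k <= rk a)%N].

Definition hasse_connected (A : {set G}) : bool :=
  [forall a in A, forall b in A,
     connect [rel u v | [&& u \in A, v \in A & covers u v || covers v u]] a b].

Definition linked (n : nat) (W : {set plus G}) : bool :=
  hasse_connected (trunc n W 1).

Definition maximally_linked (n : nat) (W W' : {set plus G}) : bool :=
  maxset (fun U => (U \subset W) && linked n U) W'.

(* Mset x n W means W \in M_n(G), for G = G_x *)
Definition Mset (x : plus G) (n : nat) (W : {set plus G}) : Prop :=
  exists2 W0, Tset x n W0 & maximally_linked n W0 W.

End TnMn.

Section Complex.
Variables (F : fieldType) (d : Order.disp_t) (P : finBPOrderType d).

(* The simplices with j vertices of the order complex of the open interval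
   (bot, x), as strictly increasing sequences; their dimension is j - 1. *)
Record simplex (x : P) (j : nat) := Simplex {
  simplex_val :> j.-tuple P;
  _ : sorted <%O simplex_val && all (fun y => \bot < y < x)%O simplex_val }.

HB.instance Definition _ x j := [isSub for @simplex_val x j].
HB.instance Definition _ x j := [Finite of simplex x j by <:].

(* augmented simplicial cochains of degree j - 1 *)
Local Notation cochain x j := {ffun simplex x j -> F}.

Definition face (i : nat) (s : seq P) : seq P := take i s ++ drop i.+1 s.

Definition coboundary x j (f : cochain x j) : cochain x j.+1 :=
  [ffun c : simplex x j.+1 =>
     \sum_(i < j.+1) \sum_(c' : simplex x j | c' == face i c :> seq P)
               (-1) ^+ i * f c'].

Definition is_cocycle x j (f : cochain x j) : Prop := coboundary f = 0.

Definition is_coboundary x j : cochain x j -> Prop :=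
  match j with
  | 0%N => fun f => f = 0
  | j'.+1 => fun f => exists g : cochain x j', f = coboundary g
  end.

Definition rank_level (m : nat) := {x : P | rk x == m}.

(* S^n is the direct sum, over x of rank n + 1, of the reduced cohomology of
   degree n - 1 of (bot, x).  Its elements are given by families of cocycles
   (Smem), two families being identified when they differ by coboundaries
   (Sequiv). *)
Definition Srep (n : nat) := forall x : rank_level n.+1, cochain (val x) n.

Definition Smem n (s : Srep n) : Prop := forall x, is_cocycle (s x).

Definition Sequiv n (s t : Srep n) : Prop := forall x, is_coboundary (s x - t x).

(* The class [x_1 <- ... <- x_n]_x is represented by the indicator cochain of
   its chain, so that the coefficient of Sdiff s at [x_1 <- ... <- x_(n+1)]_y
   is (-1)^n times that of s at [x_1 <- ... <- x_n]_(x_(n+1)). *)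
Definition Sdiff n (s : Srep n) : Srep n.+1 :=
  fun y => [ffun c : simplex (val y) n.+1 =>
    \sum_(x : rank_level n.+1 | covers (val y) (val x))
    \sum_(c' : simplex (val x) n | c == rcons c' (val x) :> seq P)
       (-1) ^+ n * s x c'].

Definition Szero n : Srep n := fun=> 0.

Arguments Szero n : clear implicits.

Definition is_Sboundary n : Srep n -> Prop :=
  match n with
  | 0%N => fun s => Sequiv s (Szero 0)
  | n'.+1 => fun s => exists2 t : Srep n', Smem t & Sequiv s (Sdiff t)
  end.

(* H^n(S) = 0 *)
Definition HS_vanishes (n : nat) : Prop :=
  forall s : Srep n, Smem s -> Sequiv (Sdiff s) (Szero n.+1) -> is_Sboundary s.

End Complex.

Definition weakly_Cohen_Macaulay (F : fieldType) (d : Order.disp_t)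
    (G : finBPOrderType d) : Prop :=
  forall (x : plus G) (k n : nat) (W : {set plus (below x)}),
    (2 <= k)%N -> (k < n)%N -> (n <= rk (val x))%N ->
    Mset F (below_top x) n W ->
    HS_vanishes F (subposet (trunc n W k)) k.-1.

(* Main.v *)
From HB Require Import structures.
Require Import Defs.
From mathcomp Require Import all_boot all_order all_algebra.
From mathcomp Require Import finmap boolp.
From mathcomp.multinomials Require Import monalg.

(** Write A for the algebra, r_x for its generators and r_W for the sum of the
generators in a set W. Every relation begins with a fixed letter, so the
augmentation ideal is the direct sum of the right ideals r_x A. Hence the syzygies
in the minimal resolution of the trivial module are, as long as the resolution
stays linear, direct sums of modules r_W A, and the next syzygies are the right
annihilators of the elements r_W. A linear form is killed by r_W exactly when
its coefficients agree on any two elements covered by a common element of W;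
hence the linear annihilators of r_W are spanned by the r_C, for C ranging over
the classes of the equivalence relation so generated ([cls]), and the right ideals
r_C A form a direct sum. Starting from the empty set, whose annihilator is taken to
be the augmentation ideal, and passing repeatedly to classes, one meets all the
sets that occur ([reach]). The algebra is Koszul if and only if for each of them
the annihilator is generated by its linear elements ([lin_ann]).

- If all these annihilators are linear, the resolution can be written down: its
  i-th term is free on the sequences of i successive classes
  ([Koszul_of_lin_ann]).
- Conversely, an arbitrary linear resolution P by projective modules is compared
  with the annihilators one at a time ([visible]): the annihilator of r_W maps to
  a syzygy of P by a map that respects degrees, and back by some other map, and
  the composite is the identity up to decomposable elements. In the syzygy all
  elements of non-minimal degree are decomposable, so the same holds in the
  annihilator, and the graded Nakayama lemma applies ([lin_ann_of_Koszul]).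

On the side of posets, let P be the set of elements of rank at least m below some
element of W, with a minimum adjoined. The top cohomology of an open interval
below y is spanned by its maximal chains, and the coboundary of a chain with one
gap is, up to sign, the sum over all ways to fill the gap. These sums are the
relations that hold in A between the words with first letter y, read along the
chain ([eval_at_eq0]). Thus the complex of P consists of the parts of A spanned by
the words of the appropriate length and first letter, and its differential is, up
to sign, left multiplication by the sum of the generators of the next level
([eval_Sdiff]). Vanishing of its cohomology in the degree next to the top says
that an element of degree k killed by r_W is a multiple of r_C, where C is the set
of all elements covered by W ([HS_vanishesP]).

If W is maximally linked inside one of the sets met above, then C is a single
class, and the maximally linked subsets correspond in this way to the classes that
W covers ([maximally_linkedP]). The annihilator splits as a direct sum over the
classes of first letters, so its linearity amounts to the vanishing of cohomology
for all these subsets ([wCM_of_lin_ann], [lin_ann_of_wCM]). Degrees outside the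
range of the definition take care of themselves: an annihilator of degree 1 is a
combination of the r_C, and words longer than the rank of their first letter
vanish. *)

Set Implicit Arguments.
Unset Strict Implicit.
Unset Printing Implicit Defensive.

Import Order.TTheory GRing.Theory.

Local Open Scope ring_scope.

(** * Words and linear maps out of the algebra *)

Section Words.
Variables (F : fieldType) (d : Order.disp_t) (G : finBPOrderType d).
Local Notation X := (plus G).
Local Notation T := (freealg F G).
Local Notation A := (Ralg F G).

Definition mono (s : seq X) : T := << FMonom s >>.

Lemma mono_cat s t : mono (s ++ t) = mono s * mono t.
Proof.
rewrite /mono; have := fgmulUU (K := {fmonom X}) (1 : F) 1 (FMonom s) (FMonom t).
rewrite mulr1 => e; apply: etrans (esym e).
by congr mkmalgU; apply/eqP; rewrite fmP fmM.
Qed.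

Lemma mono_gen x : mono [:: x] = gen F x.
Proof. by []. Qed.

Lemma mono_nil : mono [::] = 1.
Proof.
by rewrite /mono -fmoneE.
Qed.

Lemma freealgE (p : T) :
  p = \sum_(m <- msupp p) mcoeff m p *: mono (fmonom_val m).
Proof.
rewrite {1}[p]monalgE; apply: eq_bigr => m _; apply/malgP => k.
by rewrite mcoeffU [RHS]mcoeffZ /mono fmK mcoeffU1 mulr_natr.
Qed.

Section Lin.
Variables (V : lmodType F) (lam : seq X -> V).

Definition lin_ext (p : T) : V :=
  \sum_(m <- msupp p) mcoeff m p *: lam (fmonom_val m).

Lemma linEw (D : {fset {fmonom X}}%fset) (p : T) : (msupp p `<=` D)%fset ->
  lin_ext p = \sum_(m <- D) mcoeff m p *: lam (fmonom_val m).
Proof.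
move=> sD; rewrite /lin_ext [LHS](big_fset_incl _ sD) //= => m _ /mcoeff_outdom ->.
by rewrite scale0r.
Qed.

Lemma lin_linear : linear lin_ext.
Proof.
move=> c p q.
pose D := (msupp p `|` msupp q `|` msupp (c *: p + q))%fset.
have sp : (msupp p `<=` D)%fset.
  by rewrite /D -fsetUA; exact: finmap.fsubsetUl.
have sq : (msupp q `<=` D)%fset.
  by rewrite /D (fsetUC (msupp p)) -fsetUA; exact: finmap.fsubsetUl.
have s3 : (msupp (c *: p + q) `<=` D)%fset by exact: finmap.fsubsetUr.
rewrite (linEw sp) (linEw sq) (linEw s3) scaler_sumr -big_split /=.
apply: eq_bigr => m _.
by rewrite mcoeffD (mcoeffZ c p m) scalerDl scalerA.
Qed.

HB.instance Definition _ := GRing.isLinear.Build F T V *:%R lin_ext lin_linear.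

Lemma linP c p q : lin_ext (c *: p + q) = c *: lin_ext p + lin_ext q.
Proof. exact: lin_linear. Qed.

Lemma lin_mono s : lin_ext (mono s) = lam s.
Proof.
by rewrite /lin_ext /mono msuppU1 big_seq_fset1 mcoeffUU scale1r.
Qed.

End Lin.

Lemma freealg_ind (Q : T -> Prop) :
  Q 0 -> (forall c s p, Q p -> Q (c *: mono s + p)) -> forall p, Q p.
Proof.
move=> Q0 QD p; rewrite (freealgE p).
by elim/big_rec: _ => // m q _ /QD; apply.
Qed.

Section LinRel.
Variables (V : lmodType F) (Z : V -> Prop).
Hypotheses (Z0 : Z 0) (ZD : forall c a b, Z a -> Z b -> Z (c *: a + b)).
Variable lam : seq X -> V.
Hypothesis lam_sum : forall u x v,
  Z (\sum_(z : X | covers (val x) (val z)) lam (u ++ x :: z :: v)).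
Hypothesis lam_ncov : forall u x w v,
  ~~ covers (val x) (val w) -> Z (lam (u ++ x :: w :: v)).

(** An element of the ideal is a combination of products of a relator by two
words; the value of the extension on such a product is one of the sums in the
hypotheses. *)
Lemma lin_relideal p : p \in @relideal F d G -> Z (lin_ext lam p).
Proof.
have ZDD a b : Z a -> Z b -> Z (a + b).
  by move=> za zb; rewrite -[a]scale1r; apply: ZD.
move=> /relidealP[s [hs ->]]; rewrite raddf_sum big_seq.
elim/big_ind: _ => //= -[[a r] b] /hs /= {}hs.
elim/freealg_ind: a => [|c u a IH]; first by rewrite mul0r mul0r raddf0.
have -> : (c *: mono u + a) * r * b = c *: (mono u * r * b) + a * r * b.
  by rewrite mulrDl mulrDl -scalerAl -scalerAl.
rewrite linP; apply: ZD; last exact: IH.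
clear IH a.
elim/freealg_ind: b => [|e v b IHb]; first by rewrite mulr0 raddf0.
have -> : mono u * r * (e *: mono v + b) = e *: (mono u * r * mono v) + mono u * r * b.
  by rewrite mulrDr -freealg_scaleAr.
rewrite linP; apply: ZD; last exact: IHb.
clear IHb b.
case: hs => [[x ->]|[x [w [nxw ->]]]].
  rewrite (mulr_sumr _ _ (fun z => gen F z) (gen F x)).
  rewrite (mulr_sumr _ _ (fun z => gen F x * gen F z) (mono u)).
  rewrite (mulr_suml _ _ (fun z => mono u * (gen F x * gen F z)) (mono v)).
  rewrite raddf_sum /=; have := lam_sum u x v; congr Z; apply: eq_bigr => z _.
  by rewrite -!mono_gen -!mono_cat lin_mono -catA.
rewrite -!mono_gen -!mono_cat lin_mono -catA /=.
exact: lam_ncov.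
Qed.

End LinRel.

Definition Rword (s : seq X) : A := Rpi (mono s).

Lemma Rpi_linear : linear (@Rpi F d G).
Proof. by move=> c p q; rewrite -RaddE -RscaleE. Qed.

HB.instance Definition _ := GRing.isLinear.Build F T A *:%R (@Rpi F d G) Rpi_linear.

Lemma Rpi_eq0 p : Rpi p = 0 <-> p \in @relideal F d G.
Proof. by rewrite -(linear0 (@Rpi F d G)) Req subr0. Qed.

Lemma wd_cat s t : Rword (s ++ t) = Rword s * Rword t.
Proof. by rewrite /Rword mono_cat -RmulE. Qed.

Lemma wd_nil : Rword [::] = 1.
Proof. by rewrite /Rword mono_nil. Qed.

Lemma wd1 x : Rword [:: x] = Rgen F x.
Proof. by []. Qed.

Lemma wd_cons x s : Rword (x :: s) = Rgen F x * Rword s.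
Proof. by rewrite -cat1s wd_cat wd1. Qed.

Let mul1K (p : T) : 1 * p * 1 = p.
Proof. by rewrite mulr1 mul1r. Qed.

Lemma Rgen_ncov (x w : X) : ~~ covers (val x) (val w) -> Rgen F x * Rgen F w = 0.
Proof.
move=> h; rewrite -!wd1 -wd_cat; apply/Rpi_eq0/relidealP.
exists [:: (1, gen F x * gen F w, 1)]; split=> [t|].
  by rewrite inE => /eqP ->; right; exists x, w.
rewrite big_seq1 mono_cat [RHS]/=; symmetry; exact: mul1K.
Qed.

Lemma Rgen_cov (x : X) : Rgen F x * \sum_(z : X | covers (val x) (val z)) Rgen F z = 0.
Proof.
have -> : \sum_(z : X | covers (val x) (val z)) Rgen F z
    = Rpi (\sum_(z : X | covers (val x) (val z)) gen F z).
  by rewrite (raddf_sum (@Rpi F d G)).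
apply: etrans (RmulE _ _) _; apply/Rpi_eq0/relidealP.
exists [:: (1, gen F x * (\sum_(z : X | covers (val x) (val z)) gen F z), 1)].
split=> [t|]; first by rewrite inE => /eqP ->; left; exists x.
rewrite big_seq1 [RHS]/=; symmetry; exact: mul1K.
Qed.

End Words.

(** * The algebra through its universal property *)

Section Presentation.
Variables (F : fieldType) (d : Order.disp_t) (G : finBPOrderType d).
Local Notation X := (plus G).

Definition word (A : algType F) (r : X -> A) (s : seq X) : A := \prod_(x <- s) r x.

Definition wsum (V : lmodType F) (lam : seq X -> V) (w : seq (F * seq X)) : V :=
  \sum_(t <- w) t.1 *: lam t.2.

(** The algebra enters all later arguments only through this interface: spanned
by words, relations that hold, and no other relations. The last point is stated
for values in a module V modulo a submodule Z, so that it can be applied with Z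
the coboundaries. *)
Record presented (A : algType F) (grA : nat -> A -> Prop)
    (aug : {rmorphism A -> F}) (r : X -> A) : Prop := Presented {
  pr_span : forall a, exists w, a = wsum (word r) w;
  pr_ncov : forall x w : X, ~~ covers (val x) (val w) -> r x * r w = 0;
  pr_cov : forall x : X, r x * (\sum_(z : X | covers (val x) (val z)) r z) = 0;
  pr_univ : forall (V : lmodType F) (Z : V -> Prop) (lam : seq X -> V),
    Z 0 -> (forall c a b, Z a -> Z b -> Z (c *: a + b)) ->
    (forall u (x : X) v,
      Z (\sum_(z : X | covers (val x) (val z)) lam (u ++ x :: z :: v))) ->
    (forall u (x w : X) v,
      ~~ covers (val x) (val w) -> Z (lam (u ++ x :: w :: v))) ->
    forall w, wsum (word r) w = 0 -> Z (wsum lam w);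
  pr_gr : forall n a, grA n a <->
    exists2 w, all (fun t => size t.2 == n) w & a = wsum (word r) w;
  pr_aug : forall x, aug (r x) = 0;
  pr_augZ : forall c, aug (c *: 1) = c }.

Lemma word_Rgen s : word (@Rgen F d G) s = Rword F s.
Proof.
elim: s => [|x s IH]; first by rewrite /word big_nil -wd_nil.
by rewrite /word big_cons -/(word _ s) IH -wd_cons.
Qed.

Lemma wsum_Rgen w : wsum (word (@Rgen F d G)) w = Rpi (wsum (@mono F d G) w).
Proof.
rewrite /wsum (raddf_sum (@Rpi F d G)); apply: eq_bigr => t _ /=.
by rewrite word_Rgen /Rword (linearZ_LR (@Rpi F d G)).
Qed.

Lemma freealg_wsum (p : freealg F G) :
  p = wsum (@mono F d G)
        [seq (mcoeff m p, fmonom_val m) | m <- (msupp p : seq {fmonom X})].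
Proof. by rewrite /wsum big_map; exact: freealgE. Qed.

Lemma lin_wsum (V : lmodType F) (lam : seq X -> V) w :
  lin_ext lam (wsum (@mono F d G) w) = wsum lam w.
Proof.
rewrite /wsum (raddf_sum (lin_ext lam)); apply: eq_bigr => t _ /=.
by rewrite linearZ_LR /= lin_mono.
Qed.

Lemma Ralg_presented : presented (@Rgr F d G) (@Raug F d G) (@Rgen F d G).
Proof.
split.
- elim/Rind => p; exists [seq (mcoeff m p, fmonom_val m) | m <- (msupp p : seq {fmonom X})].
  by rewrite wsum_Rgen -freealg_wsum.
- exact: Rgen_ncov.
- exact: Rgen_cov.
- move=> V Z lam Z0 ZD h1 h2 w; rewrite wsum_Rgen => /Rpi_eq0.
  by move/(lin_relideal Z0 ZD h1 h2); rewrite lin_wsum.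
- move=> n a; split.
    move=> [p [hp ->]].
    exists [seq (mcoeff m p, fmonom_val m) | m <- (msupp p : seq {fmonom X})].
      by apply/allP => _ /mapP[m mp ->] /=; apply/eqP/hp; rewrite mcoeff_neq0.
    by rewrite wsum_Rgen -freealg_wsum.
  move=> [w hw ->]; exists (wsum (@mono F d G) w); split; last exact: wsum_Rgen.
  move=> m; rewrite (raddf_sum (mcoeff m)); apply: contraNeq => ne.
  apply/eqP; rewrite big_seq big1 // => t tw /=.
  rewrite (mcoeffZ t.1 _ m) mcoeffU1; case: eqP => [e|_]; last by rewrite mulr0.
  by have := allP hw t tw; rewrite -e in ne; rewrite (negPf ne).
- by move=> x; apply: etrans (RaugE _) (const_coef_gen _ _).
- move=> c; apply: etrans (congr1 (@Raug F d G) (RscaleE c 1)) _; apply: etrans (RaugE _) _.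
  apply: etrans (mcoeffZ c _ _) _.
  by apply: (etrans (congr1 (fun e => c * e) (const_coef1 F G))); rewrite mulr1.
Qed.

End Presentation.

(** * Graded structure and first letters *)

Section Consequences.
Variables (F : fieldType) (d : Order.disp_t) (G : finBPOrderType d).
Local Notation X := (plus G).
Local Notation cov := (fun x y : X => covers (val x) (val y)).
Variables (A : algType F) (grA : nat -> A -> Prop) (aug : {rmorphism A -> F}).
Variable r : X -> A.
Hypothesis pr : presented grA aug r.
Local Notation word := (word r).

Lemma word_nil : word [::] = 1.
Proof. by rewrite /word big_nil. Qed.

Lemma word_cons x s : word (x :: s) = r x * word s.
Proof. by rewrite /word big_cons. Qed.

Lemma word_cat s t : word (s ++ t) = word s * word t.
Proof. by rewrite /word big_cat. Qed.

Lemma word_unsorted s : ~~ sorted cov s -> word s = 0.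
Proof.
case: s => // x s; elim: s x => // y s IH x /=.
rewrite negb_and => /orP[nc|/IH ns]; last by rewrite word_cons ns mulr0.
by rewrite !word_cons mulrA (pr_ncov pr nc) mul0r.
Qed.

Lemma span_ind (Q : A -> Prop) :
  Q 0 -> (forall c s a, Q a -> Q (c *: word s + a)) -> forall a, Q a.
Proof.
move=> Q0 QD a; have [w ->] := pr_span pr a.
by rewrite /wsum; elim/big_rec: _ => // t b _; apply: QD.
Qed.

Lemma wsum_cat (V : lmodType F) (lam : seq X -> V) w w' :
  wsum lam (w ++ w') = wsum lam w + wsum lam w'.
Proof. exact: big_cat. Qed.

Lemma wsumZ (V : lmodType F) (lam : seq X -> V) c w :
  wsum lam [seq (c * t.1, t.2) | t <- w] = c *: wsum lam w.
Proof.
rewrite /wsum big_map scaler_sumr; apply: eq_bigr => t _ /=.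
by rewrite scalerA.
Qed.

(** The value at an element is read off an arbitrary expression of it by words;
the universal property with trivial Z makes it independent of the expression. *)
Lemma ext_exists (V : lmodType F) (lam : seq X -> V) :
  (forall u (x : X) v,
    \sum_(z : X | covers (val x) (val z)) lam (u ++ x :: z :: v) = 0) ->
  (forall u (x w : X) v,
    ~~ covers (val x) (val w) -> lam (u ++ x :: w :: v) = 0) ->
  exists f : {linear A -> V}, forall s, f (word s) = lam s.
Proof.
move=> h1 h2.
have un w : wsum word w = 0 -> wsum lam w = 0.
  apply: (pr_univ pr (Z := fun v : V => v = 0)) => // c a b -> ->.
  by rewrite scaler0 addr0.
have un2 w w' : wsum word w = wsum word w' -> wsum lam w = wsum lam w'.
  move=> e; apply/eqP; rewrite -subr_eq0 -scaleN1r -wsumZ -wsum_cat.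
  by apply/eqP/un; rewrite wsum_cat wsumZ e scaleN1r subrr.
pose f a := wsum lam (sval (cid (pr_span pr a))).
have fE w : f (wsum word w) = wsum lam w.
  by rewrite /f; case: cid => w' /= e; apply: un2.
have fl : linear f.
  move=> c a b; have [w ->] := pr_span pr a; have [w' ->] := pr_span pr b.
  by rewrite -wsumZ -wsum_cat !fE wsum_cat wsumZ.
pose fL := GRing.isLinear.Build F A V *:%R f fl.
pose f' : {linear A -> V} := HB.pack f fL.
exists f' => s.
have -> : word s = wsum word [:: (1, s)] by rewrite /wsum big_seq1 scale1r.
by rewrite [LHS]fE /wsum big_seq1 scale1r.
Qed.

(** Discarding the words outside a family is well defined on the algebra as soon
as the family contains all the words of a defining relation or none. *)
Record wordfam := Wordfam {
  wf_pred :> seq X -> bool;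
  wf_rel : forall u x z z' v, wf_pred (u ++ x :: z :: v) = wf_pred (u ++ x :: z' :: v) }.

Lemma res_exists (B : wordfam) :
  exists f : {linear A -> A}, forall s, f (word s) = if B s then word s else 0.
Proof.
apply: ext_exists => [u x v|u x w v nxw]; last first.
  case: ifP => // _.
  by rewrite word_cat !word_cons (mulrA (r x)) (pr_ncov pr nxw) mul0r mulr0.
case: (pickP (fun z : X => covers (val x) (val z))) => [z0 _|no]; last first.
  by rewrite big_pred0.
have lE z : (if B (u ++ x :: z :: v) then word (u ++ x :: z :: v) else 0)
        = if B (u ++ x :: z0 :: v) then word u * r x * r z * word v else 0.
  by rewrite (wf_rel B u x z z0 v) word_cat 2!word_cons !mulrA.
rewrite (eq_bigr _ (fun z _ => lE z)).
case: (B _); last by rewrite big1.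
by rewrite -mulr_suml -mulr_sumr -[X in X * word v]mulrA (pr_cov pr) mulr0 mul0r.
Qed.

Definition res (B : wordfam) : {linear A -> A} := sval (cid (res_exists B)).

Lemma res_word B s : res B (word s) = if B s then word s else 0.
Proof. exact: (svalP (cid (res_exists B))). Qed.

Lemma size_wordfam_subproof n u (x z z' : X) v :
  (size (u ++ x :: z :: v) == n) = (size (u ++ x :: z' :: v) == n).
Proof. by rewrite !size_cat. Qed.

Lemma head_wordfam_subproof (C : {set X}) u (x z z' : X) v :
  (if u ++ x :: z :: v is y :: _ then y \in C else false)
  = (if u ++ x :: z' :: v is y :: _ then y \in C else false).
Proof. by case: u. Qed.

Definition deg_part (n : nat) :=
  res (@Wordfam (fun s => size s == n) (size_wordfam_subproof n)).

Definition head_part (C : {set X}) :=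
  res (@Wordfam (fun s => if s is y :: _ then y \in C else false)
         (head_wordfam_subproof C)).

Lemma hc_word n s : deg_part n (word s) = if size s == n then word s else 0.
Proof. exact: res_word. Qed.

Lemma pj_word C s :
  head_part C (word s) = if s is x :: _ then if x \in C then word s else 0 else 0.
Proof. by rewrite /head_part res_word /=; case: s. Qed.

Lemma augZ c a : aug (c *: a) = c * aug a.
Proof. by rewrite -[a]mul1r scalerAl rmorphM (pr_augZ pr) mul1r. Qed.

Lemma aug_word s : aug (word s) = (s == [::])%:R.
Proof.
case: s => [|x s]; first by rewrite word_nil rmorph1.
by rewrite word_cons rmorphM (pr_aug pr) mul0r.
Qed.

Lemma hc0 a : deg_part 0 a = aug a *: 1.
Proof.
elim/span_ind: a => [|c s a IH]; first by rewrite raddf0 rmorph0 scale0r.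
rewrite linearP IH rmorphD augZ aug_word scalerDl hc_word size_eq0.
case: eqP => [->|_]; last by rewrite mulr0 scaler0 scale0r.
by rewrite mulr1 word_nil.
Qed.

Lemma hc_hc m n a : deg_part m (deg_part n a) = if m == n then deg_part n a else 0.
Proof.
elim/span_ind: a => [|c s a IH]; first by rewrite !raddf0 if_same.
rewrite !linearP IH !hc_word [LHS]/=.
have [e|ne] := eqVneq (size s) n.
  rewrite hc_word e eq_sym; case: eqP => // _.
  by rewrite scaler0 addr0.
by rewrite raddf0 !scaler0 !add0r.
Qed.

Lemma hcM n a b : deg_part n (a * b) = \sum_(i < n.+1) deg_part i a * deg_part (n - i) b.
Proof.
elim/span_ind: a => [|c s a IH].
  by rewrite mul0r raddf0 big1 // => i _; rewrite raddf0 mul0r.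
rewrite mulrDl linearD IH /= -scalerAl linearZ_LR /=.
under [RHS]eq_bigr => i _ do rewrite linearP mulrDl -scalerAl.
rewrite big_split /= -scaler_sumr; congr (_ *: _ + _).
elim/span_ind: b {IH} => [|e t b IHb].
  by rewrite mulr0 raddf0 big1 // => i _; rewrite raddf0 mulr0.
rewrite mulrDr linearD IHb /= -scalerAr linearZ_LR /=.
under [RHS]eq_bigr => i _ do rewrite linearP mulrDr -scalerAr.
rewrite big_split /= -scaler_sumr; congr (_ *: _ + _).
rewrite -word_cat hc_word size_cat.
have [lt|ge] := ltnP (size s) n.+1; last first.
  rewrite big1 => [|i _].
    by case: eqP => // e1; move: ge; rewrite -e1 ltnNge leq_addr.
  rewrite hc_word; case: eqP => [e1|_]; last by rewrite mul0r.
  by move: ge; rewrite e1 ltnNge -ltnS ltn_ord.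
rewrite (bigD1 (Ordinal lt)) //= !hc_word eqxx big1 ?addr0 => [|i ni].
  have -> : (size t == n - size s)%N = (size s + size t == n)%N.
    by rewrite -(eqn_add2l (size s)) subnKC.
  by case: eqP; rewrite ?mulr0 // word_cat.
rewrite hc_word; case: eqP => [e1|_]; last by rewrite mul0r.
by case/eqP: ni; apply: val_inj.
Qed.

Lemma hc_sum a : exists N, forall M, (N <= M)%N -> a = \sum_(i < M) deg_part i a.
Proof.
elim/span_ind: a => [|c s a [N IH]].
  by exists 0%N => M _; rewrite big1 // => i _; rewrite raddf0.
exists (maxn N (size s).+1) => M; rewrite geq_max => /andP[NM sM].
under eq_bigr => i _ do rewrite linearP.
rewrite big_split /= -scaler_sumr -(IH _ NM); congr (_ *: _ + _).
rewrite (bigD1 (Ordinal sM)) //= hc_word eqxx big1 ?addr0 // => i ni.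
rewrite hc_word; case: eqP => // e1.
by case/eqP: ni; apply: val_inj.
Qed.

Lemma hc_sum_seq (s : seq A) :
  exists N, forall a, a \in s -> a = \sum_(i < N) deg_part i a.
Proof.
suff [N h] : exists N, forall M a, (N <= M)%N -> a \in s -> a = \sum_(i < M) deg_part i a.
  by exists N => a; apply: h.
elim: s => [|a s [N IH]]; first by exists 0%N.
have [N' h] := hc_sum a; exists (maxn N N') => M b; rewrite geq_max inE.
by case/andP => NM N'M /orP[/eqP ->|]; [exact: h | exact: IH].
Qed.

Lemma grP n a : grA n a <-> deg_part n a = a.
Proof.
rewrite (pr_gr pr); split.
  move=> [w /allP hw ->]; rewrite /wsum linear_sum /= big_seq [RHS]big_seq.
  by apply: eq_bigr => t /hw st; rewrite linearZ_LR /= hc_word st.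
have [w ->] := pr_span pr a; rewrite /wsum linear_sum => e.
exists [seq t <- w | size t.2 == n]; first exact: filter_all.
rewrite /wsum big_filter -[LHS]e [RHS]big_mkcond /=; apply: eq_bigr => t _.
by rewrite linearZ_LR /= hc_word; case: ifP; rewrite ?scaler0.
Qed.

(** The first letter of a product is that of its left factor, except for the
scalar part of the latter. *)
Lemma pjM C a b : head_part C (a * b) = head_part C a * b + aug a *: head_part C b.
Proof.
elim/span_ind: a => [|c s a IH].
  by rewrite mul0r !raddf0 mul0r scale0r add0r.
rewrite mulrDl linearD IH /= -scalerAl linearZ_LR /= linearP /= mulrDl.
rewrite rmorphD augZ scalerDl addrACA; congr (_ + _).
rewrite -scalerAl -scalerA -scalerDr; congr (_ *: _); rewrite aug_word pj_word.
case: s => [|x s]; first by rewrite word_nil mul1r mul0r add0r scale1r.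
rewrite scale0r addr0; elim/span_ind: b {IH} => [|e t b IHb].
  by rewrite mulr0 raddf0 mulr0.
rewrite !mulrDr linearD IHb /= -!scalerAr linearZ_LR /= -word_cat pj_word /=.
by case: ifP => _; rewrite ?mul0r // -word_cat.
Qed.

Lemma pj_rM C x b : head_part C (r x * b) = if x \in C then r x * b else 0.
Proof.
have -> : r x = word [:: x] by rewrite word_cons word_nil mulr1.
rewrite pjM aug_word scale0r addr0 pj_word.
by case: ifP; rewrite ?mul0r.
Qed.

(** Together with [pj_rM] this decomposes the augmentation ideal as the direct sum
of the right ideals generated by the letters. *)
Lemma first_letters a : exists b : X -> A, a = aug a *: 1 + \sum_x r x * b x.
Proof.
elim/span_ind: a => [|c s a [b IH]].
  exists (fun=> 0); rewrite rmorph0 scale0r add0r big1 // => x _.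
  by rewrite mulr0.
case: s => [|x s].
  exists b; rewrite rmorphD augZ aug_word word_nil mulr1 scalerDl -addrA.
  by rewrite -IH.
exists (fun y => b y + (if y == x then c *: word s else 0)).
rewrite rmorphD augZ aug_word mulr0 add0r.
under eq_bigr => y _ do rewrite mulrDr.
rewrite big_split /= addrA -IH (bigD1 x) //= eqxx big1 => [|y ny].
  by rewrite addr0 addrC word_cons -scalerAr.
by rewrite (negPf ny) mulr0.
Qed.

Lemma pj_sum C a : aug a = 0 -> exists b : X -> A, head_part C a = \sum_(x in C) r x * b x.
Proof.
move=> a0; have [b e] := first_letters a; exists b.
rewrite [in LHS]e a0 scale0r add0r linear_sum [RHS]big_mkcond /=.
by apply: eq_bigr => x _; rewrite pj_rM.
Qed.

Lemma pj_aug C a : aug (head_part C a) = 0.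
Proof.
elim/span_ind: a => [|c s a IH]; first by rewrite !raddf0.
rewrite linearP rmorphD IH augZ pj_word addr0 /=; case: s => [|x s].
  by rewrite raddf0 mulr0.
by case: ifP => _; rewrite ?raddf0 ?aug_word mulr0.
Qed.

Lemma pj_hc C n a : head_part C (deg_part n a) = deg_part n (head_part C a).
Proof.
elim/span_ind: a => [|c s a IH]; first by rewrite !raddf0.
rewrite !linearP IH hc_word pj_word /=; congr (_ *: _ + _).
case: s => [|x s].
  by case: ifP; rewrite ?raddf0 // pj_word.
case: ifP => h1; case: ifP => h2; rewrite ?raddf0 // ?pj_word ?hc_word ?h1 ?h2 //.
Qed.

Lemma pj_pj C a : head_part C (head_part C a) = head_part C a.
Proof.
elim/span_ind: a => [|c s a IH]; first by rewrite !raddf0.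
rewrite !linearP IH pj_word /=; congr (_ *: _ + _).
case: s => [|x s]; first by rewrite raddf0.
by case: ifP => h; rewrite ?raddf0 // pj_word h.
Qed.

Lemma hc_aug_gt0 n a : (0 < n)%N -> aug (deg_part n a) = 0.
Proof.
move=> n0; have : deg_part 0 (deg_part n a) = 0 by rewrite hc_hc; case: n n0.
by rewrite hc0 => /eqP; rewrite scaler_eq0 oner_eq0 orbF => /eqP.
Qed.

Definition gen_sum (W : {set X}) : A := \sum_(z in W) r z.

Lemma pj_rs C W a : head_part C (gen_sum W * a) = gen_sum (W :&: C) * a.
Proof.
rewrite /gen_sum mulr_suml linear_sum /= mulr_suml.
rewrite big_mkcond [RHS]big_mkcond; apply: eq_bigr => x _ /=.
by rewrite inE pj_rM; case: (x \in W).
Qed.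

Lemma rs_eq0 W a : gen_sum W * a = 0 <-> forall s, s \in W -> r s * a = 0.
Proof.
split=> [e s sW|h]; last first.
  by rewrite /gen_sum mulr_suml big1.
have := congr1 (head_part [set s]) e; rewrite raddf0 pj_rs.
have -> : W :&: [set s] = [set s].
  by apply/setP => x; rewrite !inE andb_idl // => /eqP ->.
by rewrite /gen_sum big_set1.
Qed.

(** Relations involve words of length at least two only. *)
Lemma r_neq0 x : r x != 0.
Proof.
apply/eqP => rx0.
have [|u y w v _|f fE] := @ext_exists F^o (fun s => (s == [:: x])%:R).
- move=> u y v; rewrite big1 // => z _.
  by case: u => [|? [|? ?]] //=; rewrite ?andbF //; case: eqP.
- by case: u => [|? [|? ?]] //=; rewrite ?andbF //; case: eqP.
have := fE [:: x]; rewrite word_cons rx0 mul0r raddf0 eqxx => /eqP.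
by rewrite eq_sym oner_eq0.
Qed.

End Consequences.

(** * Annihilators and linkage classes *)

Section Linkage.
Context {d : Order.disp_t} {G : finBPOrderType d}.
Local Notation X := (plus G).
Implicit Types W C : {set X}.

Definition link W (u v : X) : bool :=
  [exists s in W, covers (val s) (val u) && covers (val s) (val v)].

Definition cls W z : {set X} := [set v | connect (link W) z v].

Definition clss W : {set {set X}} := [set cls W z | z : X].

Lemma link_sym W : symmetric (link W).
Proof. by move=> u v; apply: eq_existsb => s; rewrite [covers _ _ && _]andbC. Qed.

Lemma cls_id W z : z \in cls W z.
Proof. by rewrite inE connect0. Qed.

Lemma mem_cls W z v : (v \in cls W z) = (cls W v == cls W z).
Proof.
rewrite inE; apply/idP/eqP => [zv|e]; last by have := cls_id W v; rewrite e inE.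
apply/setP => u; rewrite !inE.
by rewrite (same_connect (sym_connect_sym (link_sym W)) zv).
Qed.

Lemma cls_clss W z : cls W z \in clss W.
Proof. exact: imset_f. Qed.

Lemma clss_mem W C z : C \in clss W -> z \in C -> C = cls W z.
Proof. by case/imsetP => y _ ->; rewrite mem_cls => /eqP ->. Qed.

(** The sets W whose annihilators can occur in the minimal resolution: repeated
passage to linkage classes, starting from the empty set. *)
Inductive reach : {set X} -> Prop :=
| reach0 : reach set0
| reach_cls W z : reach W -> reach (cls W z).

Lemma link0 u v : link set0 u v = false.
Proof. by apply/existsP => -[s]; rewrite inE. Qed.

Lemma cls0 z : cls set0 z = [set z].
Proof.
apply/setP => v; rewrite !inE; apply/connectP/eqP => [[[|y p] /=]|->].
- by move=> _ ->.
- by rewrite link0.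
- by exists [::].
Qed.

End Linkage.

Section Annihilators.
Variables (F : fieldType) (d : Order.disp_t) (G : finBPOrderType d).
Local Notation X := (plus G).
Variables (A : algType F) (grA : nat -> A -> Prop) (aug : {rmorphism A -> F}).
Variable r : X -> A.
Hypothesis pr : presented grA aug r.
Local Notation word := (word r).
Local Notation deg_part := (deg_part pr).
Local Notation head_part := (head_part pr).
Local Notation gen_sum := (gen_sum r).
Implicit Types (W C : {set X}) (a b : A).

Lemma r_lin (s : X) (q : X -> F) : (forall u v : X, covers (val s) (val u) ->
    covers (val s) (val v) -> q u = q v) -> r s * (\sum_z q z *: r z) = 0.
Proof.
move=> h; rewrite (bigID (fun z : X => covers (val s) (val z))) mulrDr /=.
rewrite [X in _ + X]mulr_sumr [X in _ + X]big1 ?addr0 => [|z nz]; last first.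
  by rewrite -scalerAr (pr_ncov pr nz) scaler0.
case: (pickP (fun z : X => covers (val s) (val z))) => [z0 cz0|no]; last first.
  by rewrite big_pred0 // mulr0.
rewrite (eq_bigr (fun z => q z0 *: r z)) => [|z cz]; last by rewrite (h z z0).
by rewrite -scaler_sumr -scalerAr (pr_cov pr) scaler0.
Qed.

(** The functional that is 1 on the word su, -1 on the word sv and 0 on all other
words respects the relations, because u and v both occur in the relation of s. *)
Lemma r_lin_const (s u v : X) (q : X -> F) : covers (val s) (val u) ->
  covers (val s) (val v) -> r s * (\sum_z q z *: r z) = 0 -> q u = q v.
Proof.
move=> su sv e0; have [-> //|nuv] := eqVneq u v.
pose lam (w : seq X) : F^o := (w == [:: s; u])%:R - (w == [:: s; v])%:R.
have lam0 w : size w != 2 -> lam w = 0.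
  move=> sw; have ne y : (w == [:: s; y]) = false.
    by apply: contraNF sw => /eqP ->.
  by rewrite /lam !ne subrr.
have lamE x z : lam [:: x; z] = (x == s)%:R * ((z == u)%:R - (z == v)%:R).
  rewrite /lam !eqseq_cons !andbT.
  by case: (x == s); rewrite /= ?mul1r ?mul0r ?subrr.
have sz (p t : seq X) x z : (p != [::]) || (t != [::]) ->
    size (p ++ x :: z :: t) != 2.
  by case: p => [|? ?]; case: t => [|? ?] // _; rewrite size_cat /= ?addnS.
have [p x t|p x z t nxz|f fE] := ext_exists pr (lam := lam).
- have [pt|] := boolP ((p != [::]) || (t != [::])).
    by rewrite big1 // => z _; rewrite lam0 ?sz.
  rewrite negb_or !negbK => /andP[/eqP -> /eqP ->] /=.
  rewrite (eq_bigr _ (fun z _ => lamE x z)) -mulr_sumr.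
  have [->{x}|nx] := eqVneq x s; last by rewrite mul0r.
  rewrite mul1r sumrB (bigD1 u) //= eqxx big1 => [|z /andP[_ /negPf -> //]].
  rewrite (bigD1 v) //= eqxx big1 ?addr0 ?subrr // => z /andP[_ /negPf -> //].
- have [pt|] := boolP ((p != [::]) || (t != [::])); first by rewrite lam0 ?sz.
  rewrite negb_or !negbK => /andP[/eqP -> /eqP ->] /=; rewrite lamE.
  have [e|] := eqVneq x s; last by rewrite mul0r.
  have [e'|] := eqVneq z u; first by move: nxz; rewrite e e' su.
  have [e'|] := eqVneq z v; first by move: nxz; rewrite e e' sv.
  by rewrite subrr mulr0.
have rE x z : f (r x * r z) = lam [:: x; z].
  by rewrite -fE !word_cons word_nil mulr1.
have := congr1 f e0; rewrite raddf0 mulr_sumr linear_sum /=.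
under eq_bigr => z _ do rewrite -scalerAr linearZ_LR /= rE lamE eqxx mul1r
  scalerBr.
rewrite sumrB (bigD1 u) //= eqxx big1 => [|z /negPf ->]; last by rewrite scaler0.
rewrite addr0 (bigD1 v) //= eqxx big1 => [|z /negPf ->]; last by rewrite scaler0.
by rewrite addr0 => /eqP; rewrite subr_eq0 => /eqP; rewrite ![_ *: _]mulr1.
Qed.

(** This determines the linear annihilators of W: they are the linear forms whose
coefficients are constant on the linkage classes. *)
Lemma rs_lin0 W (q : X -> F) :
  gen_sum W * (\sum_z q z *: r z) = 0 <-> forall u v, link W u v -> q u = q v.
Proof.
rewrite (rs_eq0 pr); split=> [h u v|h s sW].
  by case/existsP => s /and3P[/h e su sv]; apply: r_lin_const e.
by apply: r_lin => u v su sv; apply: h; apply/existsP; exists s; rewrite sW su.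
Qed.

(** The sum over a class is annihilated by W, and its coefficients separate this
class from the others. *)
Lemma annihilator_separates W u v :
  (forall q : X -> F, gen_sum W * (\sum_z q z *: r z) = 0 -> q u = q v)
  <-> v \in cls W u.
Proof.
split=> [h|]; last first.
  rewrite inE => /connectP[p pth ->] q /rs_lin0 hq.
  by elim: p u pth => //= w p IH u /andP[/hq -> /IH].
have := h (fun z => (z \in cls W u)%:R).
rewrite cls_id; case: (v \in cls W u) => // e.
suff /eqP : (1 : F) = 0 by rewrite oner_eq0.
apply: e; apply/rs_lin0 => x y xy; congr (_%:R).
have e : cls W y = cls W x by apply/eqP; rewrite -mem_cls inE connect1.
by rewrite !mem_cls e.
Qed.

Lemma rs_neq0 W : W != set0 -> gen_sum W != 0.
Proof.
case/set0Pn => s sW; apply: contraNneq (r_neq0 pr s) => e.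
by have /(rs_eq0 pr)/(_ s sW)/eqP : gen_sum W * 1 = 0; rewrite ?mulr1 // e.
Qed.

Lemma hc_rM n x a : deg_part n.+1 (r x * a) = r x * deg_part n a.
Proof.
elim/(span_ind pr): a => [|c s a IH]; first by rewrite mulr0 !raddf0 mulr0.
rewrite mulrDr -scalerAr !linearP IH /= mulrDr -scalerAr -word_cons !hc_word /=.
by rewrite eqSS; case: ifP => _; rewrite ?mulr0 // word_cons.
Qed.

Lemma hc_rsM n W a : deg_part n.+1 (gen_sum W * a) = gen_sum W * deg_part n a.
Proof.
rewrite /gen_sum !mulr_suml linear_sum /=; apply: eq_bigr => x _; exact: hc_rM.
Qed.

(** The positive part of the right annihilator of the sum over W. For empty W it
is the augmentation ideal, which makes the first syzygy of the trivial module an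
instance of the general pattern. *)
Definition inK W a := aug a = 0 /\ gen_sum W * a = 0.

(** The component of degree 1 of the product is the augmentation of a times the
sum over W. *)
Lemma inK_aug W a : W != set0 -> gen_sum W * a = 0 -> aug a = 0.
Proof.
move=> /rs_neq0 nz e; have := congr1 (deg_part 1) e.
rewrite raddf0 hc_rsM hc0 -scalerAr mulr1 => /eqP.
by rewrite scaler_eq0 (negPf nz) orbF => /eqP.
Qed.

Lemma inK0 W : inK W 0.
Proof. by split; rewrite ?raddf0 ?mulr0. Qed.

Lemma inKD W a b : inK W a -> inK W b -> inK W (a + b).
Proof.
by move=> [a1 a2] [b1 b2]; split; rewrite ?rmorphD ?mulrDr ?a1 ?a2 ?b1 ?b2 addr0.
Qed.

Lemma inKM W a b : inK W a -> inK W (a * b).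
Proof. by move=> [a1 a2]; split; rewrite ?rmorphM ?mulrA ?a1 ?a2 mul0r. Qed.

Lemma inKN W a : inK W a -> inK W (- a).
Proof. by move=> [a1 a2]; split; rewrite ?rmorphN ?mulrN ?a1 ?a2 oppr0. Qed.

Lemma hc_aug n a : aug a = 0 -> aug (deg_part n a) = 0.
Proof.
move=> a0; have : deg_part 0 (deg_part n a) = 0.
  by rewrite hc_hc; case: eqP => [<-|//]; rewrite hc0 a0 scale0r.
rewrite hc0 => /eqP; rewrite scaler_eq0 oner_eq0 orbF => /eqP //.
Qed.

Lemma inK_hc n W a : inK W a -> inK W (deg_part n a).
Proof.
move=> [a1 a2]; split; first exact: hc_aug.
by rewrite -hc_rsM a2 raddf0.
Qed.

(** Elements of the right ideal generated by the linear annihilators of W. *)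
Definition linspan W a :=
  exists b : {set X} -> A, a = \sum_(C in clss W) gen_sum C * b C.

Definition lin_ann W := forall a, inK W a -> linspan W a.

Lemma linspan0 W : linspan W 0.
Proof. by exists (fun=> 0); rewrite big1 // => C _; rewrite mulr0. Qed.

Lemma linspanD W a a' : linspan W a -> linspan W a' -> linspan W (a + a').
Proof.
move=> [b ->] [b' ->]; exists (fun C => b C + b' C).
by rewrite -big_split; apply: eq_bigr => C _; rewrite mulrDr.
Qed.

Lemma linspanM W a c : linspan W a -> linspan W (a * c).
Proof.
move=> [b ->]; exists (fun C => b C * c); rewrite mulr_suml.
by apply: eq_bigr => C _; rewrite mulrA.
Qed.

Lemma linspan_sum W (I : Type) (s : seq I) (P : pred I) (f : I -> A) :
  (forall i, P i -> linspan W (f i)) -> linspan W (\sum_(i <- s | P i) f i).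
Proof. by move=> h; apply: big_ind => //; [exact: linspan0 | exact: linspanD]. Qed.

Lemma linspan_rs W C b : C \in clss W -> linspan W (gen_sum C * b).
Proof.
move=> CW; exists (fun D => if D == C then b else 0).
rewrite (bigD1 C) //= eqxx big1 ?addr0 // => D /andP[_ /negPf ->].
by rewrite mulr0.
Qed.

Lemma rs_clss W C : C \in clss W -> gen_sum W * gen_sum C = 0.
Proof.
case/imsetP => y _ ->.
have -> : gen_sum (cls W y) = \sum_z (z \in cls W y)%:R *: r z.
  rewrite /gen_sum big_mkcond; apply: eq_bigr => z _.
  by case: ifP; rewrite ?scale1r ?scale0r.
apply/rs_lin0 => u v uv; congr (_%:R).
have e : cls W v = cls W u by apply/eqP; rewrite -mem_cls inE connect1.
by rewrite !mem_cls e.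
Qed.

Lemma rs_aug C : aug (gen_sum C) = 0.
Proof. by rewrite /gen_sum rmorph_sum big1 // => z _; rewrite (pr_aug pr). Qed.

Lemma inK_clss W C : C \in clss W -> inK W (gen_sum C).
Proof. by split; [exact: rs_aug | exact: rs_clss]. Qed.

Lemma clssI W C D : C \in clss W -> D \in clss W ->
  C :&: D = if C == D then C else set0.
Proof.
move=> CW DW; case: eqP => [->|ne]; first exact: setIid.
apply/setP => z; rewrite !inE; apply/negP => /andP[zC zD]; apply: ne.
by rewrite (clss_mem CW zC) (clss_mem DW zD).
Qed.

Lemma rs0 : gen_sum set0 = 0.
Proof. exact: big_set0. Qed.

(** Distinct classes are disjoint, so their sums generate a direct sum of right
ideals and the summands can be recovered from the first letters. *)
Lemma pj_linspan W (b : {set X} -> A) D : D \in clss W ->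
  head_part D (\sum_(C in clss W) gen_sum C * b C) = gen_sum D * b D.
Proof.
move=> DW; rewrite linear_sum (bigD1 D) //= pj_rs setIid big1 ?addr0 //.
by move=> C /andP[CW /negPf nCD]; rewrite pj_rs (clssI CW DW) nCD rs0 mul0r.
Qed.

Lemma pj_clss_sum W a : aug a = 0 -> a = \sum_(C in clss W) head_part C a.
Proof.
move=> a0; have [b e] := first_letters pr a; rewrite a0 scale0r add0r in e.
rewrite e; under [RHS]eq_bigr => C _ do rewrite linear_sum /=.
rewrite exchange_big; apply: eq_bigr => x _ /=.
rewrite (bigD1 (cls W x)) ?cls_clss //= pj_rM cls_id big1 ?addr0 // => C.
case/andP => CW ne; rewrite pj_rM; case: ifP => // xC.
by rewrite (clss_mem CW xC) eqxx in ne.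
Qed.

Lemma degree1 a : deg_part 1 a = a -> exists q : X -> F, a = \sum_z q z *: r z.
Proof.
move=> <-; elim/(span_ind pr): a => [|c s a [q IH]].
  exists (fun=> 0); rewrite raddf0 big1 // => z _; exact: scale0r.
rewrite linearP IH hc_word; case: s => [|x [|y s]] /=.
- by exists q; rewrite scaler0 add0r.
- exists (fun z => (if z == x then c else 0) + q z).
  under [RHS]eq_bigr => z _ do rewrite scalerDl.
  rewrite big_split /= [X in _ = X + _](bigD1 x) //= eqxx.
  rewrite [X in _ = _ + X + _]big1 => [|z /negPf ->].
    by rewrite addr0 word_cons word_nil mulr1.
  by rewrite scale0r.
- by exists q; rewrite scaler0 add0r.
Qed.

Lemma linspan_degree1 W a : inK W a -> deg_part 1 a = a -> linspan W a.
Proof.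
move=> [_ Ka] /degree1[q e]; move: Ka; rewrite e => /rs_lin0 hq.
have hC C : C \in clss W -> exists c : F, forall z, z \in C -> q z = c.
  case/imsetP => y _ ->; exists (q y) => z; rewrite inE => /connectP[p pth ->].
  by elim: p y pth => //= w p IH y /andP[/hq -> /IH].
rewrite -e (pj_clss_sum W (a := a)); last first.
  rewrite e rmorph_sum big1 // => z _; by rewrite (augZ pr) (pr_aug pr) mulr0.
apply: linspan_sum => C CW; have [c qc] := hC C CW.
have -> : head_part C a = gen_sum C * (c *: 1).
  rewrite e linear_sum /= /gen_sum mulr_suml [RHS]big_mkcond; apply: eq_bigr => z _.
  rewrite linearZ_LR /= -[r z]mulr1 pj_rM; case: ifP => [zC|]; last by rewrite scaler0.
  by rewrite (qc z zC) -!scalerAr !mulr1.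
exact: linspan_rs.
Qed.

Lemma linspan_homog W a : (forall n, linspan W (deg_part n a)) -> linspan W a.
Proof.
move=> h; have [N /(_ N (leqnn _)) ->] := hc_sum pr a.
exact: linspan_sum.
Qed.

(** Graded Nakayama: an annihilator whose elements of degree at least two are
decomposable is generated by its linear elements. *)
Lemma lin_ann_nakayama W :
  (forall m a, (1 < m)%N -> inK W a -> deg_part m a = a ->
     exists w : seq (A * A), (forall t, t \in w -> inK W t.1 /\ aug t.2 = 0)
       /\ a = \sum_(t <- w) t.1 * t.2) ->
  lin_ann W.
Proof.
move=> dec a Ka; apply: linspan_homog => n.
have : deg_part n (deg_part n a) = deg_part n a by rewrite hc_hc eqxx.
have : inK W (deg_part n a) by exact: inK_hc.
move: (deg_part n a) => {Ka}a; elim/ltn_ind: n a => -[|[|m]] IH a Ka e.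
- rewrite -e hc0; case: Ka => -> _; rewrite scale0r; exact: linspan0.
- exact: linspan_degree1.
have [w [hw ea]] := dec m.+2 a isT Ka e.
rewrite -e ea linear_sum big_seq; apply: linspan_sum => -[k b] /hw[/= Kk b0].
(* The second factor has no scalar part, so the first one has smaller degree. *)
rewrite hcM; apply: linspan_sum => i _; have [im|] := ltnP i m.+2.
  apply: linspanM; apply: (IH i) => //; first exact: inK_hc.
  by rewrite hc_hc eqxx.
move=> mi; have -> : (m.+2 - i = 0)%N by apply/eqP; rewrite subn_eq0.
by rewrite hc0 b0 scale0r mulr0; apply: linspan0.
Qed.

End Annihilators.

Lemma classWE (F : fieldType) (d : Order.disp_t) (G : finBPOrderType d)
  (W : {set plus G}) z : classW F W z = cls W z.
Proof.
apply/setP => v; rewrite [LHS]inE; apply/asboolP/idP => [h|h q].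
  exact/(annihilator_separates (@Ralg_presented F d G)).
exact: (proj2 (annihilator_separates (@Ralg_presented F d G) W z v) h q).
Qed.

(** * Lifting along the image of a linear map *)

Section Lifting.
Variables (F : fieldType) (A : algType F) (M N : lmodType A^c).
Variable e : {linear M -> N}.

Definition image_pred : {pred N} := fun n => `[< exists m, e m = n >].

Lemma image_submod_closed : submod_closed image_pred.
Proof.
split; first by apply/asboolP; exists 0; rewrite raddf0.
move=> c _ _ /asboolP[m <-] /asboolP[m' <-]; apply/asboolP.
by exists (c *: m + m'); rewrite linearP.
Qed.

HB.instance Definition _ :=
  GRing.isSubmodClosed.Build A^c N image_pred image_submod_closed.

Record image_mod := ImageMod { image_val : N; _ : image_val \in image_pred }.

HB.instance Definition _ := [isSub for image_val].
HB.instance Definition _ := [Choice of image_mod by <:].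
HB.instance Definition _ := [SubChoice_isSubLmodule of image_mod by <:].

(** Projectivity speaks of surjections, so the codomain of e is restricted to its
image. *)
Lemma projective_lift (P : lmodType A^c) (f : {linear P -> N}) :
  projective P -> (forall p, exists m, e m = f p) ->
  exists h : {linear P -> M}, forall p, e (h p) = f p.
Proof.
move=> projP ef.
have fin p : f p \in image_pred by apply/asboolP/ef.
have ein m : e m \in image_pred by apply/asboolP; exists m.
have gl : linear (fun p => ImageMod (fin p)).
  by move=> c a b; apply: val_inj; rewrite /= linearP.
have hl : linear (fun m => ImageMod (ein m)).
  by move=> c a b; apply: val_inj; rewrite /= linearP.
pose g : {linear P -> image_mod} := HB.pack (fun p => ImageMod (fin p))
  (GRing.isLinear.Build A^c P image_mod *:%R _ gl).
pose e' : {linear M -> image_mod} := HB.pack (fun m => ImageMod (ein m))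
  (GRing.isLinear.Build A^c M image_mod *:%R _ hl).
have [|h hE] := projP M image_mod e' g.
  move=> [n nI]; have /asboolP[m em] := nI.
  by exists m; apply: val_inj.
by exists h => p; have := congr1 val (hE p).
Qed.

End Lifting.

(** * Linear annihilators from a linear resolution *)

Section FromKoszul.
Variables (F : fieldType) (d : Order.disp_t) (G : finBPOrderType d).
Local Notation X := (plus G).
Variables (A : algType F) (grA : nat -> A -> Prop) (aug : {rmorphism A -> F}).
Variable r : X -> A.
Hypothesis pr : presented grA aug r.
Local Notation deg_part := (deg_part pr).
Local Notation head_part := (head_part pr).
Local Notation gen_sum := (gen_sum r).
Local Notation inK := (inK aug r).
Local Notation AR := (A^c)^o.
Local Notation "v ** a" := ((a : A^c) *: v) (at level 40, left associativity).

Lemma ractA (V : lmodType A^c) (v : V) (a b : A) : v ** a ** b = v ** (a * b).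
Proof. exact: scalerA. Qed.

Lemma ractD (V : lmodType A^c) (v : V) (a b : A) : v ** (a + b) = v ** a + v ** b.
Proof. exact: scalerDl. Qed.

Lemma ractN (V : lmodType A^c) (v : V) (a : A) : v ** (- a) = - (v ** a).
Proof. exact: scaleNr. Qed.

Lemma lin_ract (V : lmodType A^c) (f : {linear V -> AR}) v (a : A) :
  f (v ** a) = (f v : A) * a.
Proof. exact: linearZ_LR. Qed.

Section GradedModule.
Variables (i : nat) (V : lmodType A^c) (gr : nat -> V -> Prop).
Hypothesis gV : graded_module grA gr.

Lemma gr0 n : gr n 0.
Proof. by case: gV => -[h _ _ _] _; apply: h. Qed.

Lemma grB n u v : gr n u -> gr n v -> gr n (u - v).
Proof. by case: gV => -[_ h _ _] _; apply: h. Qed.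

Lemma grN n u : gr n u -> gr n (- u).
Proof. by rewrite -sub0r; apply: grB; exact: gr0. Qed.

Lemma grD n u v : gr n u -> gr n v -> gr n (u + v).
Proof. by move=> gu gv; rewrite -[v]opprK; apply: grB => //; apply: grN. Qed.

Lemma gr_sum n (I : eqType) (s : seq I) (f : I -> V) :
  (forall j, j \in s -> gr n (f j)) -> gr n (\sum_(j <- s) f j).
Proof.
by move=> h; rewrite big_seq; apply: big_ind => //; [exact: gr0 | exact: grD].
Qed.

Lemma gr_ract m n v a : gr m v -> deg_part n a = a -> gr (m + n)%N (v ** a).
Proof. by move=> gv /(grP pr) ga; case: gV => _; apply. Qed.

(** Uniqueness of homogeneous components, with the component in a degree beyond N
read as zero. *)
Lemma gr_unique N (f : nat -> V) m v : (forall n, gr n (f n)) -> gr m v ->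
  v = \sum_(n < N) f n ->
  forall n, (if (n < N)%N then f n else 0) = (if n == m then v else 0).
Proof.
move=> gf gv e; have [[_ _ _ h] _] := gV.
pose g n := (if (n < N)%N then f n else 0) - (if n == m then v else 0).
have gg n : gr n (g n).
  apply: grB; first by case: ifP => _; [exact: gf | exact: gr0].
  by case: eqP => [->|_]; [exact: gv | exact: gr0].
have := h (maxn N m.+1) g gg; rewrite sumrB.
rewrite [X in X - _](_ : _ = v); last first.
  by rewrite e (big_ord_widen _ f (leq_maxl N m.+1)) [RHS]big_mkcond.
have mM : (m < maxn N m.+1)%N by rewrite leq_max ltnSn orbT.
rewrite [X in _ - X](bigD1 (Ordinal mM)) //= eqxx big1 ?addr0 => [|n nm]; last first.
  by case: eqP => // e'; case/eqP: nm; apply: val_inj.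
move=> {}h n; have [nM|] := ltnP n (maxn N m.+1).
  by have /eqP := h (subrr _) n nM; rewrite subr_eq0 => /eqP.
rewrite geq_max => /andP[Nn mn]; rewrite ltnNge Nn /=.
by case: eqP => // e'; rewrite e' ltnn in mn.
Qed.

Lemma gr_decomp v :
  exists N (f : nat -> V), (forall n, gr n (f n)) /\ v = \sum_(n < N) f n.
Proof. by case: gV => -[_ _ h _] _; apply: h. Qed.

(** In a module generated in degree i the elements of any other degree are
decomposable: the part of an expression with scalar coefficients has degree i. *)
Lemma gr_decomposable m y : generated_in_degree i gr -> gr m y -> m != i ->
  exists s : seq (A * V), (forall t, t \in s -> aug t.1 = 0)
    /\ y = \sum_(t <- s) t.2 ** t.1.
Proof.
move=> gen gy mi; have [s [hs e]] := gen y.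
have [N hN'] := hc_sum_seq pr [seq (t.1 : A) | t <- s].
have hN t : t \in s -> (t.1 : A) = \sum_(l < N) deg_part l t.1.
  by move=> ts; apply: hN'; apply: (map_f (fun t => t.1 : A)) ts.
pose f n := if (i <= n)%N then \sum_(t <- s) t.2 ** deg_part (n - i) t.1 else 0.
have gf n : gr n (f n).
  rewrite /f; case: leqP => [lin|_]; last exact: gr0.
  apply: gr_sum => t ts; rewrite -{1}(subnKC lin).
  by apply: gr_ract; [exact: hs | rewrite hc_hc eqxx].
have ef : y = \sum_(n < i + N) f n.
  rewrite e big_split_ord /= [X in _ = X + _]big1 ?add0r => [|n _]; last first.
    by rewrite /f leqNgt ltn_ord.
  rewrite big_seq; under eq_bigr => t ts.
    rewrite (hN t ts) scaler_suml; over.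
  rewrite -big_seq exchange_big /=; apply: eq_bigr => n _.
  by rewrite /f leq_addr addKn.
(* The scalar parts of the coefficients add up to the component of y in degree i. *)
have fi : f i = 0.
  have := gr_unique gf gy ef i; rewrite eq_sym (negPf mi).
  case: ltnP => // Ni _; rewrite -{2}[i]addn0 leq_add2l leqn0 in Ni.
  rewrite /f leqnn subnn big_seq big1 // => t ts.
  by rewrite (hN t ts) (eqP Ni) big_ord0 raddf0 scale0r.
exists [seq ((t.1 : A) - deg_part 0 t.1, t.2) | t <- s]; split.
  move=> _ /mapP[t ts ->] /=.
  by rewrite rmorphB hc0 (augZ pr) rmorph1 mulr1 subrr.
rewrite big_map /=; under eq_bigr => t _ do rewrite ractD ractN.
rewrite sumrB -e; move: fi; rewrite /f leqnn subnn => ->.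
by rewrite subr0.
Qed.

End GradedModule.

Section Resolution.
Variables (P : nat -> lmodType A^c) (gr : forall i, nat -> P i -> Prop).
Variables (D : forall i, {linear P i.+1 -> P i}).
Variable eps : {linear P 0%N -> trivmod aug}.
Hypothesis gP : forall i, graded_module grA (@gr i).
Hypothesis projP : forall i, projective (P i).
Hypothesis genP : forall i, generated_in_degree i (@gr i).
Hypothesis grD' : forall i n v, @gr i.+1 n v -> @gr i n (D i v).
Hypothesis eps_gr : forall n v, (0 < n)%N -> @gr 0%N n v -> eps v = 0.
Hypothesis eps_surj : forall c, exists v, eps v = c.
Hypothesis ker_eps : forall v, eps v = 0 <-> exists w, v = D 0%N w.
Hypothesis ker_D : forall i v, D i v = 0 <-> exists w, v = D i.+1 w.

(** The differential preserves degrees, so the component of degree m of any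
preimage is again a preimage. *)
Lemma homog_preimage i m y : @gr i m (D i y) ->
  exists2 y', @gr i.+1 m y' & D i y = D i y'.
Proof.
move=> gy; have [N [f [gf e]]] := gr_decomp (gP i.+1) y.
have gDf n : @gr i n (D i (f n)) by exact: grD'.
have eD : D i y = \sum_(n < N) D i (f n) by rewrite e linear_sum.
have := gr_unique (gP i) gDf gy eD m; rewrite eqxx; case: ifP => _ <-.
  by exists (f m).
by exists 0; [exact: gr0 (gP _) _ | rewrite raddf0].
Qed.

(** The set W is visible at stage i: up to an error t killed by the augmentation,
the annihilator of W is a retract of the i-th syzygy of the resolution. Only the
map into the resolution has to preserve degrees, and it is determined by the
single element w0. *)
Definition visible W i :=
  exists (w0 : P i) (f : {linear P i -> AR}) (t : A),
  [/\ @gr i i w0,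
      forall y, inK W (f (D i y)),
      forall z, inK W z -> exists y, w0 ** z = D i y,
      inK W t
    & forall z, inK W z -> (f w0 : A) * z = z + t * z].

(** The generator w0 lifts 1, and f lifts the augmentation of the resolution to the
algebra; f w0 then has augmentation 1. *)
Lemma visible0 : visible set0 0.
Proof.
have [v0 ev0] := eps_surj 1.
have [N [f [gf e]]] := gr_decomp (gP 0) v0.
have [w0 gw0 ew0] : exists2 w0, @gr 0%N 0%N w0 & eps w0 = 1.
  case: N e => [|N] e.
    by move: ev0; rewrite e big_ord0 raddf0 => /eqP; rewrite eq_sym oner_eq0.
  exists (f 0%N) => //; rewrite -ev0 e big_ord_recl raddfD raddf_sum /= big1 ?addr0 //.
  by move=> n _; apply: eps_gr (gf _).
have al : linear (aug : AR -> trivmod aug).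
  move=> c a b; rewrite /= rmorphD; congr (_ + _).
  by rewrite [LHS](rmorphM aug (a : A) (c : A)) mulrC.
pose aug' : {linear AR -> trivmod aug} := HB.pack (aug : AR -> trivmod aug)
  (GRing.isLinear.Build A^c AR (trivmod aug) *:%R _ al).
have [|f0 f0E] := projective_lift (e := aug') (f := eps) (@projP 0).
  by move=> p; exists ((eps p : F) *: (1 : A)); apply: (pr_augZ pr).
exists w0, f0, ((f0 w0 : A) - 1); split=> //.
- move=> y; split; last by rewrite rs0 mul0r.
  by apply: etrans (f0E _) _; apply/ker_eps; exists y.
- move=> z [z0 _]; apply/ker_eps; rewrite linearZ /= ew0.
  by apply: etrans (mulr1 _) _.
- split; last by rewrite rs0 mul0r.
  rewrite rmorphB rmorph1; apply/eqP; rewrite subr_eq0; apply/eqP.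
  by apply: etrans (f0E _) _.
- by move=> z _; rewrite mulrBl mul1r addrC subrK.
Qed.

(** An annihilator z of degree m > 1 is sent to an element w0 z of degree i + m of
the syzygy, whose generators have degree i + 1. It is therefore decomposable
there, and so is its image z + t z under f. *)
Lemma visible_lin_ann W i : visible W i -> lin_ann aug r W.
Proof.
move=> [w0 [f [t [gw0 fD Dz Kt fw0]]]].
apply: (lin_ann_nakayama (pr := pr) (W := W)) => m z m1 Kz hz.
have [y ey] := Dz z Kz.
have [y' gy' ey'] : exists2 y', @gr i.+1 (i + m)%N y' & D i y = D i y'.
  by apply: homog_preimage; rewrite -ey; exact: (gr_ract (gP i) gw0 hz).
have ne : (i + m != i.+1)%N by rewrite -addn1 eqn_add2l; case: m m1 {hz gy'} => [|[]].
have [s [hs es]] := gr_decomposable (gP i.+1) (@genP _) gy' ne.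
exists ((- t, z) :: [seq ((f (D i u.2) : A), u.1) | u <- s]); split.
  move=> u; rewrite inE => /orP[/eqP -> /=|/mapP[v vs ->] /=].
    by split; [exact: inKN | case: Kz].
  by split; [exact: fD | exact: hs].
rewrite big_cons big_map /= mulNr.
have -> : \sum_(u <- s) (f (D i u.2) : A) * u.1 = z + t * z.
  rewrite -fw0 // -lin_ract ey ey' es !linear_sum; apply: eq_bigr => u _ /=.
  by rewrite -lin_ract; congr (f _); rewrite linearZ_LR.
by rewrite addrCA addNr addr0.
Qed.

(** The right ideal of the class C is a direct summand of the annihilator of W, with
projection [head_part C]. Composing the data of W with inclusion and projection
gives maps between it and the i-th syzygy of the resolution; lifting these to the
free cover of the one and the projective cover of the other yields the data for
the annihilator of C. *)
Lemma visible_cls W i C : visible W i -> C \in clss W -> visible C i.+1.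
Proof.
move=> vis CW; have lW := visible_lin_ann vis.
have [w0 [f [t [gw0 fD Dz Kt fw0]]]] := vis.
have pjK z : inK W z -> exists b, head_part C z = gen_sum C * b.
  by move=> /lW[b ->]; exists (b C); rewrite pj_linspan.
have KC : inK W (gen_sum C) by exact: (inK_clss pr CW).
have [w1 gw1 ew1] : exists2 w1, @gr i.+1 i.+1 w1 & w0 ** gen_sum C = D i w1.
  have [y ey] := Dz _ KC; rewrite ey; apply: homog_preimage; rewrite -ey -addn1.
  apply: (gr_ract (gP i) gw0); rewrite /gen_sum linear_sum; apply: eq_bigr => x _.
  by rewrite -[r x]mulr1 -(word_nil r) -word_cons hc_word.
have fl : linear (fun y => head_part C (f (D i y)) : AR).
  move=> c u v; rewrite !linearD /=; congr (_ + _).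
  rewrite linearZ_LR [f _]lin_ract [LHS]pjM.
  by have [-> _] := fD u; rewrite scale0r addr0.
pose fC : {linear P i.+1 -> AR} := HB.pack (fun y => head_part C (f (D i y)) : AR)
  (GRing.isLinear.Build A^c (P i.+1) AR *:%R _ fl).
have ml : linear (fun a : AR => gen_sum C * (a : A) : AR).
  move=> c a b; rewrite mulrDr; congr (_ + _).
  exact: (mulrA (gen_sum C) (a : A) (c : A)).
pose mC : {linear AR -> AR} := HB.pack (fun a : AR => gen_sum C * (a : A) : AR)
  (GRing.isLinear.Build A^c AR AR *:%R _ ml).
have [|f1 f1E] := projective_lift (e := mC) (f := fC) (@projP i.+1).
  by move=> y; have [b e] := pjK _ (fD y); exists b; rewrite /= e.
have {}f1E y : gen_sum C * (f1 y : A) = head_part C (f (D i y)) by exact: f1E.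
(* f1 lifts the projection of f through multiplication by the sum over C; the error
   term of W, projected to C, becomes gen_sum C * u. *)
have C0 : C != set0.
  by case/imsetP: CW => x _ ->; apply/set0Pn; exists x; exact: cls_id.
have [u eu] := pjK _ Kt.
have ew : gen_sum C * (f1 w1 : A) = gen_sum C + gen_sum C * u * gen_sum C.
  rewrite f1E -ew1 lin_ract (fw0 _ KC) raddfD /= pjM eu.
  have -> : head_part C (gen_sum C) = gen_sum C.
    by rewrite -[X in head_part C X]mulr1 pj_rs setIid mulr1.
  by case: Kt => -> _; rewrite scale0r addr0.
exists w1, f1, ((f1 w1 : A) - 1 - u * gen_sum C); split=> //.
- move=> y; have e0 : gen_sum C * (f1 (D i.+1 y) : A) = 0.
    rewrite f1E; have -> : D i (D i.+1 y) = 0 by apply/ker_D; exists y.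
    by rewrite !raddf0.
  by split=> //; exact: (inK_aug pr C0 e0).
- move=> z [_ Cz]; apply/ker_D.
  by rewrite linearZ_LR /= -ew1 ractA Cz; exact: scale0r.
- have e0 : gen_sum C * ((f1 w1 : A) - 1 - u * gen_sum C) = 0.
    by rewrite !mulrBr ew mulr1 mulrA addrAC addrK subrr.
  by split=> //; exact: (inK_aug pr C0 e0).
- move=> z [_ Cz].
  by rewrite !mulrBl -mulrA Cz mulr0 mul1r subr0 addrC subrK.
Qed.

Lemma reach_visible W : reach W -> exists i, visible W i.
Proof.
elim=> [|V z _ [i vi]]; first by exists 0%N; exact: visible0.
by exists i.+1; apply: visible_cls vi (cls_clss _ _).
Qed.

End Resolution.

Lemma lin_ann_of_Koszul : Koszul grA aug -> forall W, reach W -> lin_ann aug r W.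
Proof.
move=> [P [gr [D [eps [hP [h1 h2 h3 h4 h5]]]]]] W rW.
have gP i : graded_module grA (gr i) by case: (hP i).
have projP i : projective (P i) by case: (hP i).
have genP i : generated_in_degree i (gr i) by case: (hP i).
have [i vi] := reach_visible gP projP genP h1 h2 h3 h4 h5 rW.
exact: (visible_lin_ann gP genP h1 vi).
Qed.

End FromKoszul.

(** * A linear free resolution from linear annihilators *)

Section ToKoszul.
Variables (F : fieldType) (d : Order.disp_t) (G : finBPOrderType d).
Local Notation X := (plus G).
Variables (A : algType F) (grA : nat -> A -> Prop) (aug : {rmorphism A -> F}).
Variable r : X -> A.
Hypothesis pr : presented grA aug r.
Hypothesis lin : forall W, reach W -> lin_ann aug r W.
Local Notation deg_part := (deg_part pr).
Local Notation gen_sum := (gen_sum r).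
Local Notation inK := (inK aug r).
Local Notation AR := (A^c)^o.

(** The basis of the i-th free module: sequences of i sets, each a linkage class of
the preceding one, beginning with a class of the empty set. *)
Definition is_flag (s : seq {set X}) := path (fun W C => C \in clss W) set0 s.

Definition flag (i : nat) : Type := {t : i.-tuple {set X} | is_flag t}.

Definition mkflag i (t : i.-tuple {set X}) (p : is_flag t) : flag i :=
  exist (fun t : i.-tuple {set X} => is_flag t) t p.

HB.instance Definition _ i := Finite.on (flag i).

Definition top i (t : flag i) : {set X} := last set0 (val t).

Lemma reach_top i (t : flag i) : reach (top t).
Proof.
rewrite /top; case: t => -[s /= _]; rewrite /is_flag => pth.
have : reach (set0 : {set X}) by exact: reach0.
elim: s (set0 : {set X}) pth => //= C s IH W /andP[CW ps] rW.
by apply: IH => //; case/imsetP: CW => z _ ->; apply: reach_cls.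
Qed.

Definition free_mod i : lmodType A^c := {ffun flag i -> AR}.

Definition mkfree i (f : flag i -> A) : free_mod i :=
  ([ffun t => f t] : {ffun flag i -> AR}).

Lemma mkfreeE i (f : flag i -> A) t : mkfree f t = f t.
Proof. by rewrite ffunE. Qed.

Definition ext i (v : free_mod i.+1) (t : flag i) C : A :=
  oapp (fun t' : flag i.+1 => (v t' : A)) 0 (insub [tuple of rcons (val t) C]).

Lemma extE i (v : free_mod i.+1) (t : flag i) C (t' : flag i.+1) :
  val t' = rcons (val t) C :> seq _ -> ext v t C = v t'.
Proof.
move=> e; rewrite /ext.
have -> : [tuple of rcons (val t) C] = val t' by apply: val_inj; rewrite /= e.
by rewrite valK.
Qed.

Lemma flag_split i (t' : flag i.+1) :
  exists2 t : flag i, top t' \in clss (top t) & val t' = rcons (val t) (top t') :> seq _.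
Proof.
case: t' => -[s ss] pth; rewrite /top /=; move: pth; rewrite /is_flag /= => pth.
case/lastP: s ss pth => // s C ss /=; rewrite rcons_path last_rcons => /andP[ps Cs].
have ss' : size s == i by move: ss; rewrite size_rcons eqSS.
by exists (@mkflag i (Tuple ss') ps).
Qed.

Lemma flag_ext i (t : flag i) C : C \in clss (top t) ->
  exists2 t' : flag i.+1, val t' = rcons (val t) C :> seq _ & top t' = C.
Proof.
move=> Ct; have pth : is_flag [tuple of rcons (val t) C].
  by rewrite /is_flag /= rcons_path Ct; have := valP t; rewrite /is_flag => ->.
by exists (mkflag pth); rewrite // /top /= last_rcons.
Qed.

Definition diff_fun i (v : free_mod i.+1) : free_mod i :=
  mkfree (fun t => \sum_(C in clss (top t)) gen_sum C * ext v t C).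

Lemma ext_linear i t C (c : A^c) (u v : free_mod i.+1) :
  ext (c *: u + v) t C = ext u t C * (c : A) + ext v t C.
Proof.
rewrite /ext; case: insub => [t'|] /=; last by rewrite mul0r addr0.
by rewrite !ffunE.
Qed.

Lemma diff_linear i : linear (@diff_fun i).
Proof.
move=> c u v; apply/ffunP => t; rewrite !ffunE /=.
under eq_bigr => C _ do rewrite ext_linear mulrDr mulrA.
by rewrite big_split -mulr_suml.
Qed.

HB.instance Definition _ i :=
  GRing.isLinear.Build A^c (free_mod i.+1) (free_mod i) *:%R (@diff_fun i)
    (@diff_linear i).

Definition diff i : {linear free_mod i.+1 -> free_mod i} := @diff_fun i.

Lemma diffE i (v : free_mod i.+1) t :
  diff i v t = \sum_(C in clss (top t)) gen_sum C * ext v t C.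
Proof. by rewrite ffunE. Qed.

Lemma top_neq0 i (t : flag i.+1) : top t != set0.
Proof.
have [u /imsetP[z _ ->] _] := flag_split t.
by apply/set0Pn; exists z; exact: cls_id.
Qed.

(** The right ideals of the classes of one set form a direct sum, so the components
of the differential vanish separately. *)
Lemma ker_diff i (v : free_mod i.+1) :
  diff i v = 0 <-> forall t, inK (top t) (v t).
Proof.
split=> [e t'|Kv]; last first.
  apply/ffunP => t; rewrite diffE ffunE big1 // => C /flag_ext[t' et' tC].
  by rewrite (extE v et') -tC; case: (Kv t').
have [t Ct et'] := flag_split t'.
have e0 : gen_sum (top t') * (v t' : A) = 0.
  have /ffunP/(_ t) := e; rewrite diffE ffunE => /(congr1 (head_part pr (top t'))).
  by rewrite raddf0 pj_linspan // (extE v et').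
by split=> //; apply: (inK_aug pr (top_neq0 t')).
Qed.

(** This is where linearity of the annihilators enters: their elements are
combinations of the class sums, which are the values of the differential on the
next basis. *)
Lemma im_diff i (v : free_mod i) :
  (exists w, v = diff i w) <-> forall t, inK (top t) (v t).
Proof.
split=> [[w ->] t|Kv].
  rewrite diffE; elim/big_ind: _ => [|a b|C CW]; first exact: inK0.
    exact: inKD.
  by apply: inKM; exact: (inK_clss pr CW).
have [b hb] := choice (fun t => lin (reach_top t) (Kv t)).
pose w : free_mod i.+1 := mkfree (fun t' : flag i.+1 =>
  if [pick t : flag i | rcons (val t) (top t') == val t' :> seq _] is Some t
  then b t (top t') else 0).
exists w; apply/ffunP => t; rewrite diffE hb; apply: eq_bigr => C Ct.
have [t' et' tC] := flag_ext Ct; rewrite (extE w et') mkfreeE tC.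
case: pickP => [t1|/(_ t)]; last by rewrite et' eqxx.
by rewrite et' => /eqP/rcons_inj[/val_inj/val_inj ->].
Qed.

(** The summand of the i-th module indexed by a flag is generated in degree i. *)
Definition shift_hc i n (a : A) : A := if (i <= n)%N then deg_part (n - i) a else 0.

Definition free_gr i n (v : free_mod i) := forall t, shift_hc i n (v t) = v t.

Lemma shift_hcD i n a b : shift_hc i n (a + b) = shift_hc i n a + shift_hc i n b.
Proof. by rewrite /shift_hc; case: ifP; rewrite ?linearD ?addr0. Qed.

Lemma shift_hcN i n a : shift_hc i n (- a) = - shift_hc i n a.
Proof. by rewrite /shift_hc; case: ifP; rewrite ?linearN ?oppr0. Qed.

Lemma shift_hc0 i n : shift_hc i n 0 = 0.
Proof. by rewrite /shift_hc raddf0 if_same. Qed.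

Lemma shift_hc_sum i n (I : Type) (s : seq I) (Q : pred I) (f : I -> A) :
  shift_hc i n (\sum_(j <- s | Q j) f j) = \sum_(j <- s | Q j) shift_hc i n (f j).
Proof. exact: (big_morph _ (shift_hcD i n) (shift_hc0 i n)). Qed.

Lemma shift_hc_hc i m n a :
  shift_hc i m (shift_hc i n a) = if m == n then shift_hc i n a else 0.
Proof.
rewrite /shift_hc; case: (leqP i m) => im; case: (leqP i n) => i_n.
- by rewrite hc_hc -(eqn_add2r i) !subnK.
- by rewrite raddf0 if_same.
- by case: eqP => // e; rewrite e ltnNge i_n in im.
- by rewrite if_same.
Qed.

Lemma shift_hc_rs i n C a : shift_hc i n (gen_sum C * a) = gen_sum C * shift_hc i.+1 n a.
Proof.
rewrite /shift_hc; case: (ltngtP i n) => [lt|gt|->].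
- by rewrite -(hc_rsM pr) subnSK.
- by rewrite mulr0.
- by rewrite subnn hc0 rmorphM (rs_aug pr) mul0r scale0r mulr0.
Qed.

Lemma hc_prod p q a b : deg_part p a = a -> deg_part q b = b ->
  deg_part (p + q)%N (a * b) = a * b.
Proof.
move=> ea eb; have lt : (p < (p + q).+1)%N by rewrite ltnS leq_addr.
rewrite hcM (bigD1 (Ordinal lt)) //= ea addKn eb big1 ?addr0 // => j nj.
by rewrite -ea hc_hc; case: eqP => [e|_]; [case/eqP: nj; apply: val_inj | rewrite mul0r].
Qed.

Lemma free_graded i : graded_module grA (@free_gr i).
Proof.
split; first split.
- by move=> n t; rewrite ffunE shift_hc0.
- by move=> n u v gu gv t; rewrite !ffunE shift_hcD shift_hcN gu gv.
- move=> v; have [N hN] := hc_sum_seq pr [seq (v t : A) | t : flag i].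
  exists (i + N)%N, (fun n => mkfree (fun t => shift_hc i n (v t))); split.
    by move=> n t; rewrite !ffunE shift_hc_hc eqxx.
  apply/ffunP => t; rewrite sum_ffunE; under eq_bigr do rewrite ffunE.
  rewrite big_split_ord /= big1 ?add0r => [|n _]; last first.
    by rewrite /shift_hc leqNgt ltn_ord.
  rewrite [LHS]hN; last by apply: image_f.
  by apply: eq_bigr => n _; rewrite /shift_hc leq_addr addKn.
- move=> N f gf e n nN; apply/ffunP => t; rewrite ffunE.
  have /ffunP/(_ t) := e; rewrite sum_ffunE ffunE => /(congr1 (shift_hc i n)).
  rewrite shift_hc_sum shift_hc0 (bigD1 (Ordinal nN)) //= big1 ?addr0 => [|m nm].
    by rewrite gf.
  rewrite -gf shift_hc_hc; case: eqP => // e1; case/eqP: nm; exact: val_inj.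
move=> m n v a gv /(grP pr) ga t; rewrite ffunE.
have := gv t; rewrite /shift_hc; case: leqP => [im ev|_ <-].
  by rewrite (leq_trans im (leq_addr _ _)) -addnBAC //; apply: hc_prod.
by rewrite scaler0 raddf0 if_same.
Qed.

Definition basis_elt i (t : flag i) : free_mod i := mkfree (fun t' => (t' == t)%:R).

Lemma basis_expand i (v : free_mod i) :
  v = \sum_(t : flag i) (v t : A^c) *: basis_elt t.
Proof.
apply/ffunP => t; rewrite sum_ffunE (bigD1 t) //= big1 ?addr0 => [|t' nt].
  by rewrite !ffunE eqxx; exact: (esym (mul1r (v t : A))).
by rewrite !ffunE eq_sym (negPf nt) scaler0.
Qed.

Lemma free_generated i : generated_in_degree i (@free_gr i).
Proof.
move=> v; exists [seq ((v t : A^c), basis_elt t) | t : flag i]; split.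
  move=> _ /imageP[t _ ->] t' /=; rewrite ffunE /shift_hc leqnn subnn hc0.
  by case: eqP => _; rewrite ?rmorph1 ?rmorph0 ?scale1r ?scale0r.
by rewrite big_image /= -basis_expand.
Qed.

Lemma free_projective i : projective (free_mod i).
Proof.
move=> M N f g fs; have [m hm] := choice (fun t : flag i => fs (g (basis_elt t))).
have hl : linear (fun v : free_mod i => \sum_t (v t : A^c) *: m t).
  move=> c u v; rewrite scaler_sumr -big_split; apply: eq_bigr => t _ /=.
  by rewrite !ffunE scalerDl scalerA.
pose h : {linear free_mod i -> M} := HB.pack
  (fun v : free_mod i => \sum_t (v t : A^c) *: m t)
  (GRing.isLinear.Build A^c (free_mod i) M *:%R _ hl).
exists h => v; rewrite /= linear_sum [in RHS](basis_expand v) linear_sum.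
by apply: eq_bigr => t _; rewrite !linearZ_LR hm.
Qed.

Definition flag0 : flag 0 := @mkflag 0 [tuple] isT.

Definition free_eps_fun (v : free_mod 0) : trivmod aug := aug (v flag0).

Lemma free_eps_linear : linear free_eps_fun.
Proof.
move=> c u v; rewrite /free_eps_fun !ffunE rmorphD; congr (_ + _).
by rewrite [LHS](rmorphM aug (u flag0 : A) (c : A)) mulrC.
Qed.

HB.instance Definition _ :=
  GRing.isLinear.Build A^c (free_mod 0) (trivmod aug) *:%R free_eps_fun
    free_eps_linear.

Lemma flag0_unique (t : flag 0) : t = flag0.
Proof. by apply: val_inj; apply: val_inj; case: t => -[[]]. Qed.

Lemma Koszul_of_lin_ann : Koszul grA aug.
Proof.
exists free_mod, free_gr, diff, free_eps_fun; split.
  by move=> i; split;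
    [exact: free_graded | exact: free_projective | exact: free_generated].
split.
- move=> i n v gv t; rewrite diffE shift_hc_sum; apply: eq_bigr => C Ct.
  by have [t' et' _] := flag_ext Ct; rewrite (extE v et') shift_hc_rs gv.
- move=> n v n0 /(_ flag0); rewrite /shift_hc /= subn0 => e.
  rewrite /free_eps_fun; have : deg_part 0 (v flag0) = 0.
    by rewrite -e hc_hc; case: n n0 {e}.
  by rewrite hc0 => /eqP; rewrite scaler_eq0 oner_eq0 orbF => /eqP.
- move=> c; exists (mkfree (fun=> (c : F) *: (1 : A))).
  by rewrite /= /free_eps_fun ffunE (pr_augZ pr).
- move=> v; rewrite im_diff; split=> [e t|/(_ flag0)[]//].
  by rewrite (flag0_unique t); split=> //; rewrite rs0 mul0r.
- by move=> i v; rewrite ker_diff im_diff.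
Qed.

End ToKoszul.

(** * Ranks in finite posets *)

Section Rank.
Context {d : Order.disp_t} {P : finBPOrderType d}.
Implicit Types (x y z b : P) (C : {set P}).
Local Open Scope order_scope.

Definition ndown x : nat := #|[set y : P | y < x]|.

Lemma ndown_lt x y : x < y -> (ndown x < ndown y)%N.
Proof.
move=> xy; apply/proper_card/properP; split.
  by apply/subsetP => z; rewrite !inE => /lt_trans; apply.
by exists x; rewrite inE // ltxx.
Qed.

Lemma covers_lt x y : covers x y -> y < x.
Proof. by case/andP. Qed.

Lemma lower_cover x y : y < x -> exists2 z, covers x z & y <= z.
Proof.
move=> yx; have h0 : (y <= y) && (y < x) by rewrite lexx.
have [z /andP[yz zx] zmax] := arg_maxnP (P := fun z => (y <= z) && (z < x)) ndown h0.
exists z => //; rewrite /covers zx; apply/forallP => u; apply/negP => /andP[zu ux].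
have := zmax u; rewrite ux (le_trans yz (ltW zu)) => /(_ isT).
by rewrite /= leqNgt ndown_lt.
Qed.

Section RankFunction.
Variable rho : P -> nat.
Hypotheses (rho_cov : forall x y, covers x y -> rho x = (rho y).+1).

Lemma rank_fun_lt x y : x < y -> (rho x < rho y)%N.
Proof.
move: {2}(ndown y) (leqnn (ndown y)) => n; elim: n y => [|n IH] y hn xy.
  by have := ndown_lt xy; rewrite ltnNge (leq_trans hn).
have [z cz xz] := lower_cover xy; rewrite (rho_cov cz) ltnS.
move: xz; rewrite le_eqVlt => /orP[/eqP -> //|xz]; apply/ltnW/IH => //.
by rewrite -ltnS; apply: leq_trans hn; apply/ndown_lt/covers_lt.
Qed.

Lemma rank_fun_le x y : x <= y -> (rho x <= rho y)%N.
Proof. by rewrite le_eqVlt => /orP[/eqP ->//|/rank_fun_lt/ltnW]. Qed.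

Lemma rank_fun_covers x y : y < x -> rho x = (rho y).+1 -> covers x y.
Proof.
move=> yx e; rewrite /covers yx; apply/forallP => z; apply/negP => /andP[yz zx].
by have := rank_fun_lt yz; have := rank_fun_lt zx; rewrite e ltnS leqNgt => /negPf ->.
Qed.

End RankFunction.

Lemma chainP C : reflect {in C &, forall x y, x >=< y} (is_chain C).
Proof.
apply: (iffP forall_inP) => h x; first by move=> y xC yC; apply: (forall_inP (h x xC)).
by move=> xC; apply/forall_inP => y; apply: h.
Qed.

Lemma chain_add b C : is_chain C -> {in C, forall y, b >=< y} -> is_chain (b |: C).
Proof.
move/chainP => cC bC; apply/chainP => x y; rewrite !inE.
case/predU1P => [->|xC]; case/predU1P => [->|yC]; first exact: comparablexx.
- exact: bC.
- by rewrite comparable_sym bC.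
- exact: cC.
Qed.

Lemma max_chainP b C : reflect
  [/\ {in C, forall y, y <= b}, is_chain C
    & forall x, x <= b -> {in C, forall y, x >=< y} -> x \in C]
  (max_chain b C).
Proof.
apply: (iffP maxsetP) => [[/andP[/subsetP sC cC] mx]|[sC cC mx]].
  split=> // [y /sC|x xb xC]; first by rewrite inE.
  have <- : x |: C = C; last by rewrite setU11.
  apply: mx; last exact: subsetUr.
  rewrite chain_add // andbT; apply/subsetP => y; rewrite !inE.
  by case/predU1P => [->//|/sC]; rewrite inE.
split; first by rewrite cC andbT; apply/subsetP => y /sC; rewrite inE.
move=> D /andP[/subsetP sD /chainP cD] CD; apply/eqP; rewrite eqEsubset CD andbT.
apply/subsetP => x xD; apply: mx => [|y yC]; first by have := sD x xD; rewrite inE.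
by apply: cD => //; apply: (subsetP CD).
Qed.

Lemma max_chain_exists b : exists C, max_chain b C.
Proof.
have [|C mC _] := @maxset_exists _
  (fun C => (C \subset [set y | y <= b]) && is_chain C) set0; last by exists C.
by rewrite sub0set; apply/chainP => x y; rewrite inE.
Qed.

Lemma max_chain_top b C : max_chain b C -> b \in C.
Proof. by case/max_chainP => sC _; apply=> // y /sC/ge_comparable. Qed.

(** The greatest element of the rest of the chain is covered by b, since anything in
between could be added to the chain. *)
Lemma max_chain_pred b C : b != \bot -> max_chain b C ->
  exists2 b', covers b b' & max_chain b' (C :\ b).
Proof.
move=> b0 mC; have bC := max_chain_top mC.
have /max_chainP[sC cC mx] := mC.
have botC : \bot \in C :\ b.
  by rewrite !inE eq_sym b0; apply: mx => // y _; apply/le_comparable/le0x.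
have [b' b'C bmax] := arg_maxnP (P := fun z => z \in C :\ b) ndown botC.
have /[!inE]/andP[b'b b'C'] := b'C.
have top y : y \in C :\ b -> y <= b'.
  move=> yC; have /[!inE]/andP[_ yC'] := yC.
  have := chainP _ cC _ _ yC' b'C'; case/comparable_leP => // lt.
  by have := bmax y yC; rewrite /= leqNgt ndown_lt.
have b'ltb : b' < b by rewrite lt_neqAle b'b sC.
exists b'.
  rewrite /covers b'ltb; apply/forallP => z; apply/negP => /andP[b'z zb].
  have zC : z \in C.
    apply: mx => [|y yC]; first exact: ltW.
    have [->|nyb] := eqVneq y b; first exact/le_comparable/ltW.
    apply/ge_comparable/ltW/(le_lt_trans _ b'z)/top.
    by rewrite !inE nyb.
  have := top z; rewrite !inE zC (lt_eqF zb) => /(_ isT) /(lt_le_trans b'z).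
  by rewrite ltxx.
apply/max_chainP; split=> [//| |x xb' xC].
  by apply/chainP => x y /[!inE]/andP[_ xC] /andP[_ yC]; apply: (chainP _ cC).
have xb := le_lt_trans xb' b'ltb.
rewrite !inE (lt_eqF xb); apply: mx => [|y yC]; first exact: ltW.
have [->|nyb] := eqVneq y b; first exact/le_comparable/ltW.
by apply: xC; rewrite !inE nyb.
Qed.

Lemma max_chain_bot C : max_chain \bot C -> #|C| = 1%N.
Proof.
move=> mC; have bC := max_chain_top mC; have /max_chainP[sC _ _] := mC.
apply/eqP/cards1P; exists \bot; apply/setP => y; rewrite inE.
by apply/idP/eqP => [/sC|-> //]; rewrite lex0 => /eqP.
Qed.

(** Maximal chains descend by covers, so that all those below b have the length
prescribed by the function. *)
Lemma rank_fun_unique (rho : P -> nat) : rho \bot = 0%N ->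
  (forall x y, covers x y -> rho x = (rho y).+1) ->
  forall b, rk b = rho b.
Proof.
move=> rho0 rho_cov.
have card n b C : #|C| = n -> max_chain b C -> #|C| = (rho b).+1.
  elim: n b C => [|n IH] b C eC mC.
    by move: (max_chain_top mC); rewrite (cards0_eq eC) inE.
  have [b0|nb0] := eqVneq b \bot.
    by rewrite b0 in mC *; rewrite rho0 max_chain_bot.
  have [b' cb mC'] := max_chain_pred nb0 mC.
  have eC' : #|C :\ b| = n.
    by move: eC; rewrite (cardsD1 b C) max_chain_top // => -[].
  by rewrite eC (rho_cov _ _ cb) -(IH _ _ eC' mC') eC'.
move=> b; rewrite /rk; have [C mC] := max_chain_exists b.
suff -> : \max_(C' : {set P} | max_chain b C') #|C'| = (rho b).+1 by [].
apply/anti_leq/andP; split.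
  by apply/bigmax_leqP => C' /(card _ b C' erefl) ->.
rewrite -(card _ b C erefl mC).
exact: (@leq_bigmax_cond _ (fun C : {set P} => max_chain b C) (fun C => #|C|) C mC).
Qed.

Lemma max_chain_cover x y C : covers x y -> max_chain y C ->
  max_chain x (x |: C) /\ x \notin C.
Proof.
move=> cxy mC; have yC := max_chain_top mC; have yx := covers_lt cxy.
have /max_chainP[sC cC mx] := mC.
have Cx z : z \in C -> z < x by move/sC => zy; apply: le_lt_trans zy yx.
split; last by apply/negP => /Cx; rewrite ltxx.
apply/max_chainP; split=> [z| |z zx zC].
- by case/setU1P => [->//|/Cx/ltW].
- by apply: chain_add => // z /Cx/ltW/ge_comparable.
have := zC y; rewrite !inE yC orbT => /(_ isT); have [-> //|nzx] := eqVneq z x.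
case/comparable_leP => [zy|yz].
  by apply: mx => // u uC; apply: zC; rewrite inE uC orbT.
case/andP: cxy => _ /forallP/(_ z).
by rewrite yz lt_neqAle nzx zx.
Qed.

Lemma rk_max_chain (rP : ranked P) b C : max_chain b C -> #|C| = (rk b).+1.
Proof.
move=> mC; have C0 : (0 < #|C|)%N by apply/card_gt0P; exists b; apply: max_chain_top.
rewrite /rk; suff -> : \max_(C' : {set P} | max_chain b C') #|C'| = #|C| by rewrite prednK.
apply/anti_leq/andP; split; last exact:
    (@leq_bigmax_cond _ (fun C : {set P} => max_chain b C) (fun C => #|C|) C mC).
by apply/bigmax_leqP => C' mC'; rewrite (rP b C' C).
Qed.

Lemma rk_covers (rP : ranked P) x y : covers x y -> rk x = (rk y).+1.
Proof.
move=> cxy; have [C mC] := max_chain_exists y; have [mC' xC] := max_chain_cover cxy mC.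
apply: succn_inj; rewrite -(rk_max_chain rP mC) -(rk_max_chain rP mC').
by rewrite cardsU1 xC.
Qed.

Lemma rk_bot : rk (\bot : P) = 0%N.
Proof.
apply/eqP; rewrite -leqn0 /rk -subn1 leq_subLR addn0.
by apply/bigmax_leqP => C /max_chain_bot ->.
Qed.

End Rank.

(** * Truncated posets and their chains *)

Section Truncation.
Variables (F : fieldType) (d : Order.disp_t) (G : finBPOrderType d).
Local Notation X := (plus G).
Local Notation cov := (fun x y : X => covers (val x) (val y)).
Variables (A : algType F) (grA : nat -> A -> Prop) (aug : {rmorphism A -> F}).
Variable r : X -> A.
Hypothesis pr : presented grA aug r.
Hypothesis rG : ranked G.
Local Notation deg_part := (deg_part pr).
Local Notation head_part := (head_part pr).
Local Notation gen_sum := (gen_sum r).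
Local Notation word := (word r).

(** P is a copy of a set of elements of G of rank at least m, closed under going
down within these ranks, together with the minimum. Working with an embedding
avoids nested subtypes. *)
Variables (d' : Order.disp_t) (P : finBPOrderType d') (emb : P -> G) (m : nat).
Hypothesis m_gt0 : (0 < m)%N.
Hypothesis emb_le : forall p q, (emb p <= emb q)%O = (p <= q)%O.
Hypothesis emb_bot : emb \bot%O = \bot%O.
Hypothesis emb_rk : forall p, p != \bot%O -> (m <= rk (emb p))%N.
Hypothesis emb_down : forall p a, (a <= emb p)%O -> (m <= rk a)%N ->
  exists q, emb q = a.

Implicit Types (p q y : P) (s t : seq P).

Lemma emb_inj : injective emb.
Proof. by move=> p q e; apply/le_anti; rewrite -!emb_le e lexx. Qed.

Lemma emb_lt p q : (emb p < emb q)%O = (p < q)%O.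
Proof. by rewrite !lt_neqAle emb_le (inj_eq emb_inj). Qed.

Lemma emb_neq0 p : p != \bot%O -> emb p != \bot%O.
Proof. by rewrite -emb_bot (inj_eq emb_inj). Qed.

Let rkG_lt := rank_fun_lt (rk_covers rG).
Lemma covers_emb p q : q != \bot%O -> covers p q = covers (emb p) (emb q).
Proof.
move=> q0; rewrite /covers emb_lt; case: (boolP (q < p)%O) => //= qp.
apply/forallP/forallP => h z; apply/negP => /andP[qz zp]; last first.
  by have := h (emb z); rewrite !emb_lt qz zp.
have [u eu] := emb_down (ltW zp) (leq_trans (emb_rk q0) (ltnW (rkG_lt qz))).
by have := h u; rewrite -!emb_lt eu qz zp.
Qed.

Definition trunc_rank p : nat := if p == \bot%O then 0%N else (rk (emb p) - m).+1.

(** An element that covers the minimum of P has rank m in G: if its rank were larger,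
an element covered by it in G would still belong to P. *)
Lemma trunc_rank_covers p q : covers p q -> trunc_rank p = (trunc_rank q).+1.
Proof.
move=> cpq; have qp := covers_lt cpq; rewrite /trunc_rank.
have p0 : p != \bot%O by rewrite (gt_eqF (le_lt_trans (le0x q) qp)).
rewrite (negPf p0); have [q0|q0] := eqVneq q \bot%O; last first.
  rewrite covers_emb // in cpq.
  by rewrite (rk_covers rG cpq) subSn // emb_rk.
congr _.+1; apply/eqP; rewrite subn_eq0 leqNgt; apply/negP => lt.
have p0' : (\bot < emb p)%O by rewrite lt0x emb_neq0.
have [z cz _] := lower_cover p0'.
have rz : (m <= rk z)%N by rewrite (rk_covers rG cz) in lt.
have [u eu] := emb_down (ltW (covers_lt cz)) rz.
have u0 : u != \bot%O.
  by apply: contraTneq rz => u0; rewrite -eu u0 emb_bot rk_bot // -ltnNge.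
case/andP: cpq => _ /forallP/(_ u); rewrite q0 lt0x u0 -emb_lt eu.
by rewrite (covers_lt cz).
Qed.

Lemma rk_trunc p : rk p = trunc_rank p.
Proof.
by apply: rank_fun_unique trunc_rank_covers _; rewrite /trunc_rank eqxx.
Qed.

Lemma rk_emb p : p != \bot%O -> (rk (emb p)).+1 = (rk p + m)%N.
Proof.
by move=> p0; rewrite rk_trunc /trunc_rank (negPf p0) addSn subnK // emb_rk.
Qed.

Lemma rk_trunc_covers p q : covers p q -> rk p = (rk q).+1.
Proof. by rewrite !rk_trunc; apply: trunc_rank_covers. Qed.

Let rkP_lt := rank_fun_lt rk_trunc_covers.

Lemma rk_gt0 p : (0 < rk p)%N = (p != \bot%O).
Proof. by rewrite rk_trunc /trunc_rank; case: eqP. Qed.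

Definition wX (s : seq P) : seq X := pmap (fun p => insub (emb p)) s.

Arguments wX : simpl never.

Lemma emb_up p : p != \bot%O -> exists x : X, val x = emb p.
Proof. by move=> p0; exists (Sub (emb p) (emb_neq0 p0)); rewrite SubK. Qed.

Lemma wX_cons (x : X) p s : val x = emb p -> wX (p :: s) = x :: wX s.
Proof. by move=> e; rewrite /wX /= -e valK. Qed.

Lemma wX_cat s t : wX (s ++ t) = wX s ++ wX t.
Proof. exact: pmap_cat. Qed.

Definition nonbot (s : seq P) := all (fun p => p != \bot%O) s.

Lemma wX_val s : nonbot s -> map val (wX s) = map emb s.
Proof.
elim: s => //= p s IH /andP[p0 s0]; have [x ex] := emb_up p0.
by rewrite (wX_cons s ex) /= ex IH.
Qed.

Lemma wX_inj s t : nonbot s -> nonbot t -> wX s = wX t -> s = t.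
Proof.
move=> s0 t0 e; apply: (inj_map emb_inj).
by rewrite -!wX_val // e.
Qed.

Lemma size_wX s : nonbot s -> size (wX s) = size s.
Proof. by move=> s0; rewrite -(size_map val) wX_val // size_map. Qed.

Lemma sorted_wX s : nonbot s -> sorted (fun p q => covers p q) s -> sorted cov (wX s).
Proof.
move=> s0 ss.
have -> : sorted cov (wX s) = sorted (fun a b : G => covers a b) (map val (wX s)).
  by rewrite sorted_map.
rewrite wX_val // sorted_map.
apply: (sub_in_sorted (P := fun p => p != \bot%O)) ss => // p q p0 q0 /=.
by rewrite covers_emb.
Qed.

Definition chain_below (y : P) (s : seq P) :=
  sorted <%O s && all (fun z => \bot < z < y)%O s.

Lemma chain_nonbot y s : chain_below y s -> nonbot s.
Proof.
by case/andP => _ /allP h; apply/allP => z /h /andP[z0 _]; rewrite -lt0x.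
Qed.

(** A saturated path going down from y cannot leave P before it has reached rank m,
which it does with its last letter. *)
Lemma chain_word y w (x : X) : path cov x w -> val x = emb y ->
  rk y = (size w).+1 ->
  exists s, [/\ size s = size w, chain_below y s & wX (rev s) = w].
Proof.
elim: w x y => [|z w IH] x y /=; first by move=> _ _ _; exists [::].
case/andP => cxz pth ex ry; have y0 : y != \bot%O by rewrite -rk_gt0 ry.
have rz : (rk (val z)).+1 = ((size w).+1 + m)%N.
  by apply: succn_inj; rewrite -(rk_covers rG cxz) ex rk_emb // ry addSn.
have mz : (m <= rk (val z))%N by rewrite -ltnS rz addSn ltnS leq_addl.
have zy : (val z < emb y)%O by rewrite -ex; apply: covers_lt.
have [q eq] := emb_down (ltW zy) mz; rewrite -eq emb_lt in zy.
have q0 : q != \bot%O.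
  apply: contraTneq mz => q0.
  by rewrite -eq q0 emb_bot rk_bot // -ltnNge.
have rq : rk q = (size w).+1.
  by apply/eqP; rewrite -(eqn_add2r m) -rk_emb // eq rz.
have [s [es /andP[ss /allP s0] ws]] := IH z q pth (esym eq) rq.
exists (rcons s q); split; first by rewrite size_rcons es.
  apply/andP; split.
    rewrite (sorted_pairwise lt_trans) pairwise_rcons -(sorted_pairwise lt_trans) ss.
    by rewrite andbT; apply/allP => u /s0/andP[].
  rewrite all_rcons zy lt0x q0; apply/allP => u /s0/andP[-> uq].
  exact: lt_trans uq zy.
by rewrite rev_rcons (wX_cons _ (esym eq)) ws.
Qed.

(** The ranks along s increase strictly and lie strictly between 0 and the rank of
y, which leaves only one possibility. *)
Lemma ranks_of_chain y s : chain_below y s -> rk y = (size s).+1 ->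
  map (@rk d' P) s = seq.iota 1 (size s).
Proof.
case/andP => ss /allP sy ry; apply: (irr_sorted_eq ltn_trans ltnn).
- rewrite sorted_map; apply: sub_sorted ss => p q; exact: rkP_lt.
- exact: iota_ltn_sorted.
have sub : {subset map (@rk d' P) s <= seq.iota 1 (size s)}.
  move=> _ /mapP[z /sy /andP[z0 zy] ->]; rewrite mem_iota rk_gt0 -lt0x z0 add1n.
  by rewrite -ry rkP_lt.
have u : uniq (map (@rk d' P) s).
  apply: (sorted_uniq ltn_trans ltnn); rewrite sorted_map.
  by apply: sub_sorted ss => p q; exact: rkP_lt.
by apply: (uniq_min_size u sub _).2; rewrite size_iota size_map.
Qed.

Lemma chain_covers y s : chain_below y s -> rk y = (size s).+1 ->
  sorted (fun p q => covers p q) (y :: rev s).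
Proof.
move=> cs ry; have rks := ranks_of_chain cs ry; have /andP[ss /allP sy] := cs.
have sy' : sorted <%O (rcons s y).
  rewrite (sorted_pairwise lt_trans) pairwise_rcons -(sorted_pairwise lt_trans) ss.
  by rewrite andbT; apply/allP => u /sy/andP[].
have rks' : map (@rk d' P) (rcons s y) = seq.iota 1 (size s).+1.
  by rewrite map_rcons rks ry -[(size s).+1 in RHS]addn1 iotaD -cats1 /= add1n.
rewrite -rev_rcons rev_sorted; apply/(sortedP \bot%O) => i; rewrite size_rcons => hi.
apply: (rank_fun_covers rk_trunc_covers); first by apply/(sortedP \bot%O); rewrite ?size_rcons.
have nE k : (k < (size s).+1)%N -> rk (nth \bot%O (rcons s y) k) = k.+1.
  move=> hk; rewrite -(nth_map \bot%O 0%N (@rk d' P)) ?size_rcons //.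
  by rewrite rks' nth_iota // add1n.
by rewrite !nE // ltnW.
Qed.

(** * Cochains and words *)

(** A face determines which vertex was removed, because the ranks of a maximal
chain are consecutive. *)
Lemma face_index n s s' i i' :
  map (@rk d' P) s = seq.iota 1 n -> map (@rk d' P) s' = seq.iota 1 n ->
  (i < n)%N -> (i' < n)%N -> face i s = face i' s' -> i = i'.
Proof.
move=> es es' hi hi' /(congr1 (map (@rk d' P))).
rewrite /face !map_cat !map_take !map_drop es es'.
suff ne k k' : (k < k')%N -> (k' < n)%N ->
    take k (seq.iota 1 n) ++ drop k.+1 (seq.iota 1 n)
    <> take k' (seq.iota 1 n) ++ drop k'.+1 (seq.iota 1 n).
  by case: (ltngtP i i') => // lt e; [case: (ne i i') | case: (ne i' i)].
move=> kk' k'n /(congr1 (fun u => nth 0%N u k)); rewrite !nth_cat.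
rewrite !size_takel ?size_iota ?(ltnW k'n) ?(ltnW (ltn_trans kk' k'n)) //.
rewrite ltnn kk' subnn nth_drop addn0 nth_take // !nth_iota ?(ltn_trans kk' k'n) //.
  by rewrite !add1n => -[] /eqP; rewrite eqn_leq ltnn.
exact: leq_ltn_trans kk' k'n.
Qed.

(** A chain is written with its top element first, as words are. *)
Definition cword y (c : seq P) : seq X := wX (y :: rev c).

Section TopDegree.
Variables (y : P) (j : nat).
Hypothesis ry : rk y = j.+1.

Lemma y_neq0 : y != \bot%O.
Proof. by rewrite -rk_gt0 ry. Qed.

Lemma simplex_chain (c : simplex y j) : chain_below y c.
Proof. exact: (valP c). Qed.

Lemma simplex_size (c : simplex y j) : size c = j.
Proof. exact: size_tuple. Qed.

Lemma simplex_ranks (c : simplex y j) : map (@rk d' P) c = seq.iota 1 j.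
Proof. by rewrite (ranks_of_chain (simplex_chain c)) simplex_size. Qed.

Lemma simplex_nonbot (c : simplex y j) : nonbot (y :: rev c).
Proof. by rewrite /nonbot /= y_neq0 all_rev; apply: chain_nonbot (simplex_chain c). Qed.

Lemma cword_sorted (c : simplex y j) : sorted cov (cword y c).
Proof.
apply: sorted_wX; first exact: simplex_nonbot.
by apply: chain_covers (simplex_chain c) _; rewrite simplex_size.
Qed.

Lemma cword_size (c : simplex y j) : size (cword y c) = j.+1.
Proof. by rewrite size_wX ?simplex_nonbot //= size_rev simplex_size. Qed.

Lemma cword_inj (c c' : simplex y j) : cword y c = cword y c' -> c = c'.
Proof.
move/wX_inj => /(_ (simplex_nonbot c) (simplex_nonbot c')) [] /(congr1 rev).
by rewrite !revK => e; apply/val_inj/val_inj.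
Qed.

Lemma cword_surj (x : X) w : path cov x w -> val x = emb y -> size w = j ->
  exists c : simplex y j, cword y c = x :: w.
Proof.
move=> pth ex sw; have [|s [ss cs ws]] := chain_word pth ex; first by rewrite ry sw.
have sj : size s == j by rewrite ss sw.
by exists (@Simplex _ _ y j (Tuple sj) cs); rewrite /cword (wX_cons _ ex) /= ws.
Qed.

Lemma no_bigger_simplex (c : simplex y j.+1) : False.
Proof.
have /andP[ss /allP sy] := valP c.
have u : uniq (map (@rk d' P) c).
  apply: (sorted_uniq ltn_trans ltnn); rewrite sorted_map.
  by apply: sub_sorted ss => p q; exact: rkP_lt.
have sub : {subset map (@rk d' P) c <= seq.iota 1 j}.
  move=> _ /mapP[z /sy /andP[z0 zy] ->]; rewrite mem_iota rk_gt0 -lt0x z0 add1n.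
  by rewrite -ry rkP_lt.
by have := uniq_leq_size u sub; rewrite size_map size_tuple size_iota ltnn.
Qed.

Lemma top_cocycle (f : {ffun simplex y j -> F}) : is_cocycle f.
Proof. by apply/ffunP => c; case: (no_bigger_simplex c). Qed.

End TopDegree.

Lemma cword_split y (c : seq P) i : (i < size c)%N -> nonbot c ->
  exists z, cword y c = wX (y :: rev (drop i.+1 c)) ++ z :: wX (rev (take i c)).
Proof.
move=> hi c0; have [z ez] : exists z : X, val z = emb (nth \bot%O c i).
  by apply: emb_up; apply: (allP c0); apply: mem_nth.
exists z; rewrite -(wX_cons _ ez) -wX_cat; congr wX.
rewrite -{1}(cat_take_drop i c) (drop_nth \bot%O) // rev_cat rev_cons /=.
by rewrite cat_rcons.
Qed.

Section Evaluation.
Variables (y : P) (j : nat).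
Hypothesis ry : rk y = j.+1.
Implicit Types c : simplex y j.

Definition above i (c : seq P) := wX (y :: rev (drop i.+1 c)).
Definition beneath i (c : seq P) := wX (rev (take i c)).

Lemma chain_nonbot_simplex c : nonbot c.
Proof. exact: chain_nonbot (simplex_chain c). Qed.

Lemma nonbot_above i c : nonbot (y :: rev (drop i.+1 c)).
Proof.
rewrite /nonbot /= (y_neq0 ry) all_rev; apply/allP => z /mem_drop.
exact: (allP (chain_nonbot_simplex c)).
Qed.

Lemma nonbot_beneath i c : nonbot (rev (take i c)).
Proof.
rewrite /nonbot all_rev; apply/allP => z /mem_take.
exact: (allP (chain_nonbot_simplex c)).
Qed.

Lemma size_above i c : size (above i c) = (j - i.+1).+1.
Proof.
by rewrite size_wX ?nonbot_above //= size_rev size_drop simplex_size.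
Qed.

(** Removing the vertex of index i of a chain keeps the letters above and beneath
it, so the chains with the same face are those whose words differ in that letter
only. *)
Lemma face_cword i c0 c : (i < j)%N ->
  face i c = face i c0 <-> exists z, cword y c = above i c0 ++ z :: beneath i c0.
Proof.
move=> hi; have hic : (i < size c)%N by rewrite simplex_size.
have [z ez] := cword_split y hic (chain_nonbot_simplex c).
split=> [/eqP|[z']].
  rewrite /face eqseq_cat ?size_takel ?simplex_size 1?ltnW // => /andP[/eqP e1 /eqP e2].
  by exists z; rewrite ez /above /beneath -e1 -e2.
rewrite ez => /eqP; rewrite -/(above i c) eqseq_cat ?size_above //.
rewrite eqseq_cons => /and3P[/eqP e1 _ /eqP e2].
have [] := wX_inj (nonbot_above i c) (nonbot_above i c0) e1.
move=> /(congr1 rev); rewrite !revK => d1.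
have /(congr1 rev) := wX_inj (nonbot_beneath i c) (nonbot_beneath i c0) e2.
by rewrite !revK /face => -> ; rewrite d1.
Qed.

Definition eval_at (f : {ffun simplex y j -> F}) : A :=
  \sum_c f c *: word (cword y c).

End Evaluation.

Section Coboundaries.
Variables (y : P) (j : nat).
Hypothesis ry : rk y = j.+2.

Lemma face_chain i (c : simplex y j.+1) : (i < j.+1)%N ->
  exists c' : simplex y j, c' = face i c :> seq P.
Proof.
move=> hi; have sf : size (face i c) == j.
  rewrite /face size_cat size_takel ?size_drop simplex_size 1?ltnW //.
  by rewrite subSS subnKC.
have cf : chain_below y (face i c).
  have /andP[ss sy] := simplex_chain c; apply/andP; split.
    apply: (subseq_sorted lt_trans) ss; rewrite -{2}(cat_take_drop i c).
    apply: cat_subseq (subseq_refl _) _; rewrite [drop i _](drop_nth \bot%O) ?simplex_size //.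
    exact: subseq_cons.
  rewrite /face all_cat; apply/andP; split; apply/allP => z.
    by move/mem_take; apply: (allP sy).
  by move/mem_drop; apply: (allP sy).
by exists (@Simplex _ _ y j (Tuple sf) cf).
Qed.

(** By [face_index] a maximal chain has the given face for at most one index, so
only the sign of that index survives in the coboundary of the indicator of the
face. *)
Lemma coboundary_indicator i (c0 : simplex y j.+1) : (i < j.+1)%N ->
  exists g : {ffun simplex y j -> F}, forall c : simplex y j.+1,
    coboundary g c = (-1) ^+ i * (face i c == face i c0)%:R.
Proof.
move=> hi; have [c' ec'] := face_chain c0 hi.
exists [ffun x => (x == c')%:R] => c; rewrite ffunE.
rewrite (bigD1 (Ordinal hi)) //= [X in _ + X]big1 ?addr0 => [|i' ni].
  have [e|ne] := eqVneq (face i c) (face i c0).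
    rewrite (bigD1 c') /=; last by rewrite ec' e.
    rewrite ffunE eqxx big1 ?addr0 // => x /andP[_ /negPf xc'].
    by rewrite ffunE xc' mulr0.
  rewrite mulr0 big1 // => x /eqP ex; rewrite ffunE; case: eqP => [xc'|]; last by rewrite mulr0.
  by case/eqP: ne; rewrite -ex xc' ec'.
rewrite big1 // => x /eqP ex; rewrite ffunE; case: eqP => [xc'|]; last by rewrite mulr0.
case/eqP: ni; apply: val_inj => /=.
apply: (face_index (simplex_ranks ry c) (simplex_ranks ry c0) (ltn_ord i') hi).
by rewrite -ex xc' ec'.
Qed.

Lemma coboundary_lin (e : F) (g h : {ffun simplex y j -> F}) (c : simplex y j.+1) :
  coboundary [ffun x => e * g x + h x] c = e * coboundary g c + coboundary h c.
Proof.
rewrite !ffunE mulr_sumr -big_split; apply: eq_bigr => i _ /=.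
rewrite mulr_sumr -big_split; apply: eq_bigr => x _ /=.
by rewrite ffunE mulrDr mulrCA.
Qed.

End Coboundaries.

Lemma indicator_coboundary y j i (c0 : simplex y j) : rk y = j.+1 -> (i < j)%N ->
  exists2 f : {ffun simplex y j -> F}, is_coboundary f &
    forall c, f c = (-1) ^+ i * (face i c == face i c0)%:R.
Proof.
case: j c0 => // k c0 ry hi; have [g eg] := coboundary_indicator ry c0 hi.
by exists (coboundary g) => //; exists g.
Qed.

Lemma sorted_mid (u : seq X) (x z : X) v :
  sorted cov (u ++ x :: z :: v) -> cov x z.
Proof.
case: u => [|t u] /=; first by case/andP.
by rewrite cat_path /= => /andP[_ /and3P[]].
Qed.

Section EvaluationKernel.
Variables (y : P) (j : nat).
Hypothesis ry : rk y = j.+1.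
Local Notation cochain := {ffun simplex y j -> F^o}.

Lemma is_coboundary_lin (e : F) (f f' : cochain) :
  is_coboundary (f : {ffun simplex y j -> F}) ->
  is_coboundary (f' : {ffun simplex y j -> F}) ->
  is_coboundary (e *: f + f' : {ffun simplex y j -> F}).
Proof.
case: j f f' => [|k] f f' /=; first by move=> -> ->; rewrite scaler0 addr0.
move=> [g eg] [h eh]; exists [ffun x => e * g x + h x].
by apply/ffunP => c; rewrite coboundary_lin -eg -eh !ffunE.
Qed.

Lemma is_coboundary0 : is_coboundary (0 : {ffun simplex y j -> F}).
Proof.
case: (j) => [|k] //=; exists 0; apply/ffunP => c; rewrite !ffunE.
by rewrite big1 // => i _; rewrite big1 // => x _; rewrite ffunE mulr0.
Qed.

(** By the universal property with Z the coboundaries: the indicators of the words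
that occur in a relation add up to the coboundary of the indicator of a chain
with one gap, up to sign. *)
Lemma eval_at_coboundary (f : {ffun simplex y j -> F}) :
  eval_at f = 0 -> is_coboundary f.
Proof.
move=> e0; pose lam w : cochain := [ffun c : simplex y j => (cword y c == w)%:R].
pose w := [seq (f c, cword y (c : simplex y j)) | c : simplex y j].
have e1 : wsum word w = 0 by rewrite /wsum big_image; exact: e0.
have e2 : wsum lam w = f.
  rewrite /wsum big_image /=; apply/ffunP => c; rewrite sum_ffunE.
  rewrite (bigD1 c) //= big1 ?addr0 => [|c' nc].
    by rewrite !ffunE eqxx; apply: mulr1.
  rewrite !ffunE; case: eqP => [/(cword_inj ry) e|_]; last exact: mulr0.
  by case/eqP: nc.
rewrite -e2; move: w e1 {e2}.
apply: (pr_univ pr (Z := fun f : cochain => is_coboundary (f : {ffun simplex y j -> F}))).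
- exact: is_coboundary0.
- by move=> e a b; apply: is_coboundary_lin.
- move=> u x v; case: (pickP (fun c0 : simplex y j =>
      [exists z0, cword y c0 == u ++ x :: z0 :: v])) => [c0 /existsP[z0 /eqP ec]|no].
    have sz := cword_size ry c0; rewrite ec size_cat /= !addnS in sz.
    have hi : (size v < j)%N by case: sz => <-; rewrite ltnS leq_addl.
    have hic : (size v < size c0)%N by rewrite simplex_size.
    have [z1 e1] := cword_split y hic (chain_nonbot_simplex c0).
    rewrite ec -cat_rcons in e1; have /eqP := e1.
    have su : size (rcons u x) = size (above y (size v) c0).
      rewrite (size_above ry) size_rcons; case: sz => sz.
      by rewrite -sz subSS addnK.
    rewrite -/(above y (size v) c0) -/(beneath (size v) c0) (eqseq_cat _ _ su).
    rewrite eqseq_cons => /and3P[/eqP ea _ /eqP eb].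
    have [g cg eg] := indicator_coboundary c0 ry hi.
    rewrite (_ : \sum_(z | _) _ = (-1) ^+ size v *: (g : cochain) + 0); last first.
      rewrite addr0; apply/ffunP => c; rewrite sum_ffunE ffunE eg.
      rewrite [RHS]mulrA -exprD addnn -muln2 mulnC exprM sqrrN expr1n expr1n mul1r.
      have [/(face_cword ry _ _ hi)[z ez]|ne] := eqVneq (face (size v) c) (face (size v) c0).
        have ez' : cword y c = u ++ x :: z :: v by rewrite ez -ea -eb cat_rcons.
        have cz : covers (val x) (val z).
          by have := cword_sorted ry c; rewrite ez' => /sorted_mid.
        rewrite (bigD1 z) //= ffunE ez' eqxx big1 ?addr0 // => z' /andP[_ nz].
        rewrite ffunE ez'; case: eqP => // /eqP.
        by rewrite eqseq_cat // !eqseq_cons eqxx /= eq_sym (negPf nz) andbF.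
      rewrite big1 // => z _; rewrite ffunE; case: eqP => // ez.
      case/eqP: ne; apply/(face_cword ry _ _ hi); exists z.
      by rewrite ez -ea -eb cat_rcons.
    by apply: is_coboundary_lin => //; exact: is_coboundary0.
  rewrite big1; first exact: is_coboundary0.
  move=> z _; apply/ffunP => c; rewrite !ffunE; case: eqP => // e.
  by have /existsP[] := no c; exists z; rewrite e.
- move=> u x z v nxz; rewrite (_ : lam _ = 0); first exact: is_coboundary0.
  apply/ffunP => c; rewrite !ffunE; case: eqP => // e.
  by case/negP: nxz; have := cword_sorted ry c; rewrite e => /sorted_mid.
Qed.

End EvaluationKernel.

(** The letters that fit into the gap are those covered by the letter x above it, up
to letters for which the word vanishes; so the sum contains the relation of x. *)
Lemma face_sum0 y k (c' : simplex y k) i : rk y = k.+2 -> (i < k.+1)%N ->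
  \sum_(c : simplex y k.+1 | c' == face i c :> seq P) word (cword y c) = 0.
Proof.
move=> ry hi; case: (pickP (fun c : simplex y k.+1 => c' == face i c :> seq P)) =>
  [c0 /eqP e0|no]; last by rewrite big_pred0.
have [x0 ex0] := emb_up (y_neq0 ry).
have [u [x eu]] : exists u x, above y i c0 = rcons u x.
  rewrite /above (wX_cons _ ex0) lastI.
  by exists (belast x0 (wX (rev (drop i.+1 c0)))), (last x0 (wX (rev (drop i.+1 c0)))).
set v := beneath i c0.
(* Words vanish for those z covered by x that do not cover the letter beneath, so
   all z covered by x may be included. *)
have S0 : \sum_(z : X | covers (val x) (val z)) word (rcons u x ++ z :: v) = 0.
  under eq_bigr => z _ do rewrite word_cat word_cons mulrA.
  rewrite -mulr_suml -mulr_sumr -cats1 word_cat word_cons word_nil mulr1.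
  by rewrite -[X in X * word v]mulrA (pr_cov pr) mulr0 mul0r.
have single z : word (rcons u x ++ z :: v)
    = \sum_(c : simplex y k.+1 | cword y c == rcons u x ++ z :: v) word (cword y c).
  case: (pickP (fun c : simplex y k.+1 => cword y c == rcons u x ++ z :: v)).
    move=> c1 /eqP e1; rewrite (bigD1 c1) /=; last exact/eqP.
    rewrite e1 big1 ?addr0 // => c /andP[/eqP e nc].
    by case/eqP: nc; apply: (cword_inj ry); rewrite e e1.
  move=> no; rewrite big_pred0 //; apply: (word_unsorted pr); apply/negP => ss.
  have sv : size v = i.
    by rewrite /v size_wX ?nonbot_beneath // size_rev size_takel // simplex_size ltnW.
  have sr : size (wX (rev (drop i.+1 c0))) = (k - i)%N.
    apply: succn_inj; rewrite -[LHS]/(size (x0 :: _)) -(wX_cons _ ex0).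
    by rewrite -/(above y i c0) (size_above ry) subSS.
  rewrite -eu /above (wX_cons _ ex0) in ss no.
  have [|c1 e1] := cword_surj ry (ss : path cov x0 (_ ++ _)) ex0.
    by rewrite size_cat /= sr sv addnS subnK.
  by have := no c1; rewrite e1 eqxx.
rewrite -[RHS]S0 (eq_bigr _ (fun z _ => single z)) (exchange_big_dep predT) //= big_mkcond.
apply: eq_bigr => c _; case: eqP => [ec|ne].
  have [z ez] : exists z, cword y c = above y i c0 ++ z :: v.
    by apply/(face_cword ry); rewrite // -ec e0.
  have cz : covers (val x) (val z).
    by have := cword_sorted ry c; rewrite ez eu cat_rcons => /sorted_mid.
  rewrite (bigD1 z) /=; last by rewrite cz ez eu eqxx.
  rewrite big1 ?addr0 // => z' /andP[/andP[_ /eqP ez'] nz].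
  move: ez'; rewrite ez eu => /eqP; rewrite eqseq_cat // eqxx eqseq_cons.
  by rewrite eq_sym (negPf nz).
rewrite big1 // => z /andP[_ /eqP ez]; case: ne; rewrite e0.
by symmetry; apply/(face_cword ry) => //; exists z; rewrite ez eu.
Qed.

(** This identifies the top cohomology of the open interval below y with the part of
the algebra spanned by the words of maximal length with first letter y. *)
Lemma eval_at_eq0 y j (f : {ffun simplex y j -> F}) : rk y = j.+1 ->
  eval_at f = 0 <-> is_coboundary f.
Proof.
move=> ry; split; first exact: eval_at_coboundary.
case: j ry f => [|k] ry f /= => [->|[g ->]].
  by rewrite /eval_at big1 // => c _; rewrite ffunE scale0r.
rewrite /eval_at; under eq_bigr => c _.
  rewrite ffunE scaler_suml.
  under eq_bigr => i _ do rewrite scaler_suml big_mkcond.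
  over.
rewrite exchange_big big1 //= => i _; rewrite exchange_big big1 //= => c' _.
rewrite -big_mkcond -scaler_sumr face_sum0 ?scaler0 //.
Qed.

Lemma eval_at_lin y j (e : F) (f g : {ffun simplex y j -> F}) :
  eval_at [ffun c => e * f c + g c] = e *: eval_at f + eval_at g.
Proof.
rewrite /eval_at scaler_sumr -big_split; apply: eq_bigr => c _ /=.
by rewrite ffunE scalerDl scalerA.
Qed.

(** * The complex and left multiplication *)

Definition level k : {set X} := [set x | [exists p : P, (val x == emb p) && (rk p == k)]].

Lemma levelP k x : reflect (exists2 p : P, val x = emb p & rk p = k) (x \in level k).
Proof.
rewrite inE; apply: (iffP existsP) => [[p /andP[/eqP e /eqP rp]]|[p e rp]].
  by exists p.
by exists p; rewrite e rp !eqxx.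
Qed.

Definition eval n (s : Srep F P n) : A := \sum_(y : rank_level P n.+1) eval_at (s y).

Lemma rank_levelP k (y : rank_level P k) : rk (val y) = k.
Proof. exact/eqP/(valP y). Qed.

Lemma pj_eval_at C y j (x : X) (f : {ffun simplex y j -> F}) : val x = emb y ->
  head_part C (eval_at f) = if x \in C then eval_at f else 0.
Proof.
move=> ex; rewrite /eval_at linear_sum /=.
transitivity (\sum_c if x \in C then f c *: word (cword y c) else 0).
  apply: eq_bigr => c _; rewrite linearZ_LR /= /cword (wX_cons _ ex) pj_word.
  by case: ifP; rewrite ?scaler0.
by case: ifP => _ //; rewrite big1.
Qed.

Lemma eval_eq0 n (s : Srep F P n) : eval s = 0 <-> Sequiv s (@Szero F d' P n).
Proof.
have e0 (y : rank_level P n.+1) : is_coboundary (s y - @Szero F d' P n y) <-> eval_at (s y) = 0.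
  rewrite eval_at_eq0 ?rank_levelP //; suff -> : s y - @Szero F d' P n y = s y by [].
  by apply/ffunP => c; rewrite !ffunE subr0.
split=> [e y|h]; last by rewrite /eval big1 // => y _; apply/e0.
apply/e0; have [x ex] := emb_up (y_neq0 (rank_levelP y)).
have := congr1 (head_part [set x]) e; rewrite raddf0 /eval linear_sum (bigD1 y) //=.
rewrite (pj_eval_at _ _ ex) set11 big1 ?addr0 // => y' ny.
have [x' ex'] := emb_up (y_neq0 (rank_levelP y')).
rewrite (pj_eval_at _ _ ex') inE; case: eqP => // e'.
case/eqP: ny; apply/val_inj/emb_inj.
by rewrite -ex' e' ex.
Qed.

Lemma rs_level k : (0 < k)%N ->
  gen_sum (level k) = \sum_(y : rank_level P k) word (wX [:: val y]).
Proof.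
move=> k0; have y0 (y : rank_level P k) : val y != \bot%O.
  by rewrite -rk_gt0 rank_levelP.
transitivity (\sum_(z in level k) \sum_(y : rank_level P k | val z == emb (val y)) r z).
  apply: eq_bigr => z /levelP[p ez rp].
  have hp : rk p == k by apply/eqP.
  rewrite (bigD1 (exist _ p hp)) /=; last by apply/eqP.
  rewrite big1 ?addr0 // => y /andP[/eqP ey ny]; case/eqP: ny; apply/val_inj/emb_inj.
  by rewrite /= -ey.
rewrite (exchange_big_dep predT) //=; apply: eq_bigr => y _.
have [x ex] := emb_up (y0 y); rewrite (wX_cons _ ex) word_cons word_nil mulr1.
rewrite (bigD1 x) /=; last first.
  by rewrite ex eqxx andbT; apply/levelP; exists (val y); rewrite ?rank_levelP.
rewrite big1 ?addr0 // => z /andP[/andP[_ /eqP ez] nz].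
by case/eqP: nz; apply: val_inj; exact: etrans ez (esym ex).
Qed.

Lemma Sdiff_word n (y : rank_level P n.+2) (x : rank_level P n.+1)
    (c' : simplex (val x) n) : covers (val y) (val x) ->
  \sum_(c : simplex (val y) n.+1 | c == rcons c' (val x) :> seq P) word (cword (val y) c)
  = word (wX [:: val y]) * word (cword (val x) c').
Proof.
move=> cyx; have /andP[ss /allP sx] := simplex_chain c'.
have cc : chain_below (val y) (rcons c' (val x)).
  apply/andP; split.
    rewrite (sorted_pairwise lt_trans) pairwise_rcons -(sorted_pairwise lt_trans) ss.
    by rewrite andbT; apply/allP => u /sx/andP[].
  rewrite all_rcons (covers_lt cyx) lt0x -rk_gt0 rank_levelP /=.
  by apply/allP => u /sx/andP[-> ux]; apply: lt_trans ux (covers_lt cyx).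
have sz : size (rcons c' (val x)) == n.+1 by rewrite size_rcons simplex_size.
rewrite (bigD1 (@Simplex _ _ (val y) n.+1 (Tuple sz) cc)) //= big1 ?addr0 => [|c].
  by rewrite /cword /= rev_rcons -cat1s wX_cat word_cat.
by case/andP => /eqP e nc; case/eqP: nc; apply/val_inj/val_inj.
Qed.

(** The sum over the elements that cover the top of a chain can be extended to the
whole level, since the product of two letters without a cover relation is 0. *)
Lemma eval_Sdiff n (s : Srep F P n) :
  eval (Sdiff s) = (-1) ^+ n *: (gen_sum (level n.+2) * eval s).
Proof.
rewrite rs_level // /eval mulr_suml scaler_sumr; apply: eq_bigr => y _.
transitivity (\sum_(x : rank_level P n.+1 | covers (val y) (val x))
    \sum_(c' : simplex (val x) n) ((-1) ^+ n * s x c') *: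
      \sum_(c : simplex (val y) n.+1 | c == rcons c' (val x) :> seq P)
         word (cword (val y) c)).
  rewrite /eval_at; under eq_bigr => c _.
    rewrite ffunE scaler_suml; under eq_bigr => x _ do rewrite scaler_suml big_mkcond.
    over.
  rewrite exchange_big; apply: eq_bigr => x _; rewrite exchange_big.
  by apply: eq_bigr => c' _; rewrite -big_mkcond -scaler_sumr.
rewrite big_mkcond mulr_sumr scaler_sumr; apply: eq_bigr => x _.
rewrite /eval_at mulr_sumr scaler_sumr; case: ifP => cyx.
  apply: eq_bigr => c' _; rewrite Sdiff_word // -scalerA -scalerAr.
  by [].
rewrite big1 // => c' _.
have [v ev] := emb_up (y_neq0 (rank_levelP y)).
have [u eu] := emb_up (y_neq0 (rank_levelP x)).
rewrite (wX_cons _ ev) /cword (wX_cons _ eu) !word_cons word_nil mulr1 -scalerAr.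
rewrite mulrA (pr_ncov pr) ?mul0r ?scaler0 // ev eu.
by rewrite -covers_emb ?cyx // -rk_gt0 rank_levelP.
Qed.

Lemma eval_lin n (e : F) (s t : Srep F P n) :
  eval (fun y : rank_level P n.+1 => [ffun c => e * s y c + t y c]) = e *: eval s + eval t.
Proof.
rewrite /eval scaler_sumr -big_split; apply: eq_bigr => y _ /=.
exact: eval_at_lin.
Qed.

(** The words of the right length and first letter are those of maximal chains. *)
Lemma eval_surj n a : deg_part n.+1 a = a -> head_part (level n.+1) a = a ->
  exists s : Srep F P n, eval s = a.
Proof.
suff [s es] : exists s : Srep F P n, eval s = deg_part n.+1 (head_part (level n.+1) a).
  by move=> ha pa; exists s; rewrite es pa ha.
elim/(span_ind pr): a => [|e w a [s IH]].
  exists (fun y : rank_level P n.+1 => 0); rewrite !raddf0 /eval big1 // => y _.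
  by rewrite /eval_at big1 // => c _; rewrite ffunE scale0r.
suff [t et] : exists t : Srep F P n, eval t = deg_part n.+1 (head_part (level n.+1) (word w)).
  exists (fun y : rank_level P n.+1 => [ffun c => e * t y c + s y c]).
  by rewrite eval_lin et IH !linearP.
have zero : exists t : Srep F P n, eval t = 0.
  exists (fun y : rank_level P n.+1 => 0); rewrite /eval big1 // => y _.
  by rewrite /eval_at big1 // => c _; rewrite ffunE scale0r.
rewrite pj_word; case: w => [|x w]; first by rewrite raddf0.
case: ifP => [/levelP[p ex rp]|_]; last by rewrite raddf0.
rewrite hc_word; case: eqP => // -[sw].
have [pth|np] := boolP (path cov x w); last by rewrite (word_unsorted pr).
have hp : rk p == n.+1 by apply/eqP.
pose y0 : rank_level P n.+1 := exist _ p hp.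
have [c0 ec0] := cword_surj rp pth ex sw.
exists (fun y : rank_level P n.+1 =>
  [ffun c : simplex (val y) n => (cword (val y) c == x :: w)%:R]).
rewrite /eval (bigD1 y0) //= [X in _ + X]big1 ?addr0 => [|y ny]; last first.
  rewrite /eval_at big1 // => c _; rewrite ffunE; case: eqP => [e'|]; last first.
    by rewrite scale0r.
  case/eqP: ny; apply/val_inj/emb_inj.
  have [x' ex'] := emb_up (y_neq0 (rank_levelP y)).
  by move: e'; rewrite /cword (wX_cons _ ex') => -[e1 _]; rewrite -ex' e1 ex.
rewrite /eval_at (bigD1 c0) //= big1 ?addr0 => [|c nc].
  by rewrite ffunE ec0 eqxx scale1r.
rewrite ffunE; case: eqP => [e'|_]; last by rewrite scale0r.
by case/eqP: nc; apply: (cword_inj rp); rewrite e' ec0.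
Qed.

Lemma eval_level n (s : Srep F P n) :
  deg_part n.+1 (eval s) = eval s /\ head_part (level n.+1) (eval s) = eval s.
Proof.
have in_level (y : rank_level P n.+1) x : val x = emb (val y) -> x \in level n.+1.
  by move=> ex; apply/levelP; exists (val y); rewrite ?rank_levelP.
rewrite /eval !linear_sum; split; apply: eq_bigr => y _ /=.
  rewrite /eval_at linear_sum; apply: eq_bigr => c _ /=.
  by rewrite linearZ_LR /= hc_word (cword_size (rank_levelP y)) eqxx.
have [x ex] := emb_up (y_neq0 (rank_levelP y)).
by rewrite (pj_eval_at _ _ ex) (in_level _ _ ex).
Qed.

Lemma level_covers k (x z : X) : (0 < k)%N -> x \in level k.+1 ->
  covers (val x) (val z) -> z \in level k.
Proof.
move=> k0 /levelP[p ex rp] cxz; have p0 : p != \bot%O by rewrite -rk_gt0 rp.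
have rz : (rk (val z)).+1 = (k + m)%N.
  by apply: succn_inj; rewrite -(rk_covers rG cxz) ex (rk_emb p0) rp addSn.
have mz : (m <= rk (val z))%N.
  by rewrite -ltnS rz -{1}[m]add0n ltn_add2r.
have [q eq] : exists q, emb q = val z.
  by apply: (emb_down (p := p)) => //; rewrite -ex ltW // covers_lt.
apply/levelP; exists q => //; have q0 : q != \bot%O.
  apply: contraTneq mz => q0.
  by rewrite -eq q0 emb_bot rk_bot // -ltnNge.
by apply/eqP; rewrite -(eqn_add2r m) -rk_emb // eq rz.
Qed.

Lemma eval_equiv n (s t : Srep F P n) : Sequiv s t <-> eval s = eval t.
Proof.
pose u : Srep F P n := fun y : rank_level P n.+1 => [ffun c => -1 * t y c + s y c].
have eu : eval u = 0 <-> eval s = eval t.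
  rewrite eval_lin scaleN1r addrC; split=> [/eqP|->]; last exact: subrr.
  by rewrite subr_eq0 => /eqP.
rewrite -eu eval_eq0; suff e (y : rank_level P n.+1) : u y - @Szero F d' P n y = s y - t y.
  by split=> h y; have := h y; rewrite e.
by apply/ffunP => c; rewrite !ffunE subr0 mulN1r addrC.
Qed.

Lemma rs_level_pj k b : (0 < k)%N -> aug b = 0 ->
  gen_sum (level k.+1) * b = gen_sum (level k.+1) * head_part (level k) b.
Proof.
move=> k0 b0; have [c e] := first_letters pr b; rewrite b0 scale0r add0r in e.
rewrite /gen_sum !mulr_suml; apply: eq_bigr => x xl.
rewrite e linear_sum !mulr_sumr; apply: eq_bigr => z _ /=.
rewrite pj_rM; case: ifP => // nz; rewrite mulr0 mulrA.
rewrite (pr_ncov pr) ?mul0r //; apply: contraFN nz; exact: level_covers.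
Qed.

(** Both cocycles and coboundaries translate through [eval]. An arbitrary factor b
can be replaced by its component of degree k - 1 with first letters in the level
below, as no other part of it contributes to the product in degree k. *)
Lemma HS_vanishesP k : (1 < k)%N -> HS_vanishes F P k.-1 <->
  forall a, deg_part k a = a -> head_part (level k) a = a -> gen_sum (level k.+1) * a = 0 ->
    exists b, a = gen_sum (level k) * b.
Proof.
case: k => [|[|k]] // _; split=> [HS a ha pa ka|h s _ e].
  have [s es] := eval_surj ha pa.
  have e0 : eval (Sdiff s) = 0 by rewrite eval_Sdiff es ka scaler0.
  have sm : Smem s by move=> x; exact: top_cocycle (rank_levelP x) _.
  have /= [t _ /eval_equiv et] := HS s sm ((eval_eq0 _).1 e0).
  by exists ((-1) ^+ k *: eval t); rewrite -es et eval_Sdiff scalerAr.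
have [hs ps] := eval_level s.
have ks : gen_sum (level k.+3) * eval s = 0.
  move/eval_eq0: e; rewrite eval_Sdiff => /eqP; rewrite scaler_eq0.
  by rewrite signr_eq0 => /eqP.
have [b eb] := h _ hs ps ks.
pose b1 := head_part (level k.+1) (deg_part k.+1 b).
have b1E : eval s = gen_sum (level k.+2) * b1.
  rewrite /b1 -rs_level_pj //; last by apply: hc_aug_gt0.
  by rewrite -(hc_rsM pr) -eb hs.
have [||t et] := @eval_surj k ((-1) ^+ k *: b1).
- by rewrite linearZ_LR /= /b1 -pj_hc hc_hc eqxx.
- by rewrite linearZ_LR /= /b1 pj_pj.
exists t; first by move=> x; exact: top_cocycle (rank_levelP x) _.
apply/eval_equiv; rewrite eval_Sdiff et b1E -scalerAr scalerA -exprD addnn.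
by rewrite -muln2 mulnC exprM sqrrN expr1n expr1n scale1r.
Qed.

End Truncation.

(** * Maximally linked sets are the sets above a linkage class *)

Section MaximallyLinked.
Context {d : Order.disp_t} {G : finBPOrderType d}.
Local Notation X := (plus G).
Hypothesis rk_cov : forall a b : G, covers a b -> rk a = (rk b).+1.
Variables (n : nat) (W : {set X}).
Hypothesis W_rk : forall s, s \in W -> rk (val s) = n.
Hypothesis n_gt1 : (1 < n)%N.

Let rk_lt := rank_fun_lt rk_cov.
(** The elements of W that cover some element of the class of z; if W covers z, then
conversely the class consists of the elements that they cover. *)
Definition above_cls (z : X) : {set X} :=
  [set s in W | [exists v in cls W z, covers (val s) (val v)]].

Lemma above_clsP z s : reflect (s \in W /\ exists2 v, v \in cls W z & covers (val s) (val v))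
  (s \in above_cls z).
Proof.
rewrite inE; apply: (iffP andP) => -[sW h]; split=> //.
  by case/existsP: h => v /andP[]; exists v.
by case: h => v vz sv; apply/existsP; exists v; rewrite vz.
Qed.

Lemma cls_covered z u v s : u \in cls W z -> s \in W -> covers (val s) (val u) ->
  covers (val s) (val v) -> v \in cls W z.
Proof.
rewrite !inE => zu sW su sv; apply: connect_trans zu (connect1 _).
by apply/existsP; exists s; rewrite sW su sv.
Qed.

Lemma cls_has_cover z v : (exists2 s, s \in W & covers (val s) (val z)) ->
  v \in cls W z -> exists2 s, s \in W & covers (val s) (val v).
Proof.
move=> hz; rewrite inE => /connectP[p]; elim: p z hz => [|w p IH] z hz /=.
  by move=> _ ->.
case/andP => /existsP[s /and3P[sW _ sw]] pth e; apply: IH pth e.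
by exists s.
Qed.

Lemma trunc1P (U : {set X}) a : U \subset W -> a \in trunc n U 1 ->
  (exists2 s, s \in U & a = val s) \/
  (exists2 s, s \in U & covers (val s) a) /\ rk a = n.-1.
Proof.
move=> /subsetP UW; rewrite inE => /andP[/existsP[s /andP[sU]]].
rewrite le_eqVlt => /orP[/eqP -> _|ls hr]; first by left; exists s.
have := rk_lt ls; rewrite W_rk ?UW // => r_a.
have ra : rk a = n.-1 by apply/anti_leq; rewrite -subn1 hr andbT subn1 -ltnS prednK // ltnW.
right; split=> //; exists s => //; apply: (rank_fun_covers rk_cov) => //.
by rewrite W_rk ?UW // ra prednK // ltnW.
Qed.

Lemma mem_trunc1 (U : {set X}) s : U \subset W -> s \in U -> val s \in trunc n U 1.
Proof.
move=> UW sU; rewrite inE (W_rk (subsetP UW s sU)) leq_subr andbT.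
by apply/existsP; exists s; rewrite sU lexx.
Qed.

Lemma mem_trunc1_cov (U : {set X}) s a : U \subset W -> s \in U ->
  covers (val s) a -> a \in trunc n U 1.
Proof.
move=> UW sU sa; rewrite inE -(W_rk (subsetP UW s sU)) (rk_cov sa) subn1 leqnn andbT.
by apply/existsP; exists s; rewrite sU ltW ?covers_lt.
Qed.

Let edge (U : {set X}) := [rel u v : G | [&& u \in trunc n U 1, v \in trunc n U 1
  & covers u v || covers v u]].

Let edge_sym U : symmetric (edge U).
Proof. by move=> u v /=; rewrite andbCA orbC. Qed.

(** Every element is joined to an element of the class of z, and consecutive elements
of a linkage path are joined through a common cover. *)
Lemma above_cls_linked z : (exists2 s, s \in W & covers (val s) (val z)) ->
  linked n (above_cls z).
Proof.
move=> hz; have UW : above_cls z \subset W by apply/subsetP => s; rewrite inE => /andP[].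
set U := above_cls z.
have e1 s v : s \in U -> covers (val s) v -> connect (edge U) (val s) v.
  move=> sU sv; apply: connect1; rewrite /= sv /= mem_trunc1 //=.
  by rewrite (mem_trunc1_cov UW sU sv).
have csym := sym_connect_sym (@edge_sym U).
have inU s v : s \in W -> v \in cls W z -> covers (val s) (val v) -> s \in U.
  by move=> sW vz sv; apply/above_clsP; split=> //; exists v.
have toz v : v \in cls W z -> connect (edge U) (val v) (val z).
  rewrite csym inE => /connectP[p pth ->].
  suff h q : q \in cls W z -> path (link W) q p -> connect (edge U) (val q) (val (last q p)).
    by apply: h pth; exact: cls_id.
  elim: p q {pth v} => [|w p IH] q qz /=; first by rewrite connect0.
  case/andP => /existsP[s /and3P[sW sq sw]] /IH IHw.
  have wz := cls_covered qz sW sq sw; have sU := inU s q sW qz sq.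
  apply: (connect_trans _ (IHw wz)); apply: (connect_trans (y := val s)).
    by rewrite csym; apply: e1.
  exact: e1.
have stoz s : s \in U -> connect (edge U) (val s) (val z).
  move=> sU; have /above_clsP[_ [v vz sv]] := sU.
  by apply: connect_trans (toz v vz); apply: e1.
have atoz a : a \in trunc n U 1 -> connect (edge U) a (val z).
  move=> /(trunc1P UW)[[s sU ->]|[[s sU sa] _]]; first exact: stoz.
  by apply: connect_trans (stoz s sU); rewrite csym; apply: e1.
apply/forall_inP => a aU; apply/forall_inP => b bU.
by apply: connect_trans (atoz a aU) _; rewrite csym; apply: atoz.
Qed.

(** Along a path of the graph, elements of W and elements covered by them alternate;
the former stay above the class of z and the latter stay in it. *)
Lemma linked_sub_above (U : {set X}) s0 z : U \subset W -> linked n U -> s0 \in U ->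
  covers (val s0) (val z) -> U \subset above_cls z.
Proof.
move=> UW lU s0U s0z; apply/subsetP => s sU; have sW := subsetP UW s sU.
(* The invariant along the path; elements of W have rank n, the others n - 1. *)
pose I (a : G) := (forall t : X, t \in W -> a = val t -> t \in above_cls z) /\
  (forall v : X, rk a = n.-1 -> a = val v -> v \in cls W z).
have nn : n.-1 <> n by move=> e; have := ltn_predL n; rewrite e ltnn (ltnW n_gt1).
have /connectP[p pth e] := forall_inP (forall_inP lU _ (mem_trunc1 UW s0U)) _
  (mem_trunc1 UW sU).
suff [h _] : I (last (val s0) p) by apply: h => //; rewrite -e.
have : I (val s0).
  split=> [t tW /val_inj <-|v r0 _]; last by case: nn; rewrite -r0 W_rk // (subsetP UW).
  apply/above_clsP; split; first exact: (subsetP UW).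
  by exists z; [exact: cls_id|].
elim: p (val s0) pth {e} => //= b p IH a /andP[/and3P[aU bU ab] pth] Ia.
apply: IH pth _; have {aU bU} := (trunc1P UW aU, trunc1P UW bU).
case=> aP bP; case/orP: ab => [ab|ba].
  have ra := rk_cov ab.
  have rb : rk b = n.-1.
    case: bP => [[t tU eb]|[_ //]]; exfalso.
    have := ra; rewrite eb (W_rk (subsetP UW t tU)).
    case: aP => [[t' t'U ->]|[_ ->]].
      by rewrite (W_rk (subsetP UW _ t'U)) => /eqP; rewrite eqn_leq ltnn andbF.
    by move=> e; have := leq_pred n; rewrite e ltnn.
  split=> [t tW et|v _ ev]; first by case: nn; rewrite -rb et W_rk.
  have [t tU ea] : exists2 t, t \in U & a = val t.
    case: aP => // -[_ e]; have := ra; rewrite e rb => /eqP.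
    by rewrite eqn_leq ltnn andbF.
  have tW := subsetP UW t tU.
  have /above_clsP[_ [u uz tu]] := Ia.1 t tW ea.
  by apply: (cls_covered uz tW tu); rewrite -ea -ev.
have rb := rk_cov ba.
have [t tU eb] : exists2 t, t \in U & b = val t.
  case: bP => // -[_ e]; exfalso; move: rb; rewrite e.
  case: aP => [[t' t'U ->]|[_ ->]].
    by rewrite (W_rk (subsetP UW _ t'U)) => e'; have := leq_pred n; rewrite e' ltnn.
  by move/eqP; rewrite eqn_leq ltnn andbF.
have tW := subsetP UW t tU.
have ra : rk a = n.-1.
  by move: rb; rewrite eb W_rk // => ->.
split=> [t' t'W et'|v rv _]; last by case: nn; rewrite -rv eb W_rk.
have -> : t' = t by apply: val_inj; rewrite -et' eb.
have [v ev] : exists v : X, a = val v.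
  have a0 : a != \bot%O.
    case: aP => [[u _ ->]|[_ _]]; first exact: (valP u).
    apply/eqP => a0; have := ra; rewrite a0 rk_bot => /eqP.
    by rewrite eq_sym -subn1 subn_eq0 leqNgt n_gt1.
  by exists (Plus a0).
apply/above_clsP; split=> //; exists v; first exact: (Ia.2 v ra ev).
by rewrite -eb -ev.
Qed.

Lemma maximally_linkedP (U : {set X}) : W != set0 ->
  maximally_linked n W U <->
  exists2 z, (exists2 s, s \in W & covers (val s) (val z)) & U = above_cls z.
Proof.
move=> W0; have sub z : above_cls z \subset W.
  by apply/subsetP => s; rewrite inE => /andP[].
have below s : s \in W -> exists z : X, covers (val s) (val z).
  move=> sW; have := W_rk sW; have [a ca _] : exists2 a, covers (val s) a & (\bot <= a)%O.
    by apply: lower_cover; rewrite lt0x (valP s).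
  rewrite (rk_cov ca) => ra; have a0 : a != \bot%O.
    by apply/eqP => a0; move: n_gt1; rewrite -ra a0 rk_bot ltnn.
  by exists (Plus a0).
split=> [/maxsetP[/andP[UW lU] mx]|[z [s0 s0W s0z] ->]].
  have [s0 s0U] : exists s, s \in U.
    apply/set0Pn; apply: contra_neq W0 => U0; apply/eqP; rewrite -subset0.
    apply/subsetP => s sW; have [z sz] := below s sW.
    have hz : exists2 s, s \in W & covers (val s) (val z) by exists s.
    rewrite -U0 -(mx (above_cls z)) ?U0 ?sub0set //; last first.
      by rewrite sub above_cls_linked.
    by apply/above_clsP; split=> //; exists z; rewrite ?cls_id.
  have [z sz] := below s0 (subsetP UW s0 s0U); exists z.
    by exists s0; rewrite // (subsetP UW).
  apply/esym/mx; last exact: linked_sub_above lU s0U sz.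
  by rewrite sub above_cls_linked //; exists s0; rewrite // (subsetP UW).
apply/maxsetP; split; first by rewrite sub above_cls_linked //; exists s0.
move=> D /andP[DW lD] UD; apply/eqP; rewrite eqEsubset UD andbT.
apply: linked_sub_above (s0z) => //; apply: (subsetP UD).
by apply/above_clsP; split=> //; exists z; rewrite ?cls_id.
Qed.

End MaximallyLinked.

(** * Subposets and intervals *)

Section Subposet.
Context {d : Order.disp_t} {G : finBPOrderType d} (S : {set G}).

Lemma subposet_le (p q : subposet S) :
  (subposet_val p <= subposet_val q)%O = (p <= q)%O.
Proof. exact: (Order.le_val p q). Qed.

Lemma subposet_lt (p q : subposet S) :
  (subposet_val p < subposet_val q)%O = (p < q)%O.
Proof. by rewrite !lt_neqAle subposet_le. Qed.

Lemma subposet_val0 : subposet_val (\bot%O : subposet S) = \bot%O.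
Proof. by []. Qed.

Lemma subposet_mem (p : subposet S) : p != \bot%O -> subposet_val p \in S.
Proof.
move=> p0; have /orP[/eqP e|//] := valP p.
by case/eqP: p0; apply: val_inj; rewrite /= [LHS]e.
Qed.

Lemma subposet_surj a : a \in S -> exists p : subposet S, subposet_val p = a.
Proof.
move=> aS; have h : (a == \bot%O) || (a \in S) by rewrite aS orbT.
by exists (SubPoset h).
Qed.

End Subposet.

Section Interval.
Context {d : Order.disp_t} {G : finBPOrderType d} (x : plus G).
Hypothesis rG : ranked G.
Local Notation Gx := (below x).
Local Notation vx := (@subposet_val d G [set y | (y <= val x)%O]).

Lemma below_le (p : Gx) : (vx p <= val x)%O.
Proof.
have [->|/subposet_mem] := eqVneq p \bot%O; last by rewrite inE.
by rewrite subposet_val0 le0x.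
Qed.

Lemma below_surj a : (a <= val x)%O -> exists p : Gx, vx p = a.
Proof. by move=> ax; apply: subposet_surj; rewrite inE. Qed.

Lemma below_covers (p q : Gx) : covers p q = covers (vx p) (vx q).
Proof.
rewrite /covers subposet_lt; case: (boolP (q < p)%O) => //= qp.
apply/forallP/forallP => h z; apply/negP => /andP[qz zp]; last first.
  by have := h (vx z); rewrite !subposet_lt qz zp.
have [u eu] := below_surj (ltW (lt_le_trans zp (below_le p))).
by have := h u; rewrite -!subposet_lt eu qz zp.
Qed.

Lemma below_rk (p : Gx) : rk p = rk (vx p).
Proof.
apply: (rank_fun_unique (rho := fun p : Gx => rk (vx p))).
  by rewrite subposet_val0 rk_bot.
by move=> a b; rewrite below_covers => /(rk_covers rG).
Qed.

Lemma below_rk_covers (p q : Gx) : covers p q -> rk p = (rk q).+1.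
Proof. by rewrite below_covers !below_rk => /(rk_covers rG). Qed.

Lemma lft_subproof (u : plus Gx) : vx (val u) != \bot%O.
Proof.
apply/eqP => e; have /eqP := valP u; apply.
by apply: val_inj; rewrite [LHS]e.
Qed.

Definition lft (u : plus Gx) : plus G := Plus (lft_subproof u).

Lemma lft_val u : val (lft u) = vx (val u).
Proof. by []. Qed.

Lemma lft_covers (u v : plus Gx) : covers (val (lft u)) (val (lft v)) = covers (val u) (val v).
Proof. by rewrite below_covers. Qed.

Lemma lft_surj (z : plus G) : (val z <= val x)%O -> exists u, lft u = z.
Proof.
move=> zx; have [p ep] := below_surj zx.
have p0 : p != \bot%O.
  by apply/eqP => p0; have := valP z; rewrite -[X in X != _]ep p0 subposet_val0 eqxx.
by exists (Plus p0); apply: val_inj.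
Qed.

Lemma lft_top : lft (below_top x) = x.
Proof. exact: val_inj. Qed.

Lemma lft_link (W : {set plus Gx}) u v : link (lft @: W) (lft u) (lft v) = link W u v.
Proof.
apply/existsP/existsP => -[s /andP[sW]].
  case/imsetP: sW => t tW ->; rewrite !lft_covers => h.
  by exists t; rewrite tW.
by move=> h; exists (lft s); rewrite imset_f // !lft_covers.
Qed.

Lemma link_lft (W : {set plus Gx}) z v : link (lft @: W) z v -> exists u, lft u = v.
Proof.
case/existsP => s /and3P[/imsetP[t _ ->] _ sv]; apply: lft_surj.
by apply: le_trans (below_le (val t)); rewrite ltW // covers_lt.
Qed.

Lemma lft_cls (W : {set plus Gx}) z : lft @: cls W z = cls (lft @: W) (lft z).
Proof.
apply/setP => v; apply/imsetP/idP => [[u]|].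
  rewrite !inE => /connectP[p pth ->] ->; apply/connectP.
  exists (map lft p); last by rewrite last_map.
  elim: p z pth => //= w p IH z /andP[zw /IH ->].
  by rewrite lft_link zw.
rewrite inE => /connectP[p pth e].
suff [q qE] : exists q, map lft q = p.
  exists (last z q); last by rewrite e -qE last_map.
  rewrite inE; apply/connectP; exists q => //; move: pth; rewrite -qE {e qE}.
  by elim: q z => //= w q IH z /andP[]; rewrite lft_link => -> /IH.
elim: p z {e} pth => [|w p IH] z /=; first by exists [::].
case/andP => /link_lft[u <-] /IH[q <-].
by exists (u :: q).
Qed.

Section Tsets.
Variable F : fieldType.

(** An interval contains everything covered by its elements, so linkage classes of
covered elements are the same in the interval and in G. *)
Lemma Tset_reach n W : Tset F (below_top x) n W ->
  [/\ reach (lft @: W), W != set0 & forall s, s \in W -> rk (val s) = n].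
Proof.
elim=> [|i {}W s z i1 _ [rW _ Wn] sW sz].
  split; last by move=> s /set1P ->.
    rewrite imset_set1 lft_top -cls0; exact: reach_cls reach0.
  by apply/set0Pn; exists (below_top x); rewrite set11.
rewrite classWE lft_cls; split; first exact: reach_cls.
  by apply/set0Pn; exists z; exact: cls_id.
move=> v vz; have hz : exists2 s, s \in W & covers (val s) (val z) by exists s.
have [t tW tv] := cls_has_cover hz vz.
by have := below_rk_covers tv; rewrite Wn // => -[].
Qed.

End Tsets.
End Interval.

Arguments lft {d G x} u.

(** A class of elements that no element of the preceding set covers is a singleton,
and the construction starts again at this element. *)
Lemma reach_Tset (F : fieldType) (d : Order.disp_t) (G : finBPOrderType d)
    (rG : ranked G) (W : {set plus G}) : reach W ->
  W = set0 \/ exists (x : plus G) n (W0 : {set plus (below x)}),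
    Tset F (below_top x) n W0 /\ W = lft @: W0.
Proof.
have single z : exists (x : plus G) n (W0 : {set plus (below x)}),
    Tset F (below_top x) n W0 /\ [set z] = lft @: W0.
  exists z, (rk (val (below_top z))), [set below_top z].
  by split; [exact: Tset_top | rewrite imset_set1 lft_top].
elim=> [|V z _ IH]; [by left | right].
case: IH => [->|[x [n [W0 [TW0 ->]]]]]; first by rewrite cls0.
have [rW W0n Wn] := Tset_reach rG TW0.
have [/existsP[s /andP[sW sz]]|no] :=
    boolP [exists s in lft @: W0, covers (val s) (val z)]; last first.
  suff -> : cls (lft @: W0) z = [set z] by exact: single.
  apply/setP => v; rewrite !inE; apply/connectP/eqP => [[[|y p] /=]|->].
  - by move=> _ ->.
  - case/andP => /existsP[s /and3P[sW sz _]]; case/existsP: no.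
    by exists s; rewrite sW.
  - by exists [::].
case/imsetP: sW => t tW es; rewrite es in sz.
have [u eu] : exists u : plus (below x), lft u = z.
  apply: lft_surj; apply: le_trans (below_le (val t)).
  by rewrite ltW // covers_lt.
rewrite -eu lft_covers in sz; rewrite -eu -lft_cls.
case: n TW0 Wn => [|i] TW0 Wn; first by have := below_rk_covers rG sz; rewrite Wn.
exists x, i, (cls W0 u); split=> //; rewrite -(classWE F).
apply: (Tset_step _ TW0 tW sz).
have := below_rk_covers rG sz; rewrite Wn // => -[->].
by rewrite -(rk_bot (P := below x)) (rank_fun_lt (below_rk_covers rG)) // lt0x (valP u).
Qed.

(** * Weakly Cohen-Macaulay posets and linear annihilators *)

Section TruncatedInterval.
Context {d : Order.disp_t} {G : finBPOrderType d}.
Hypothesis rG : ranked G.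
Variables (x : plus G) (n k : nat) (U : {set plus (below x)}).
Hypothesis U_rk : forall s, s \in U -> rk (val s) = n.
Hypotheses (k_gt0 : (0 < k)%N) (k_ltn : (k < n)%N).

Local Notation P := (subposet (trunc n U k)).

Definition trunc_emb (p : P) : G := subposet_val (subposet_val p).

Lemma trunc_emb_le p q : (trunc_emb p <= trunc_emb q)%O = (p <= q)%O.
Proof. by rewrite /trunc_emb !subposet_le. Qed.

Lemma trunc_emb_bot : trunc_emb \bot%O = \bot%O.
Proof. by []. Qed.

Lemma trunc_emb_rk p : p != \bot%O -> (n - k <= rk (trunc_emb p))%N.
Proof. by move/subposet_mem; rewrite inE (below_rk rG) => /andP[]. Qed.

Lemma trunc_emb_down p a : (a <= trunc_emb p)%O -> (n - k <= rk a)%N ->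
  exists q, trunc_emb q = a.
Proof.
move=> ap ra; have p0 : p != \bot%O.
  apply: contraTneq ra => p0; move: ap; rewrite p0 trunc_emb_bot lex0 => /eqP ->.
  by rewrite rk_bot -ltnNge subn_gt0.
have := subposet_mem p0; rewrite inE => /andP[/existsP[s /andP[sU ps]] _].
have [q eq] := below_surj (le_trans ap (below_le (subposet_val p))).
have [|t et] := @subposet_surj _ _ (trunc n U k) q; last by exists t; rewrite /trunc_emb et.
rewrite inE (below_rk rG) eq ra andbT; apply/existsP; exists s; rewrite sU.
apply: le_trans ps; rewrite -subposet_le eq; exact: ap.
Qed.

Lemma trunc_le_top p : p != \bot%O -> exists2 s, s \in U & (trunc_emb p <= val (lft s))%O.
Proof.
move/subposet_mem; rewrite inE => /andP[/existsP[s /andP[sU ps]] _].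
by exists s; rewrite // lft_val subposet_le.
Qed.

Lemma trunc_surj_top s : s \in U -> exists p : P, trunc_emb p = val (lft s).
Proof.
move=> sU; have [|p ep] := @subposet_surj _ _ (trunc n U k) (val s); last first.
  by exists p; rewrite /trunc_emb ep.
by rewrite inE (U_rk sU) leq_subr andbT; apply/existsP; exists s; rewrite sU lexx.
Qed.

Let m_gt0 : (0 < n - k)%N. Proof. by rewrite subn_gt0. Qed.

Let rkE p : p != \bot%O -> (rk (trunc_emb p)).+1 = (rk p + (n - k))%N.
Proof.
exact: (rk_emb rG m_gt0 trunc_emb_le trunc_emb_bot trunc_emb_rk trunc_emb_down).
Qed.

Let rk0 (p : P) : (0 < rk p)%N = (p != \bot%O).
Proof.
exact: (rk_gt0 rG m_gt0 trunc_emb_le trunc_emb_bot trunc_emb_rk trunc_emb_down).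
Qed.

Let lft_rk s : s \in U -> rk (val (lft s)) = n.
Proof. by move=> sU; rewrite -(U_rk sU) (below_rk rG). Qed.

Lemma level_top : level trunc_emb k.+1 = lft @: U.
Proof.
apply/setP => z; apply/levelP/imsetP => [[p ez rp]|[s sU ->]].
  have p0 : p != \bot%O by rewrite -rk0 rp.
  have [s sU] := trunc_le_top p0; rewrite le_eqVlt => /orP[/eqP es|lt].
    by exists s => //; apply: val_inj; rewrite [LHS]ez.
  have := rank_fun_lt (rk_covers rG) lt; rewrite (lft_rk sU) -ltnS (rkE p0) rp.
  by rewrite addSn subnKC ?(ltnW k_ltn) // ltnn.
have [p ep] := trunc_surj_top sU; exists p; first by rewrite ep.
have p0 : p != \bot%O.
  by apply/eqP => p0; have := valP (lft s); rewrite -[X in X != _]ep p0 trunc_emb_bot eqxx.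
apply/eqP; rewrite -(eqn_add2r (n - k)) -(rkE p0) ep (lft_rk sU).
by rewrite addSn subnKC // ltnW.
Qed.

Lemma level_below_top (z : plus G) : z \in level trunc_emb k <->
  exists2 s, s \in lft @: U & covers (val s) (val z).
Proof.
split=> [/levelP[p ez rp]|[s]]; last first.
  rewrite -level_top; move=> sU cz.
  exact: (level_covers rG m_gt0 trunc_emb_le trunc_emb_bot trunc_emb_rk trunc_emb_down
    k_gt0 sU cz).
have p0 : p != \bot%O by rewrite -rk0 rp.
have [s sU] := trunc_le_top p0; rewrite -ez => zs.
have rz : (rk (val z)).+1 = n by rewrite ez (rkE p0) rp subnKC // ltnW.
exists (lft s); first exact: imset_f.
apply: (rank_fun_covers (rk_covers rG)); last by rewrite rz (lft_rk sU).
rewrite lt_neqAle zs andbT; apply/eqP => e; move: rz.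
by rewrite e (lft_rk sU) => /eqP; rewrite eqn_leq ltnn.
Qed.

End TruncatedInterval.

Section Main.
Variables (F : fieldType) (d : Order.disp_t) (G : finBPOrderType d).
Local Notation X := (plus G).
Variables (A : algType F) (grA : nat -> A -> Prop) (aug : {rmorphism A -> F}).
Variable r : X -> A.
Hypothesis pr : presented grA aug r.
Hypothesis rG : ranked G.
Local Notation deg_part := (deg_part pr).
Local Notation head_part := (head_part pr).
Local Notation gen_sum := (gen_sum r).
Local Notation inK := (inK aug r).

Section OneSet.
Variables (x : plus G) (n : nat) (W0 : {set plus (below x)}).
Hypothesis TW0 : Tset F (below_top x) n W0.
Local Notation W := (lft @: W0).

Let W0_rk s : s \in W0 -> rk (val s) = n.
Proof. by case: (Tset_reach rG TW0) => _ _; apply. Qed.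

Lemma above_sub z : above_cls W0 z \subset W0.
Proof. by apply/subsetP => s; rewrite inE => /andP[]. Qed.

(** [HS_vanishesP] speaks of the elements killed by the maximally linked subset U. The
other elements of W cover nothing in the class of z, so they kill all words
with first letter in this class, and U can be replaced by W. *)
Lemma HS_above k z : (1 < k)%N -> (k < n)%N ->
  (exists2 s, s \in W0 & covers (val s) (val z)) ->
  HS_vanishes F (subposet (trunc n (above_cls W0 z) k)) k.-1 <->
  (forall a, deg_part k a = a -> head_part (cls W (lft z)) a = a -> gen_sum W * a = 0 ->
    exists b, a = gen_sum (cls W (lft z)) * b).
Proof.
move=> k1 kn hz; set U := above_cls W0 z; set C := cls W (lft z).
have U_rk s : s \in U -> rk (val s) = n by move=> sU; apply/W0_rk/(subsetP (above_sub z)).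
have k0 : (0 < k)%N by exact: ltnW.
have m0 : (0 < n - k)%N by rewrite subn_gt0.
have topE := level_top rG U_rk kn.
have levE : level (@trunc_emb _ _ x n k U) k = C.
  apply/setP => v; rewrite /C -lft_cls.
  apply/idP/idP => [/(level_below_top rG U_rk k0 kn)|]; last first.
    case/imsetP => u uz ->; have [s sW su] := cls_has_cover hz uz.
    apply/(level_below_top rG U_rk k0 kn); exists (lft s); last by rewrite lft_covers.
    by apply/imset_f/above_clsP; split=> //; exists u.
  case=> _ /imsetP[s /above_clsP[sW [u uz su]] ->] sv.
  have [v' ev] : exists v' : plus (below x), lft v' = v.
    apply: lft_surj; apply: le_trans (below_le (val s)).
    by rewrite ltW // covers_lt.
  rewrite -ev imset_f // (cls_covered uz sW su) //.
  by rewrite -lft_covers ev.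
have HSP := HS_vanishesP pr rG m0 (@trunc_emb_le _ _ x n k U)
  (@trunc_emb_bot _ _ x n k U) (trunc_emb_rk rG (U := U)) (trunc_emb_down rG kn (U := U)) k1.
rewrite HSP topE levE.
have kill a : deg_part k a = a -> head_part C a = a ->
    gen_sum (lft @: U) * a = 0 <-> gen_sum W * a = 0.
  move=> ha pa; rewrite !(rs_eq0 pr); split=> h s; last first.
    by move/imsetP => [t tU ->]; apply/h/imset_f/(subsetP (above_sub z)).
  case/imsetP => t tW ->; have [tU|tU] := boolP (t \in U); first exact/h/imset_f.
  have a0 : aug a = 0 by rewrite -ha; apply: hc_aug_gt0.
  have [b eb] := pj_sum pr C a0; rewrite -pa eb mulr_sumr big1 // => v vC.
  rewrite mulrA (pr_ncov pr) ?mul0r //; apply: contra tU => tv.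
  move: vC; rewrite /C -lft_cls => /imsetP[u uz ev].
  apply/above_clsP; split=> //; exists u => //.
  by rewrite -lft_covers -ev.
by split=> h a ha pa ka; apply: h => //; apply/kill.
Qed.

End OneSet.

(** In an expression of an annihilator by class sums, only the summand of the class of
z has its first letters there. *)
Lemma wCM_of_lin_ann : (forall W, reach W -> lin_ann aug r W) ->
  weakly_Cohen_Macaulay F G.
Proof.
move=> lin x k n U k2 kn nx [W0 TW0 mU].
have [rW W0n W0_rk] := Tset_reach rG TW0.
have [z hz ->] := (maximally_linkedP (below_rk_covers rG) W0_rk
  (leq_trans k2 (ltnW kn)) U W0n).1 mU.
apply/(HS_above TW0 k2 kn hz) => a ha pa ka.
have a0 : aug a = 0 by rewrite -ha; apply: hc_aug_gt0; apply: ltnW.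
have [b eb] := lin _ rW a (conj a0 ka).
exists (b (cls (lft @: W0) (lft z))).
by rewrite -[LHS]pa eb pj_linspan // cls_clss.
Qed.

(** Nonzero words go down by covers, so they are no longer than the rank of their
first letter. *)
Lemma hc_large (C : {set X}) k a : (forall z, z \in C -> (rk (val z) < k)%N) ->
  deg_part k (head_part C a) = 0.
Proof.
move=> hC; elim/(span_ind pr): a => [|e w a IH]; first by rewrite !raddf0.
rewrite !linearP IH addr0 pj_word /=; case: w => [|y w].
  by rewrite raddf0 scaler0.
case: ifP => [yC|_]; last by rewrite raddf0 scaler0.
rewrite hc_word; case: eqP => [sw|_]; last by rewrite scaler0.
rewrite (word_unsorted pr) ?scaler0 //; apply: contraL (hC y yC) => /= pth.
rewrite -leqNgt -sw /=; elim: w y pth {sw yC} => [|v w IHw] y /=.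
  by move=> _; rewrite -(rk_bot (P := G)) (rank_fun_lt (rk_covers rG)) // lt0x (valP y).
by case/andP => /(rk_covers rG) -> /IHw.
Qed.

(** An annihilator is the sum of its parts with first letters in the various classes,
and each part is again an annihilator because an element of W covers elements of
one class at most. The parts in degree k with 1 < k < n are multiples of the
class sum by hypothesis. *)
Lemma lin_ann_of_wCM : weakly_Cohen_Macaulay F G ->
  forall W, reach W -> lin_ann aug r W.
Proof.
move=> wCM W rW a Ka; apply: (linspan_homog (pr := pr)) => k.
have {Ka} := inK_hc pr k Ka.
have : deg_part k (deg_part k a) = deg_part k a by rewrite hc_hc eqxx.
move: (deg_part k a) => {}a ha Ka.
have a0 : aug a = 0 by case: Ka.
rewrite (pj_clss_sum pr W a0); apply: linspan_sum => C CW.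
have unlinked : (forall s z, s \in W -> z \in C -> ~~ covers (val s) (val z)) ->
    linspan r W (head_part C a).
  move=> nc; have [b eb] := pj_sum pr C a0.
  have [z eC] : exists z, C = [set z].
    case/imsetP: CW nc => z _ -> nc; exists z; apply/setP => v; rewrite !inE.
    apply/connectP/eqP => [[[|y p] /=]|->]; [by move=> _ -> | | by exists [::]].
    case/andP => /existsP[s /and3P[sW sz _]].
    by have := nc s z sW (cls_id W z); rewrite sz.
  rewrite eb eC big_set1.
  have -> : r z * b z = gen_sum C * b z by rewrite eC /gen_sum big_set1.
  exact: linspan_rs.
have [W_0|[x [n [W0 [TW0 eW]]]]] := reach_Tset F rG rW.
  by apply: unlinked => s z; rewrite W_0 inE.
have [_ W0n W0_rk] := Tset_reach rG TW0.
have [/existsP[z /andP[zC /existsP[s /andP[sW sz]]]]|no] :=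
    boolP [exists z in C, exists s in W, covers (val s) (val z)]; last first.
  apply: unlinked => s z sW zC; apply: contra no => sz.
  by apply/existsP; exists z; rewrite zC; apply/existsP; exists s; rewrite sW.
have Ca : head_part C (head_part C a) = head_part C a by exact: pj_pj.
have hCa : deg_part k (head_part C a) = head_part C a by rewrite -pj_hc ha.
have W_rk t : t \in W -> rk (val t) = n.
  by rewrite eW => /imsetP[u uW ->]; rewrite -(W0_rk u uW) (below_rk rG).
have noncov t (D : {set X}) :
    (forall v, v \in D -> ~~ covers (val t) (val v)) -> r t * head_part D a = 0.
  move=> nc; have [b ->] := pj_sum pr D a0; rewrite mulr_sumr big1 // => v vD.
  by rewrite mulrA (pr_ncov pr) ?mul0r // nc.
have CE v : v \in C -> C = cls W v by exact: clss_mem.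
have KCa : gen_sum W * head_part C a = 0.
  apply/(rs_eq0 pr) => t tW; have [_ /(rs_eq0 pr)/(_ t tW) ta] := Ka.
  have [/existsP[v /andP[vC tv]]|nc] := boolP [exists v in C, covers (val t) (val v)];
    last first.
    apply: noncov => v vC; apply: contra nc => tv.
    by apply/existsP; exists v; rewrite vC.
  rewrite -ta [in RHS](pj_clss_sum pr W a0) (bigD1 C) //= mulrDr mulr_sumr.
  rewrite big1 ?addr0 // => D /andP[DW nDC]; apply: noncov => u uD.
  apply: contra nDC => tu; rewrite (clss_mem DW uD) (CE v vC) -mem_cls inE connect1 //.
  by apply/existsP; exists t; rewrite tW tv.
case: k => [|[|k]] in ha hCa *.
- rewrite -hCa hc0 (pj_aug pr) scale0r; exact: linspan0.
- apply: (linspan_degree1 (pr := pr)) => //; split=> //; exact: pj_aug.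
have hz : exists2 s, s \in W & covers (val s) (val z) by exists s.
have [kn|nk] := ltnP k.+2 n; last first.
  rewrite -hCa hc_large; first exact: linspan0.
  move=> v; rewrite (CE z zC) => /(cls_has_cover hz)[t tW tv].
  by apply: leq_trans nk; rewrite -(W_rk t tW) (rk_covers rG tv).
have [s0 s0W es] : exists2 s0, s0 \in W0 & s = lft s0 by move: sW; rewrite eW => /imsetP.
have sx : (val s <= val x)%O by rewrite es; exact: below_le.
have [z0 ez] : exists z0 : plus (below x), lft z0 = z.
  by apply: lft_surj; apply: le_trans sx; rewrite ltW // covers_lt.
have hz0 : exists2 s, s \in W0 & covers (val s) (val z0).
  by exists s0 => //; rewrite -lft_covers ez -es.
have nx : (n <= rk (val x))%N.
  by rewrite -(W_rk s sW) (rank_fun_le (rk_covers rG)).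
have M : Mset F (below_top x) n (above_cls W0 z0).
  exists W0 => //; apply/(maximally_linkedP (below_rk_covers rG) W0_rk _ _ W0n).
    exact: leq_trans (ltnW kn).
  by exists z0.
have := wCM x k.+2 n _ isT kn nx M; rewrite (HS_above TW0 _ kn hz0) // ez -eW -(CE z zC).
move/(_ (head_part C a) hCa Ca KCa) => [b ->]; exact: linspan_rs.
Qed.

End Main.

Theorem theorem1p5 (F : fieldType) (d : Order.disp_t) (G : finBPOrderType d)
    (G_ranked : ranked G) (G_cyclic : cyclic_poset G) :
  weakly_Cohen_Macaulay F G
  <-> Koszul (@Rgr F d G) (@Raug F d G).
Proof.
have pr := @Ralg_presented F d G.
split=> [wCM|/(lin_ann_of_Koszul pr)]; last exact: (wCM_of_lin_ann pr G_ranked).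
exact/(Koszul_of_lin_ann pr)/(lin_ann_of_wCM pr G_ranked).
Qed.
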